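(* Let $A>0$ be a parameter such that $A \gg N^{-1/4}$. Then $$\sum_{N \leq k \leq 2\sqrt{2}N}\frac{d(k)}{k^{1/6}}e^{3\pi i(Ak)^{2/3}} =\sqrt{3}\,A^{-4/3} \sum_{A^{4/3}N^{1/3} \leq k \leq \sqrt{2}A^{4/3}N^{1/3}}d(k)k^{1/2}e^{-\pi i (k/A)^2}+O\left(A^{-1/3}N^{1/2+\varepsilon}\right) + O\left(A^{1/3}N^{1/6} \log N\right)+O\left(A^{-1/9}N^{2/9+\varepsilon}\right),$$ and moreover $$\sum_{N \leq k \leq 2\sqrt{2}N}\frac{d(k)}{k^{1/6}}e^{3\pi i(Ak)^{2/3}} \ll A^{2/3}N^{1/2} \log N.$$
   Context: $d(n)=\sum_{n=d_1d_2}1$ is the divisor function (number of positive divisors of $n$). $N$ is a large positive number, and the sums run over positive integers $k$ in the indicated ranges. $\varepsilon$ denotes an arbitrarily small positive number, which need not be the same at each occurrence; implied constants may depend on $\varepsilon$ and on the implied constant in $A\gg N^{-1/4}$, but are otherwise uniform in $A$ and $N$. *)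

(* Defs.v *)
(* Stdlib reals, with Coquelicot's complex numbers and finite sums *)
From Stdlib Require Export Reals List.
From Coquelicot Require Export Coquelicot.
Open Scope R_scope.

(** The number of pairs [(d1, d2)] of positive integers with [d1 * d2 = n]. *)
Definition d (n : nat) : nat :=
  length (filter (fun p : nat * nat => Nat.eqb (fst p * snd p) n)
                 (list_prod (seq 1 n) (seq 1 n))).

(** [cis t] is exp(i t). *)
Definition cis (t : R) : C := (cos t, sin t).

(** The sum of [f k] over the positive integers [k] with [a <= k <= b];
    since [b < IZR (up b)], stopping at [up b] loses no term. *)
Definition sum_between (a b : R) (f : nat -> C) : C :=
  sum_n_m
    (fun k : nat =>
       if Rle_dec a (INR k)
       then if Rle_dec (INR k) b then f k else RtoC 0
       else RtoC 0)
    1 (Z.to_nat (up b)).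

(* Main.v *)
Require Import Defs.
From Stdlib Require Import Reals List.
From Coquelicot Require Import Coquelicot.
From Stdlib Require Import Arith ZArith Lra Lia Psatz.
Open Scope R_scope.

(** The Voronoi-type identity comes from applying van der Corput's B-process twice. Write the sum over [k] as a sum
    over pairs [n <= m] with [n * m = k]. For fixed [n], Poisson summation and stationary phase in [m] turn
    [e(3/2 (A n m)^(2/3))] into a sum over frequencies [nu] with the quadratic phase [e(A^2 n^2 / (2 nu^2))]; for fixed
    [nu], the reciprocity formula for incomplete Gauss sums turns the sum over [n] into a sum over [mu] with phase
    [e(- (mu nu / A)^2 / 2)], and the region [n <= m], [X <= n m <= Y] becomes exactly [nu <= mu],
    [X <= (mu nu)^3 / A^4 <= Y]. All phases are real cosines with a free shift [phi], so real and imaginary parts are the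
    cases [phi = 0] and [phi = PI / 2].

    The error is [O((A^(1/3) N^(1/6) + N^(1/3)) ln N)], which is enough for both claims: an endpoint of the [m]-sum costs
    [min(lambda^(-1/2), 1 / |f' - nu|)], and these terms are summed over [n] using that the endpoint frequencies are well
    spaced. The Gauss sum step uses the reciprocity from the [mu]-side, which saves a logarithm when [A] is large. *)

(** * Finite sums *)

(** The estimate is first proved without the weight [k^(-1/6)], uniformly in the upper end of the
    range; the dual sum then carries the weight [k]. Partial summation against [x^(-1/6)], taken at
    [x = k] on one side and at [x = k^3 / A^4] on the other, inserts both weights of the theorem at
    once, since [(k^3 / A^4)^(-1/6) = A^(2/3) k^(-1/2)].

    The condition [A >> N^(-1/4)] says that [A^(2/3) N^(1/6)], the order of the number of
    frequencies, is bounded below, so that rounding it up to an integer costs a constant factor. The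
    term [N^(1/3) ln N] of the error is absorbed by [A^(-1/3) N^(1/2+eps)] when [A <= N^(1/2)] and
    by [A^(1/3) N^(1/6) ln N] otherwise. The same threshold serves the upper bound: below it the
    dual sum is bounded trivially, above it the original sum.

    Poisson summation is obtained from partial sums of the sawtooth series, whose error is
    integrated explicitly, and the Fresnel constants stay unknown until the B-process itself
    determines them. *)

Fixpoint rsum (n : nat) (F : nat -> R) : R :=
  match n with O => 0 | S k => rsum k F + F (S k) end.

Lemma div_le_iff a b c : 0 < c -> (a / c <= b <-> a <= b * c).
Proof.
  intros hc; split; intros H.
  - apply Rmult_le_reg_r with (/ c); [now apply Rinv_pos|]. rewrite Rmult_assoc, Rinv_r by lra. lra.
  - apply Rmult_le_reg_r with c; auto. unfold Rdiv. rewrite Rmult_assoc, Rinv_l by lra. lra.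
Qed.

Lemma le_div_iff a b c : 0 < c -> (a <= b / c <-> a * c <= b).
Proof.
  intros hc; split; intros H.
  - apply Rmult_le_reg_r with (/ c); [now apply Rinv_pos|]. rewrite Rmult_assoc, Rinv_r by lra. lra.
  - apply Rmult_le_reg_r with c; auto. unfold Rdiv. rewrite Rmult_assoc, Rinv_l by lra. lra.
Qed.

(** Both ends are closed and an empty interval gives 0, so a summation range can be rewritten
    exactly through [cut_iff], with no care for boundary terms. *)
Definition cut (a b x : R) : R :=
  if Rle_dec a x then if Rle_dec x b then 1 else 0 else 0.

Lemma cut_in a b x : a <= x <= b -> cut a b x = 1.
Proof. intros [H1 H2]; unfold cut; repeat destruct Rle_dec; lra. Qed.

Lemma cut_out a b x : x < a \/ b < x -> cut a b x = 0.
Proof. intros H; unfold cut; repeat destruct Rle_dec; lra. Qed.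

Lemma cut_cases a b x :
  (a <= x <= b /\ cut a b x = 1) \/ ((x < a \/ b < x) /\ cut a b x = 0).
Proof. unfold cut; repeat destruct Rle_dec; try lra; left; lra. Qed.

Lemma cut_bound a b x : 0 <= cut a b x <= 1.
Proof. destruct (cut_cases a b x) as [[_ ->]|[_ ->]]; lra. Qed.

Lemma cut_iff a b x a' b' x' :
  (a <= x <= b <-> a' <= x' <= b') -> cut a b x = cut a' b' x'.
Proof.
  intros H; destruct (cut_cases a b x) as [[h ->]|[h ->]];
  destruct (cut_cases a' b' x') as [[h' ->]|[h' ->]]; try reflexivity; lra.
Qed.

Lemma rsum_ext n F G :
  (forall k, (1 <= k <= n)%nat -> F k = G k) -> rsum n F = rsum n G.
Proof.
  induction n as [|n IH]; intros H; simpl; [reflexivity|].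
  rewrite IH, (H (S n)); auto; [lia|intros; apply H; lia].
Qed.

Lemma rsum_plus n F G : rsum n (fun k => F k + G k) = rsum n F + rsum n G.
Proof. induction n; simpl; lra. Qed.

Lemma rsum_minus n F G : rsum n (fun k => F k - G k) = rsum n F - rsum n G.
Proof. induction n; simpl; lra. Qed.

Lemma rsum_scal n c F : rsum n (fun k => c * F k) = c * rsum n F.
Proof. induction n as [|n IH]; simpl; [|rewrite IH]; lra. Qed.

Lemma rsum_scal_r n c F : rsum n (fun k => F k * c) = rsum n F * c.
Proof. induction n as [|n IH]; simpl; [|rewrite IH]; lra. Qed.

Lemma rsum_const n c : rsum n (fun _ => c) = INR n * c.
Proof. induction n as [|n IH]; [simpl; lra|]. rewrite S_INR; simpl; lra. Qed.

Lemma rsum_le n F G :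
  (forall k, (1 <= k <= n)%nat -> F k <= G k) -> rsum n F <= rsum n G.
Proof.
  induction n as [|n IH]; intros H; simpl; [lra|].
  assert (F (S n) <= G (S n)) by (apply H; lia).
  assert (rsum n F <= rsum n G) by (apply IH; intros; apply H; lia). lra.
Qed.

Lemma rsum_zero n F : (forall k, (1 <= k <= n)%nat -> F k = 0) -> rsum n F = 0.
Proof. intros H; rewrite (rsum_ext n F (fun _ => 0)), rsum_const by auto; ring. Qed.

Lemma rsum_nonneg n F : (forall k, (1 <= k <= n)%nat -> 0 <= F k) -> 0 <= rsum n F.
Proof.
  intros H; replace 0 with (rsum n (fun _ => 0)) by (rewrite rsum_const; ring).
  now apply rsum_le.
Qed.

Lemma rsum_abs n F : Rabs (rsum n F) <= rsum n (fun k => Rabs (F k)).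
Proof.
  induction n as [|n IH]; simpl; [rewrite Rabs_R0; lra|].
  eapply Rle_trans; [apply Rabs_triang|lra].
Qed.

Lemma rsum_abs_le n F G :
  (forall k, (1 <= k <= n)%nat -> Rabs (F k) <= G k) -> Rabs (rsum n F) <= rsum n G.
Proof. intros H; eapply Rle_trans; [apply rsum_abs|now apply rsum_le]. Qed.

Lemma rsum_dist_le n F G E :
  (forall k, (1 <= k <= n)%nat -> Rabs (F k - G k) <= E k) ->
  Rabs (rsum n F - rsum n G) <= rsum n E.
Proof. intros H; rewrite <- rsum_minus; now apply rsum_abs_le. Qed.

Lemma rsum_swap n p F :
  rsum n (fun i => rsum p (fun j => F i j)) = rsum p (fun j => rsum n (fun i => F i j)).
Proof.
  induction n as [|n IH]; simpl.
  - now rewrite rsum_zero.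
  - now rewrite IH, rsum_plus.
Qed.

Lemma rsum_widen n p F :
  (n <= p)%nat -> (forall k, (n < k <= p)%nat -> F k = 0) -> rsum p F = rsum n F.
Proof.
  induction 1 as [|p Hp IH]; intros H; [reflexivity|].
  simpl; rewrite IH, (H (S p)) by (intros; try apply H; lia); ring.
Qed.

Lemma rsum_mono_len n p F :
  (n <= p)%nat -> (forall k, (1 <= k <= p)%nat -> 0 <= F k) -> rsum n F <= rsum p F.
Proof.
  induction 1 as [|p Hp IH]; intros H; [lra|].
  simpl; assert (0 <= F (S p)) by (apply H; lia).
  assert (rsum n F <= rsum p F) by (apply IH; intros; apply H; lia). lra.
Qed.

Lemma rsum_single n p F :
  (1 <= p <= n)%nat -> (forall k, (1 <= k <= n)%nat -> k <> p -> F k = 0) -> rsum n F = F p.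
Proof.
  induction n as [|n IH]; intros Hp H; [lia|]. simpl.
  destruct (Nat.eq_dec p (S n)) as [->|Hne].
  - rewrite rsum_zero; [ring|]. intros; apply H; lia.
  - rewrite IH, (H (S n)) by (intros; try apply H; lia). ring.
Qed.

Lemma rsum_rev n F : rsum n F = rsum n (fun k => F (S n - k)%nat).
Proof.
  assert (Hs : forall m G, rsum (S m) G = G 1%nat + rsum m (fun k => G (S k))).
  { induction m as [|m IH]; intros G; [simpl; ring|].
    change (rsum (S (S m)) G) with (rsum (S m) G + G (S (S m))).
    rewrite IH; simpl; ring. }
  revert F; induction n as [|n IH]; intros F; [reflexivity|].
  rewrite (Hs n (fun k => F (S (S n) - k)%nat)).
  simpl rsum at 1. rewrite (IH F).
  rewrite Rplus_comm; reflexivity.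
Qed.

(** * Harmonic sums and sums over well spaced points *)

Definition harm (n : nat) : R := rsum n (fun k => / INR k).

Lemma INR_ge1 k : (1 <= k)%nat -> 1 <= INR k.
Proof. intros H; apply (le_INR 1); lia. Qed.

Lemma harm_nonneg n : 0 <= harm n.
Proof.
  apply rsum_nonneg; intros k Hk. left; apply Rinv_pos.
  assert (1 <= INR k) by (apply INR_ge1; lia); lra.
Qed.

Lemma harm_ge1 n : (1 <= n)%nat -> 1 <= harm n.
Proof.
  intros H. assert (h : harm 1 <= harm n).
  { apply rsum_mono_len; [lia|]. intros k Hk. left; apply Rinv_pos.
    assert (1 <= INR k) by (apply INR_ge1; lia); lra. }
  unfold harm in h at 1; simpl in h; lra.
Qed.

Lemma harm_mono n p : (n <= p)%nat -> harm n <= harm p.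
Proof.
  intros H; apply rsum_mono_len; auto. intros k Hk. left; apply Rinv_pos.
  assert (1 <= INR k) by (apply INR_ge1; lia); lra.
Qed.

(** This is [ln y <= y - 1] at [y = x / (x + 1)]. *)
Lemma inv_le_ln_step x : 0 < x -> / (x + 1) <= ln (x + 1) - ln x.
Proof.
  intros Hx.
  assert (H : ln (x / (x + 1)) <= x / (x + 1) - 1).
  { assert (Hp : 0 < x / (x + 1)) by (apply Rdiv_lt_0_compat; lra).
    generalize (exp_ineq1_le (ln (x / (x + 1)))). rewrite exp_ln by auto. lra. }
  rewrite ln_div in H by lra.
  replace (x / (x + 1) - 1) with (- / (x + 1)) in H by (field; lra). lra.
Qed.

(** The first [k >= p] costs at most 1, being a positive integer, and the others telescope against
    [ln]. The bound sees only the ratio [q / p], which later stays under control however large [A]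
    is; a full harmonic sum would bring in [ln A]. *)
Lemma sum_inv_cut_le K p q : 0 < p -> p <= q ->
  rsum K (fun k => cut p q (INR k) * / INR k) <= 1 + ln (q / p).
Proof.
  intros Hp Hq.
  assert (Hpos : 0 <= ln (q / p)).
  { rewrite <- ln_1; apply ln_le; [lra|].
    apply Rmult_le_reg_r with p; [lra|]; field_simplify; lra. }
  (* The induction needs the bound at the last index reached, [Rmin (INR K) q], and 0 as long as no
     index has reached [p]. *)
  assert (H : rsum K (fun k => cut p q (INR k) * / INR k) <=
     if Rle_dec p (INR K) then 1 + ln (Rmin (INR K) q / p) else 0).
  { induction K as [|K IH]; [simpl; destruct Rle_dec; lra|].
    cbn [rsum].
    assert (Hk := pos_INR K). rewrite S_INR in *.
    destruct (cut_cases p q (INR K + 1)) as [[h ->]|[h ->]].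
    - rewrite (Rmin_left (INR K + 1)) by lra.
      destruct (Rle_dec p (INR K + 1)); [|lra].
      destruct (Rle_dec p (INR K)) as [h'|h'].
      + rewrite Rmin_left in IH by lra.
        rewrite ln_div in * by lra.
        assert (Hs := inv_le_ln_step (INR K)). lra.
      + assert (0 <= ln ((INR K + 1) / p)).
        { rewrite <- ln_1; apply ln_le; [lra|].
          apply Rmult_le_reg_r with p; [lra|]; field_simplify; lra. }
        assert (/ (INR K + 1) <= 1).
        { rewrite <- Rinv_1 at 2; apply Rinv_le_contravar; lra. }
        lra.
    - destruct (Rle_dec p (INR K)), (Rle_dec p (INR K + 1)); try lra.
      + assert (ln (Rmin (INR K) q / p) <= ln (Rmin (INR K + 1) q / p)); [|lra].
        apply ln_le.
        * apply Rdiv_lt_0_compat; auto. apply Rmin_glb_lt; lra.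
        * unfold Rdiv; apply Rmult_le_compat_r; [left; apply Rinv_pos; lra|].
          unfold Rmin; repeat destruct Rle_dec; lra.
      + rewrite Rmin_right by lra. lra. }
  destruct Rle_dec as [h|h]; [|lra].
  assert (ln (Rmin (INR K) q / p) <= ln (q / p)); [|lra].
  apply ln_le.
  - apply Rdiv_lt_0_compat; auto. apply Rmin_glb_lt; lra.
  - unfold Rdiv; apply Rmult_le_compat_r; [left; apply Rinv_pos; lra|]. apply Rmin_r.
Qed.

Lemma harm_le_ln n x : 1 <= x -> INR n <= x -> harm n <= 1 + ln x.
Proof.
  intros Hx Hn. replace (harm n) with (rsum n (fun k => cut 1 x (INR k) * / INR k)).
  - eapply Rle_trans; [apply sum_inv_cut_le; lra|]. rewrite Rdiv_1_r; lra.
  - apply rsum_ext; intros k Hk. rewrite cut_in; [ring|]. split.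
    + apply INR_ge1; lia.
    + apply Rle_trans with (INR n); auto. apply le_INR; lia.
Qed.

(** The terms nearest to [z] on either side are bounded by [T], the [j]-th next ones by [/ (delta * j)]. *)
Lemma spaced_sum K (b t : nat -> R) z delta T :
  0 < delta -> 0 <= T ->
  (forall i j, (1 <= i)%nat -> (i <= j <= K)%nat -> delta * (INR j - INR i) <= b j - b i) ->
  (forall k, (1 <= k <= K)%nat -> t k <= T) ->
  (forall k, (1 <= k <= K)%nat -> z <> b k -> t k <= / Rabs (b k - z)) ->
  rsum K t <= 2 * T + 2 / delta * harm K.
Proof.
  intros Hd HT Hsp Ht1 Ht2.
  (* Spacing makes [b] increasing, so the indices with [b k <= z] form an initial segment. *)
  assert (Hex : exists p, (p <= K)%nat /\ (forall k, (1 <= k <= p)%nat -> b k <= z) /\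
                (forall k, (p < k <= K)%nat -> z < b k)).
  { clear Ht1 Ht2. induction K as [|K IH]; [exists 0%nat; repeat split; intros; lia|].
    destruct IH as (p & H1 & H2 & H3); [intros; apply Hsp; lia|].
    destruct (Rle_dec (b (S K)) z) as [h|h].
    - exists (S K); split; [lia|split; [|intros; lia]]. intros k Hk.
      assert (Hs := Hsp k (S K)). assert (INR k <= INR (S K)) by (apply le_INR; lia).
      assert (0 <= delta * (INR (S K) - INR k)) by (apply Rmult_le_pos; lra).
      assert (delta * (INR (S K) - INR k) <= b (S K) - b k) by (apply Hs; lia). lra.
    - exists p; split; [lia|split; auto]. intros k Hk.
      destruct (Nat.eq_dec k (S K)) as [->|]; [lra|]. apply H3; lia. }
  destruct Hex as (p & Hp & Hlo & Hhi).
  assert (Hd' : 0 < / delta) by now apply Rinv_pos.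
  assert (Hsplit : rsum K t = rsum p t + rsum (K - p) (fun k => t (p + k)%nat)).
  { replace K with (p + (K - p))%nat at 1 by lia. generalize (K - p)%nat as q.
    induction q as [|q IH]; [rewrite Nat.add_0_r; simpl; ring|].
    rewrite Nat.add_succ_r; simpl; rewrite IH, Nat.add_succ_r; ring. }
  assert (Hhalf : forall q (s : nat -> R), (q <= K)%nat ->
     (forall k, (1 <= k <= q)%nat -> s k <= T) ->
     (forall k, (1 < k <= q)%nat -> s k <= / delta * / INR (k - 1)) ->
     rsum q s <= T + / delta * harm K).
  { intros q s Hq Hs1 Hs2. destruct q as [|q].
    - simpl. assert (0 <= / delta * harm K) by (apply Rmult_le_pos; [lra|apply harm_nonneg]). lra.
    - assert (Hx : rsum (S q) s <= T + / delta * harm q).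
      { clear Hsplit. induction q as [|q IH].
        - unfold harm; simpl. assert (s 1%nat <= T) by (apply Hs1; lia). lra.
        - change (rsum (S (S q)) s) with (rsum (S q) s + s (S (S q))).
          unfold harm; cbn [rsum]; fold (harm q).
          assert (rsum (S q) s <= T + / delta * harm q).
          { apply IH; [lia| |]; intros; [apply Hs1|apply Hs2]; lia. }
          assert (s (S (S q)) <= / delta * / INR (S (S q) - 1)) by (apply Hs2; lia).
          replace (S (S q) - 1)%nat with (S q) in * by lia. cbn [rsum] in *. lra. }
      assert (/ delta * harm q <= / delta * harm K); [|lra].
      apply Rmult_le_compat_l; [lra|]. apply harm_mono; lia. }
  (* Reversed, the left part also lists its points outward from [z]. *)
  rewrite Hsplit, rsum_rev.
  assert (H1 : rsum p (fun k => t (S p - k)%nat) <= T + / delta * harm K).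
  { apply Hhalf; [lia| |]; intros k Hk; [apply Ht1; lia|].
    set (i := (S p - k)%nat).
    assert (Hg : delta * (INR p - INR i) <= b p - b i) by (apply Hsp; lia).
    assert (Hb : b p <= z) by (apply Hlo; lia).
    rewrite <- minus_INR in Hg by lia. replace (p - i)%nat with (k - 1)%nat in Hg by (unfold i; lia).
    assert (Hk1 : 1 <= INR (k - 1)) by (apply INR_ge1; lia).
    assert (Hpos : 0 < delta * INR (k - 1)) by (apply Rmult_lt_0_compat; lra).
    rewrite <- Rinv_mult. eapply Rle_trans; [apply Ht2; [lia|lra]|].
    apply Rinv_le_contravar; auto. rewrite Rabs_left by lra. lra. }
  assert (H2 : rsum (K - p) (fun k => t (p + k)%nat) <= T + / delta * harm K).
  { apply Hhalf; [lia| |]; intros k Hk; [apply Ht1; lia|].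
    assert (Hg : delta * (INR (p + k) - INR (p + 1)) <= b (p + k)%nat - b (p + 1)%nat) by (apply Hsp; lia).
    assert (Hb : z < b (p + 1)%nat) by (apply Hhi; lia).
    rewrite <- minus_INR in Hg by lia. replace (p + k - (p + 1))%nat with (k - 1)%nat in Hg by lia.
    assert (Hk1 : 1 <= INR (k - 1)) by (apply INR_ge1; lia).
    assert (Hpos : 0 < delta * INR (k - 1)) by (apply Rmult_lt_0_compat; lra).
    rewrite <- Rinv_mult. eapply Rle_trans; [apply Ht2; [lia|lra]|].
    apply Rinv_le_contravar; auto. rewrite Rabs_right by lra. lra. }
  lra.
Qed.

(** * Integration by parts and the sawtooth series *)

Lemma is_derive_cont (f : R -> R) x l : is_derive f x l -> continuous f x.
Proof. intros H; apply (ex_derive_continuous f); now exists l. Qed.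

Lemma ex_derive_cont (f : R -> R) x : ex_derive f x -> continuous f x.
Proof. apply (ex_derive_continuous (V := R_NormedModule)). Qed.

Lemma ex_RInt_cont_le (f : R -> R) a b :
  a <= b -> (forall x, a <= x <= b -> continuous f x) -> ex_RInt f a b.
Proof.
  intros Hab H; apply (ex_RInt_continuous (V := R_CompleteNormedModule)).
  intros x; rewrite Rmin_left, Rmax_right by auto; apply H.
Qed.

Lemma is_RInt_cont_le (f : R -> R) a b :
  a <= b -> (forall x, a <= x <= b -> continuous f x) -> is_RInt f a b (RInt f a b).
Proof. intros; apply (RInt_correct (V := R_CompleteNormedModule)), ex_RInt_cont_le; auto. Qed.

Lemma is_RInt_cst c a b : is_RInt (fun _ : R => c) a b ((b - a) * c).
Proof. apply (is_RInt_const (V := R_NormedModule)). Qed.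

Lemma is_RInt_derive_le (f df : R -> R) a b :
  a <= b -> (forall x, a <= x <= b -> is_derive f x (df x)) ->
  (forall x, a <= x <= b -> continuous df x) -> is_RInt df a b (f b - f a).
Proof.
  intros Hab H1 H2; apply (is_RInt_derive (V := R_CompleteNormedModule));
  intros x; rewrite Rmin_left, Rmax_right by auto; auto.
Qed.

Lemma is_RInt_ext_le (f g : R -> R) a b l :
  a <= b -> (forall x, a < x < b -> f x = g x) -> is_RInt f a b l -> is_RInt g a b l.
Proof.
  intros Hab H; apply is_RInt_ext.
  intros x; rewrite Rmin_left, Rmax_right by auto; apply H.
Qed.

Lemma is_RInt_ext_all (f g : R -> R) a b l :
  (forall x, f x = g x) -> is_RInt f a b l -> is_RInt g a b l.
Proof. intros H; apply is_RInt_ext; intros; apply H. Qed.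

Lemma RInt_abs_le (f g : R -> R) a b l :
  a <= b -> ex_RInt f a b -> is_RInt g a b l ->
  (forall x, a <= x <= b -> Rabs (f x) <= g x) -> Rabs (RInt f a b) <= l.
Proof.
  intros Hab Hf Hg H.
  apply (norm_RInt_le f g a b); auto.
  apply (RInt_correct (V := R_CompleteNormedModule)); auto.
Qed.

(** A substitute for the second mean value theorem: integration by parts moves the derivative onto
    [q], whose total variation is [|q b - q a|] because [dq] keeps its sign. *)
Lemma RInt_monotone_parts (q dq S dS : R -> R) a b M :
  a <= b ->
  (forall x, a <= x <= b -> is_derive q x (dq x)) ->
  (forall x, a <= x <= b -> is_derive S x (dS x)) ->
  (forall x, a <= x <= b -> continuous dq x) ->
  (forall x, a <= x <= b -> continuous dS x) ->
  (forall x, a <= x <= b -> Rabs (S x) <= M) ->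
  (forall x, a <= x <= b -> 0 <= dq x) \/ (forall x, a <= x <= b -> dq x <= 0) ->
  Rabs (RInt (fun x => q x * dS x) a b) <= 2 * M * (Rabs (q a) + Rabs (q b)).
Proof.
  intros Hab Hq HS Cq CS HM Hsign.
  assert (HM0 : 0 <= M) by (apply Rle_trans with (Rabs (S a)); [apply Rabs_pos|apply HM; lra]).
  assert (Cq0 : forall x, a <= x <= b -> continuous q x) by (intros x Hx; apply (is_derive_cont q x (dq x)); auto).
  assert (CS0 : forall x, a <= x <= b -> continuous S x) by (intros x Hx; apply (is_derive_cont S x (dS x)); auto).
  assert (E1 : ex_RInt (fun x => dq x * S x) a b).
  { apply ex_RInt_cont_le; auto. intros x Hx; apply (continuous_mult dq S); auto. }
  assert (E2 : ex_RInt (fun x => q x * dS x) a b).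
  { apply ex_RInt_cont_le; auto. intros x Hx; apply (continuous_mult q dS); auto. }
  assert (Hparts : RInt (fun x => dq x * S x) a b + RInt (fun x => q x * dS x) a b = q b * S b - q a * S a).
  { rewrite <- (RInt_plus (V := R_CompleteNormedModule)) by auto.
    apply is_RInt_unique.
    apply (is_RInt_derive_le (fun x => q x * S x)); auto.
    - intros x Hx. exact (is_derive_mult (K := R_AbsRing) q S x _ _ (Hq x Hx) (HS x Hx) Rmult_comm).
    - intros x Hx. apply (continuous_plus (fun x => dq x * S x)); [apply (continuous_mult dq S)|apply (continuous_mult q dS)]; auto. }
  assert (Hvar : Rabs (RInt (fun x => dq x * S x) a b) <= M * Rabs (q b - q a)).
  { assert (Idq : is_RInt dq a b (q b - q a)) by (apply is_RInt_derive_le; auto).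
    (* [sg] is the sign of [dq], so that [sg * dq] is its absolute value and the two monotone cases
       merge. *)
    assert (Hg : forall sg, (sg = 1 \/ sg = -1) -> (forall x, a <= x <= b -> 0 <= sg * dq x) ->
       Rabs (RInt (fun x => dq x * S x) a b) <= M * Rabs (q b - q a)).
    { intros sg Hsg Hpos.
      assert (I2 : is_RInt (fun x => M * (sg * dq x)) a b (M * (sg * (q b - q a)))).
      { apply (is_RInt_scal (fun x => sg * dq x)).
        apply (is_RInt_scal dq); auto. }
      assert (Hle : Rabs (RInt (fun x => dq x * S x) a b) <= M * (sg * (q b - q a))).
      { apply (RInt_abs_le _ (fun x => M * (sg * dq x))); auto.
        intros x Hx. rewrite Rabs_mult. rewrite Rmult_comm.
        replace (Rabs (dq x)) with (sg * dq x).
        - apply Rmult_le_compat_r; auto.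
        - specialize (Hpos x Hx). destruct Hsg as [-> | ->];
          [rewrite Rabs_right|rewrite Rabs_left1]; lra. }
      eapply Rle_trans; [exact Hle|]. apply Rmult_le_compat_l; auto.
      destruct Hsg as [-> | ->].
      - rewrite Rmult_1_l; apply Rle_abs.
      - rewrite <- Rabs_Ropp. replace (-1 * (q b - q a)) with (- (q b - q a)) by ring. apply Rle_abs. }
    destruct Hsign as [H|H].
    - apply (Hg 1); auto. intros x Hx; specialize (H x Hx); lra.
    - apply (Hg (-1)); auto. intros x Hx; specialize (H x Hx); lra. }
  replace (RInt (fun x => q x * dS x) a b) with (q b * S b - q a * S a - RInt (fun x => dq x * S x) a b) by lra.
  assert (T1 : Rabs (q b * S b) <= Rabs (q b) * M).
  { rewrite Rabs_mult. apply Rmult_le_compat_l; [apply Rabs_pos|apply HM; lra]. }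
  assert (T2 : Rabs (q a * S a) <= Rabs (q a) * M).
  { rewrite Rabs_mult. apply Rmult_le_compat_l; [apply Rabs_pos|apply HM; lra]. }
  assert (T3 : M * Rabs (q b - q a) <= M * (Rabs (q b) + Rabs (q a))).
  { apply Rmult_le_compat_l; auto. unfold Rminus; eapply Rle_trans; [apply Rabs_triang|]. rewrite Rabs_Ropp; lra. }
  eapply Rle_trans; [apply Rabs_triang|]. rewrite Rabs_Ropp.
  eapply Rle_trans; [apply Rplus_le_compat_r; apply Rabs_triang|]. rewrite Rabs_Ropp. lra.
Qed.

(** A partial sum of the Fourier series of [/ 2 - x] on the open interval from 0 to 1. *)
Definition theta (V : nat) (x : R) : R :=
  rsum V (fun k => sin (2 * PI * INR k * x) / (PI * INR k)).

(** The truncation error on the unit interval only; other unit cells are reached through the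
    periodicity of [theta] in [theta_shift]. *)
Definition saw_err (V : nat) (x : R) : R := theta V x + x - / 2.

Lemma theta_derive V x :
  is_derive (theta V) x (rsum V (fun k => 2 * cos (2 * PI * INR k * x))).
Proof.
  induction V as [|V IH]; unfold theta; cbn [rsum].
  - apply (is_derive_const 0).
  - apply (is_derive_plus (theta V)); [exact IH|].
    assert (0 < INR (S V)) by (apply lt_0_INR; lia). assert (h := PI_RGT_0).
    generalize dependent (INR (S V)); intros k hk.
    auto_derive; [auto|]. field; lra.
Qed.

(** The second factor on the left is the derivative of [saw_err V]. Together with [saw_err_half]
    this makes [saw_err V x] an integral of a fast sine divided by [sin (PI * x)]. *)
Lemma dirichlet_kernel V x :
  sin (PI * x) * (1 + rsum V (fun k => 2 * cos (2 * PI * INR k * x))) = sin ((2 * INR V + 1) * PI * x).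
Proof.
  induction V as [|V IH]; cbn [rsum].
  - simpl. rewrite Rplus_0_r, Rmult_1_r. f_equal; ring.
  - rewrite <- Rplus_assoc, Rmult_plus_distr_l, IH, S_INR.
    replace ((2 * INR V + 1) * PI * x) with (2 * PI * (INR V + 1) * x - PI * x) by ring.
    replace ((2 * (INR V + 1) + 1) * PI * x) with (2 * PI * (INR V + 1) * x + PI * x) by ring.
    rewrite sin_plus, sin_minus. ring.
Qed.

Lemma sin_nat_PI k : sin (INR k * PI) = 0.
Proof.
  induction k as [|k IH]; [simpl; rewrite Rmult_0_l; apply sin_0|].
  rewrite S_INR, Rmult_plus_distr_r, Rmult_1_l, neg_sin, IH; ring.
Qed.

Lemma saw_err_half V : saw_err V (/ 2) = 0.
Proof.
  unfold saw_err, theta. rewrite rsum_zero; [ring|].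
  intros k _. replace (2 * PI * INR k * / 2) with (INR k * PI) by field.
  rewrite sin_nat_PI; unfold Rdiv; ring.
Qed.

Lemma saw_err_sym V x : saw_err V (1 - x) = - saw_err V x.
Proof.
  unfold saw_err. replace (theta V (1 - x)) with (- theta V x); [lra|].
  unfold theta. rewrite <- (Rmult_1_l (rsum _ _)), Ropp_mult_distr_l, <- rsum_scal.
  apply rsum_ext; intros k _.
  replace (2 * PI * INR k * (1 - x)) with (- (2 * PI * INR k * x) + 2 * INR k * PI) by ring.
  rewrite sin_period, sin_neg. unfold Rdiv; ring.
Qed.

Lemma theta_shift V x m : theta V (x - INR m) = theta V x.
Proof.
  apply rsum_ext; intros k _. f_equal.
  rewrite <- (sin_period (2 * PI * INR k * (x - INR m)) (k * m)), mult_INR. f_equal; ring.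
Qed.

(** With [y = PI * x <= 2], the cubic Taylor bound gives [sin y >= y / 3 >= x]. *)
Lemma sin_PI_lower x : 0 <= x <= / 2 -> x <= sin (PI * x).
Proof.
  intros Hx.  assert (h4 := PI_4).
  assert (hp : 3 <= PI) by (generalize PI2_3_2; lra).
  set (y := PI * x). assert (Hy : 3 * x <= y <= 2) by (unfold y; nra).
  destruct (sin_bound y 0) as [Hlow _]; [lra|lra|].
  unfold sin_approx, sin_term in Hlow; simpl in Hlow.
  assert (0 <= y * (4 - y * y)) by (apply Rmult_le_pos; nra). lra.
Qed.

(** Two regimes. For [V x <= 1] each term of [theta] is at most [2 x]; otherwise the Dirichlet
    kernel is integrated from [x] to [/ 2] by parts, using that [1 / sin (PI t)] decreases there. *)
Lemma saw_err_bound V x :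
  (1 <= V)%nat -> 0 <= x <= / 2 -> Rabs (saw_err V x) <= 8 / (1 + INR V * x).
Proof.
  intros HV Hx. assert (hV := INR_ge1 V HV).
  assert (hp3 : 3 <= PI) by (generalize PI2_3_2; lra).
  destruct (Rle_dec (INR V * x) 1) as [Hs|Hs].
  - apply Rle_trans with 4.
    2:{ apply Rmult_le_reg_r with (1 + INR V * x); [nra|]. unfold Rdiv; rewrite Rmult_assoc, Rinv_l by nra. nra. }
    assert (Ht : Rabs (theta V x) <= 2 * (INR V * x)).
    { replace (2 * (INR V * x)) with (rsum V (fun _ => 2 * x)) by (rewrite rsum_const; ring).
      apply rsum_abs_le. intros k Hk. assert (hk : 1 <= INR k) by (apply INR_ge1; lia).
      assert (hpk : 0 < PI * INR k) by nra.
      unfold Rdiv; rewrite Rabs_mult, (Rabs_right (/ _)) by (left; apply Rinv_pos; auto).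
      apply Rmult_le_reg_r with (PI * INR k); auto.
      rewrite Rmult_assoc, Rinv_l, Rmult_1_r by lra.
      set (y := 2 * PI * INR k * x). replace (2 * x * (PI * INR k)) with y by (unfold y; ring).
      assert (0 <= y) by (unfold y; apply Rmult_le_pos; nra).
      destruct (Req_dec y 0) as [->|hy]; [rewrite sin_0, Rabs_R0; lra|].
      assert (hs := sin_lt_x y).
      apply Rabs_le; split; [|lra].
      destruct (Rle_dec y PI); [assert (0 <= sin y) by (apply sin_ge_0; lra); lra|].
      generalize (SIN_bound y); lra. }
    unfold saw_err. apply Rabs_le. apply Rabs_le_between in Ht. lra.
  - assert (Hx0 : 0 < x) by (destruct (Req_dec x 0) as [->|]; [rewrite Rmult_0_r in Hs; lra|lra]).
    assert (Hsin : forall t, x <= t <= / 2 -> 0 < sin (PI * t)).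
    { intros t Ht. generalize (sin_PI_lower t); lra. }
    set (D := fun t => 1 + rsum V (fun k => 2 * cos (2 * PI * INR k * t))).
    assert (HD : is_RInt D x (/ 2) (saw_err V (/ 2) - saw_err V x)).
    { apply is_RInt_derive_le; [lra| |].
      - intros t _. unfold saw_err, D.
        evar_last; [apply (is_derive_minus (fun t => theta V t + t) (fun _ => / 2));
          [apply (is_derive_plus (theta V) (fun t => t)); [apply theta_derive|apply (is_derive_id (K := R_AbsRing))]
          |apply is_derive_const]|].
        unfold plus, minus, opp, zero, one; simpl. unfold plus; simpl. ring.
      - intros t _. apply (continuous_plus (fun _ => 1)); [apply continuous_const|].
        clear. induction V as [|V IH]; cbn [rsum]; [apply continuous_const|].
        apply (continuous_plus (fun t => rsum V (fun k => 2 * cos (2 * PI * INR k * t)))); auto.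
        apply (is_derive_cont _ _ (- 2 * (2 * PI * INR (S V)) * sin (2 * PI * INR (S V) * t))).
        generalize (INR (S V)); intros c. auto_derive; [auto|]. ring. }
    set (w := (2 * INR V + 1) * PI).
    assert (Hw : 0 < w) by (unfold w; apply Rmult_lt_0_compat; lra).
    assert (Hb := RInt_monotone_parts (fun t => / sin (PI * t)) (fun t => - (PI * cos (PI * t)) / (sin (PI * t))^2)
       (fun t => - cos (w * t) / w) (fun t => sin (w * t)) x (/ 2) (/ w)).
    assert (Heq : RInt (fun t => / sin (PI * t) * sin (w * t)) x (/ 2) = - saw_err V x).
    { apply is_RInt_unique. rewrite saw_err_half in HD. rewrite Rminus_0_l in HD.
      apply (is_RInt_ext_le D); auto; [lra|]. intros t Ht.
      unfold w. rewrite <- dirichlet_kernel. unfold D. field.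
      apply Rgt_not_eq, Hsin; lra. }
    cbv beta in Hb. rewrite Heq, Rabs_Ropp in Hb.
    eapply Rle_trans; [apply Hb|].
    + lra.
    + intros t Ht. specialize (Hsin t Ht). auto_derive; [lra|]. field; lra.
    + intros t Ht. auto_derive; [lra|]. field; lra.
    + intros t Ht. specialize (Hsin t Ht). apply ex_derive_cont.
      auto_derive. assert (0 < sin (PI * t) * (sin (PI * t) * 1)) by (apply Rmult_lt_0_compat; lra). lra.
    + intros t Ht. apply ex_derive_cont. auto_derive; auto.
    + intros t Ht. unfold Rdiv. rewrite Rabs_mult, Rabs_Ropp, (Rabs_right (/ w)) by (left; apply Rinv_pos; auto).
      rewrite <- (Rmult_1_l (/ w)) at 2. apply Rmult_le_compat_r; [left; apply Rinv_pos; auto|].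
      apply Rabs_le, COS_bound.
    + right. intros t Ht.
      assert (0 <= cos (PI * t)) by (apply cos_ge_0; nra).
      unfold Rdiv. rewrite <- Ropp_mult_distr_l.
      assert (0 <= PI * cos (PI * t) * / sin (PI * t) ^ 2); [|lra].
      apply Rmult_le_pos; [apply Rmult_le_pos; lra|]. left; apply Rinv_pos, pow_lt; auto.
    + replace (PI * / 2) with (PI / 2) by (unfold Rdiv; ring). rewrite sin_PI2, Rinv_1, Rabs_R1.
      assert (Hsx : / sin (PI * x) <= / x).
      { apply Rinv_le_contravar; auto. apply sin_PI_lower; lra. }
      rewrite Rabs_right by (left; apply Rinv_pos, Hsin; lra).
      assert (Hx1 : 1 <= / x) by (rewrite <- Rinv_1; apply Rinv_le_contravar; lra).
      apply Rle_trans with (2 * / w * (2 * / x)).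
      { apply Rmult_le_compat_l; [|lra]. apply Rmult_le_pos; [lra|]. left; apply Rinv_pos; auto. }
      assert (Hwx : 6 * (INR V * x) <= w * x) by (unfold w; nra).
      replace (2 * / w * (2 * / x)) with (4 / (w * x)) by (field; lra).
      apply Rmult_le_reg_r with (w * x); [nra|]. unfold Rdiv at 1. rewrite Rmult_assoc, Rinv_l, Rmult_1_r by nra.
      apply Rmult_le_reg_r with (1 + INR V * x); [nra|].
      replace (8 / (1 + INR V * x) * (w * x) * (1 + INR V * x)) with (8 * (w * x)) by (field; nra). nra.
Qed.

(** The two one-sided bounds added together: a majorant on the whole unit interval with an
    elementary antiderivative, whose integral tends to 0 as [V] grows. *)
Definition saw_maj (V : nat) (x : R) : R := 8 / (1 + INR V * x) + 8 / (1 + INR V * (1 - x)).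

Lemma saw_err_maj V x : (1 <= V)%nat -> 0 <= x <= 1 -> Rabs (saw_err V x) <= saw_maj V x.
Proof.
  intros HV Hx. assert (hV := INR_ge1 V HV). unfold saw_maj.
  assert (0 < 8 / (1 + INR V * x)) by (apply Rdiv_lt_0_compat; nra).
  assert (0 < 8 / (1 + INR V * (1 - x))) by (apply Rdiv_lt_0_compat; nra).
  destruct (Rle_dec x (/ 2)).
  - generalize (saw_err_bound V x HV); intros; lra.
  - generalize (saw_err_bound V (1 - x) HV). rewrite saw_err_sym, Rabs_Ropp. intros; lra.
Qed.

Lemma saw_maj_int V u v :
  (1 <= V)%nat -> 0 <= u <= v -> v <= 1 ->
  exists l, is_RInt (saw_maj V) u v l /\ l <= 16 * ln (1 + INR V) / INR V.
Proof.
  intros HV Huv Hv. assert (hV := INR_ge1 V HV).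
  set (F := fun x => 8 / INR V * (ln (1 + INR V * x) - ln (1 + INR V * (1 - x)))).
  exists (F v - F u). split.
  - apply is_RInt_derive_le; [lra| |]; intros x Hx;
    assert (0 < 1 + INR V * x) by nra; assert (0 < 1 + INR V * (1 - x)) by nra.
    + unfold F, saw_maj. auto_derive; [lra|]. field. lra.
    + apply ex_derive_cont. unfold saw_maj. auto_derive. lra.
  - unfold F.
    assert (Hl : forall y, 0 <= y <= 1 -> 0 <= ln (1 + INR V * y) <= ln (1 + INR V)).
    { intros y Hy; split; [rewrite <- ln_1|]; apply ln_le; nra. }
    assert (L1 := Hl v ltac:(lra)). assert (L2 := Hl u ltac:(lra)).
    assert (L3 := Hl (1 - v) ltac:(lra)). assert (L4 := Hl (1 - u) ltac:(lra)).
    replace (16 * ln (1 + INR V) / INR V) with (8 / INR V * (2 * ln (1 + INR V))) by (field; lra).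
    rewrite <- Rmult_minus_distr_l. apply Rmult_le_compat_l; [|lra].
    left; apply Rdiv_lt_0_compat; lra.
Qed.

Lemma ln_ratio_small eps : 0 < eps ->
  exists V0, forall V, (V0 <= V)%nat -> 16 * ln (1 + INR V) / INR V <= eps.
Proof.
  (* From [ln (1 + V) <= 4 sqrt V] the quotient is at most [64 / sqrt V], hence this threshold for
     [V]. *)
  intros He. set (z := (64 / eps) ^ 2).
  destruct (nfloor_ex z) as [n Hn]; [apply pow2_ge_0|].
  exists (S n). intros V HV. apply le_INR in HV. rewrite S_INR in HV.
  assert (hn := pos_INR n).
  set (s := sqrt (INR V)). assert (hs : s * s = INR V) by (apply sqrt_sqrt; lra).
  assert (s1 : 1 <= s) by (rewrite <- sqrt_1; apply sqrt_le_1; lra).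
  assert (He' : 64 / eps <= s).
  { assert (0 < 64 / eps) by (apply Rdiv_lt_0_compat; lra).
    apply Rsqr_incr_0; unfold Rsqr; try lra. unfold z in Hn. nra. }
  assert (Hln : ln (1 + INR V) <= 4 * s).
  { rewrite <- hs. apply Rle_trans with (ln ((1 + s) * (1 + s))).
    - apply ln_le; nra.
    - rewrite ln_mult by lra. generalize (exp_ineq1_le (ln (1 + s))). rewrite exp_ln by lra. lra. }
  rewrite <- hs. apply Rmult_le_reg_r with (s * s); [nra|].
  unfold Rdiv; rewrite Rmult_assoc, Rinv_l, Rmult_1_r by nra. rewrite hs.
  assert (64 <= eps * s).
  { apply Rmult_le_reg_r with (/ eps); [apply Rinv_pos; auto|].
    replace (eps * s * / eps) with s by (field; lra). unfold Rdiv in He'; lra. }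
  assert (64 * s <= eps * (s * s)) by nra. rewrite <- hs at 2. lra.
Qed.

Lemma is_RInt_shift (f : R -> R) c u v l :
  is_RInt f (u - c) (v - c) l -> is_RInt (fun x => f (x - c)) u v l.
Proof.
  intros H. apply (is_RInt_ext (fun x => scal 1 (f (1 * x + - c)))).
  - intros x _. rewrite !Rmult_1_l. reflexivity.
  - apply (is_RInt_comp_lin f 1 (- c) u v).
    now rewrite !Rmult_1_l.
Qed.

(** * Sums as integrals: Euler-Maclaurin with a truncated sawtooth *)

Section Sawtooth.

Variables (G dG : R -> R) (a b : R).
Hypothesis Ha : 0 < a.
Hypothesis Hab : a <= b.
Hypothesis HG : forall x, a <= x <= b -> is_derive G x (dG x).
Hypothesis CG : forall x, a <= x <= b -> continuous dG x.

(** The Euler-Maclaurin integrand, with the sawtooth replaced by its partial Fourier sum so that it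
    is continuous across the integers. *)
Let J (V : nat) (x : R) : R := G x - theta V x * dG x.

Lemma J_cont V x : a <= x <= b -> continuous (J V) x.
Proof.
  intros Hx. apply (continuous_minus G (fun x => theta V x * dG x)).
  - apply (is_derive_cont G x (dG x)); auto.
  - apply (continuous_mult (theta V) dG); auto.
    eapply is_derive_cont, theta_derive.
Qed.

(** Inside one unit cell [theta] is close to [/ 2 - (x - m)], which turns [J] into the derivative of
    [(x - m - / 2) * G x]. The discrepancy is bounded by [saw_maj] times a bound for [dG]. *)
Lemma sawtooth_cell m u v eps :
  0 < eps -> a <= u <= v -> v <= b -> INR m <= u -> v <= INR m + 1 ->
  exists V0, forall V, (V0 <= V)%nat ->
    Rabs (RInt (J V) u v - ((v - INR m - / 2) * G v - (u - INR m - / 2) * G u)) <= eps.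
Proof.
  intros He Hu Hv Hmu Hmv.
  assert (HB : exists B, 0 < B /\ forall x, u <= x <= v -> Rabs (dG x) <= B).
  { destruct (continuity_ab_maj (fun x => Rabs (dG x)) u v) as [M [HM _]]; [lra| |].
    - intros c Hc. apply continuity_pt_filterlim.
      apply (continuous_comp dG Rabs); [apply CG; lra|]. apply (continuous_Rabs (dG c)).
    - exists (Rabs (dG M) + 1). split; [generalize (Rabs_pos (dG M)); lra|].
      intros x Hx; specialize (HM x Hx); lra. }
  destruct HB as [B [HB0 HB]].
  destruct (ln_ratio_small (eps / B)) as [V0 HV0]; [apply Rdiv_lt_0_compat; auto|].
  exists (S V0). intros V HV. assert (HV1 : (1 <= V)%nat) by lia.
  destruct (saw_maj_int V (u - INR m) (v - INR m)) as [l [Il Hl]]; [auto|lra|lra|].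
  assert (I0 : is_RInt (fun x => G x + (x - INR m - / 2) * dG x) u v ((v - INR m - / 2) * G v - (u - INR m - / 2) * G u)).
  { apply (is_RInt_derive_le (fun x => (x - INR m - / 2) * G x)); [lra| |].
    - intros x Hx. evar_last.
      { apply (is_derive_mult (K := R_AbsRing) (fun x => x - INR m - / 2) G x 1 (dG x)).
        - auto_derive; [auto|ring].
        - apply HG; lra.
        - exact Rmult_comm. }
      unfold plus, mult; simpl. ring.
    - intros x Hx. apply (continuous_plus G (fun x => (x - INR m - / 2) * dG x)).
      + apply (is_derive_cont G x (dG x)), HG; lra.
      + apply (continuous_mult (fun x => x - INR m - / 2) dG); [|apply CG; lra].
        apply (is_derive_cont _ _ 1). auto_derive; [auto|ring]. }
  assert (EJ : ex_RInt (J V) u v) by (apply ex_RInt_cont_le; [lra|intros; apply J_cont; lra]).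
  rewrite <- (is_RInt_unique _ _ _ _ I0).
  rewrite <- (RInt_minus (V := R_CompleteNormedModule)) by (auto; eexists; eauto).
  assert (I1 : is_RInt (fun x => B * saw_maj V (x - INR m)) u v (B * l)).
  { apply (is_RInt_scal (fun x => saw_maj V (x - INR m))).
    now apply is_RInt_shift. }
  apply Rle_trans with (B * l).
  - refine (RInt_abs_le _ _ u v _ _ _ I1 _); [lra| |].
    + apply ex_RInt_minus; auto. eexists; eauto.
    + intros x Hx. change (Rabs (J V x - (G x + (x - INR m - / 2) * dG x)) <= B * saw_maj V (x - INR m)).
      replace (J V x - (G x + (x - INR m - / 2) * dG x)) with (- (saw_err V (x - INR m) * dG x)).
      2:{ unfold J, saw_err. rewrite theta_shift. ring. }
      rewrite Rabs_Ropp, Rabs_mult, Rmult_comm.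
      apply Rmult_le_compat; try apply Rabs_pos; [apply HB; lra|apply saw_err_maj; [auto|lra]].
  - assert (Hlim : 16 * ln (1 + INR V) / INR V <= eps / B) by (apply HV0; lia).
    apply Rle_trans with (B * (eps / B)); [apply Rmult_le_compat_l; lra|].
    right; field; lra.
Qed.

(** At an interior integer the cell on its left and the cell on its right each leave half of the
    value of [G], which add up to one full term of the sum. *)
Lemma sawtooth_cells m j c eps :
  0 < eps -> INR m <= a < INR m + 1 -> a <= c <= b -> INR (m + j) <= c <= INR (m + j) + 1 ->
  exists V0, forall V, (V0 <= V)%nat ->
    Rabs (RInt (J V) a c - (rsum j (fun i => G (INR (m + i)))
       + (c - INR (m + j) - / 2) * G c - (a - INR m - / 2) * G a)) <= eps.
Proof.
  intros He Hm. revert c eps He. induction j as [|j IH]; intros c eps He Hc Hcj.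
  - rewrite Nat.add_0_r in *. cbn [rsum].
    destruct (sawtooth_cell m a c eps) as [V0 H]; try lra.
    exists V0; intros V HV. specialize (H V HV). rewrite Rplus_0_l. exact H.
  - rewrite Nat.add_succ_r, S_INR in *.
    assert (hmj : INR m <= INR (m + j)) by (apply le_INR; lia).
    set (c' := INR (m + j) + 1) in *.
    destruct (IH c' (eps / 2)) as [V1 H1]; [lra| |unfold c'; lra|].
    { unfold c' in *. lra. }
    destruct (sawtooth_cell (m + S j) c' c (eps / 2)) as [V2 H2]; try (unfold c' in *; lra).
    { rewrite Nat.add_succ_r, S_INR; unfold c'; lra. }
    { rewrite Nat.add_succ_r, S_INR; unfold c' in *; lra. }
    exists (V1 + V2)%nat. intros V HV. specialize (H1 V ltac:(lia)). specialize (H2 V ltac:(lia)).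
    rewrite <- (RInt_Chasles (J V) a c' c).
    + change (plus (RInt (J V) a c') (RInt (J V) c' c)) with (RInt (J V) a c' + RInt (J V) c' c).
      rewrite Nat.add_succ_r, S_INR in H2. fold c' in H2. cbn [rsum].
      rewrite Nat.add_succ_r, S_INR. fold c'.
      replace (INR (m + j)) with (c' - 1) in H1 by (unfold c'; ring).
      apply Rabs_le_between in H1. apply Rabs_le_between in H2.
      apply Rabs_le.
      lra.
    + apply ex_RInt_cont_le; [unfold c' in *; lra|]. intros; apply J_cont; unfold c' in *; lra.
    + apply ex_RInt_cont_le; [unfold c' in *; lra|]. intros; apply J_cont; unfold c' in *; lra.
Qed.

Lemma sawtooth_sum K eps :
  0 < eps -> b <= INR K -> (forall x, a <= x <= b -> Rabs (G x) <= 1) ->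
  exists V0, forall V, (V0 <= V)%nat ->
    Rabs (rsum K (fun k => cut a b (INR k) * G (INR k)) - RInt (J V) a b) <= 2 + eps.
Proof.
  intros He HK H1.
  destruct (nfloor_ex a) as [m Hm]; [lra|]. destruct (nfloor_ex b) as [n Hn]; [lra|].
  assert (Hmn : (m <= n)%nat).
  { destruct (Nat.le_gt_cases m n) as [h|h]; auto. apply le_INR in h. rewrite S_INR in h. lra. }
  assert (HnK : (n <= K)%nat) by (apply INR_le; lra).
  destruct (sawtooth_cells m (n - m) b eps) as [V0 HV]; auto; try lra.
  { replace (m + (n - m))%nat with n by lia; lra. }
  exists V0. intros V h. specialize (HV V h). replace (m + (n - m))%nat with n in HV by lia.
  (* The cells account for the integers after [m] only; [z = 1] restores the term at [a] when [a] is
     itself the integer [m]. *)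
  assert (Es : exists z, 0 <= z <= 1 /\ (z = 0 \/ z = 1 /\ a = INR m) /\
     rsum K (fun k => cut a b (INR k) * G (INR k)) = z * G a + rsum (n - m) (fun i => G (INR (m + i)))).
  { assert (Hw : rsum K (fun k => cut a b (INR k) * G (INR k)) = rsum n (fun k => cut a b (INR k) * G (INR k))).
    { apply rsum_widen; auto. intros k hk. rewrite cut_out; [ring|right].
      assert (INR n + 1 <= INR k) by (rewrite <- S_INR; apply le_INR; lia). lra. }
    rewrite Hw.
    assert (Hsp : rsum n (fun k => cut a b (INR k) * G (INR k)) =
       rsum m (fun k => cut a b (INR k) * G (INR k)) + rsum (n - m) (fun i => G (INR (m + i)))).
    { assert (Hall : forall i, (m + i <= n)%nat -> rsum (m + i) (fun k => cut a b (INR k) * G (INR k)) =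
        rsum m (fun k => cut a b (INR k) * G (INR k)) + rsum i (fun i => G (INR (m + i)))).
      { induction i as [|i IHi]; intros hi; [rewrite Nat.add_0_r; simpl; ring|].
        rewrite Nat.add_succ_r. cbn [rsum]. rewrite IHi by lia.
        rewrite cut_in; [rewrite Nat.add_succ_r; ring|].
        split.
        - apply Rle_trans with (INR m + 1); [lra|]. rewrite <- S_INR; apply le_INR; lia.
        - apply Rle_trans with (INR n); [apply le_INR; lia|lra]. }
      replace n with (m + (n - m))%nat at 1 by lia. apply Hall; lia. }
    rewrite Hsp. destruct (Req_dec a (INR m)) as [ham|ham].
    - exists 1. split; [lra|]. split; [right; auto|]. f_equal.
      destruct m as [|m']; [simpl in ham; lra|].
      rewrite (rsum_single (S m') (S m')); [rewrite cut_in by lra; rewrite <- ham; ring|lia|].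
      intros k h1 h2. rewrite cut_out; [ring|]. left. rewrite ham. apply lt_INR; lia.
    - exists 0. split; [lra|]. split; [left; auto|]. rewrite rsum_zero; [ring|].
      intros k hk. rewrite cut_out; [ring|]. left. assert (INR k <= INR m) by (apply le_INR; lia). lra. }
  destruct Es as (z & Hz & Hz' & ->).
  assert (Ga := H1 a ltac:(lra)). assert (Gb := H1 b ltac:(lra)).
  apply Rabs_le_between in Ga. apply Rabs_le_between in Gb. apply Rabs_le_between in HV.
  apply Rabs_le.
  assert (T1 : -1 <= (b - INR n - / 2) * G b <= 1) by nra.
  assert (T2 : -1 <= (z + (a - INR m - / 2)) * G a <= 1).
  {  nra. }
  lra.
Qed.

End Sawtooth.

(** * Truncated Poisson summation *)

Lemma is_derive_cos_comp (p : R -> R) x dp :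
  is_derive p x dp -> is_derive (fun x => cos (p x)) x (- dp * sin (p x)).
Proof.
  intros H. evar_last; [apply (is_derive_comp cos p x); [|exact H]|].
  - apply is_derive_Reals, derivable_pt_lim_cos.
  - unfold scal; simpl; unfold mult; simpl. ring.
Qed.

Lemma is_derive_sin_comp (p : R -> R) x dp :
  is_derive p x dp -> is_derive (fun x => sin (p x)) x (dp * cos (p x)).
Proof.
  intros H. evar_last; [apply (is_derive_comp sin p x); [|exact H]|].
  - apply is_derive_Reals, derivable_pt_lim_sin.
  - reflexivity.
Qed.

(** Written as [(1 / dh) * (dh * cos h)], the integrand is a monotone factor times the derivative of
    [sin h]. *)
Lemma first_derivative_test (h dh ddh : R -> R) a b m :
  a <= b -> 0 < m ->
  (forall x, a <= x <= b -> is_derive h x (dh x)) ->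
  (forall x, a <= x <= b -> is_derive dh x (ddh x)) ->
  (forall x, a <= x <= b -> continuous ddh x) ->
  (forall x, a <= x <= b -> 0 <= ddh x) \/ (forall x, a <= x <= b -> ddh x <= 0) ->
  (forall x, a <= x <= b -> m <= dh x) ->
  Rabs (RInt (fun x => cos (h x)) a b) <= 4 / m.
Proof.
  intros Hab Hm Hh Hdh Cddh Hsign Hlow.
  assert (Cdh : forall x, a <= x <= b -> continuous dh x) by (intros x Hx; apply (is_derive_cont dh x (ddh x)); auto).
  assert (Ccos : forall x, a <= x <= b -> continuous (fun x => cos (h x)) x).
  { intros x Hx. eapply is_derive_cont, is_derive_cos_comp; auto. }
  replace (RInt (fun x => cos (h x)) a b) with (RInt (fun x => / dh x * (dh x * cos (h x))) a b).
  2:{ apply is_RInt_unique. apply (is_RInt_ext_le (fun x => cos (h x))); auto.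
      - intros x Hx. specialize (Hlow x ltac:(lra)). field. lra.
      - apply is_RInt_cont_le; auto. }
  eapply Rle_trans.
  - apply (RInt_monotone_parts (fun x => / dh x) (fun x => - ddh x / dh x ^ 2) (fun x => sin (h x))
      (fun x => dh x * cos (h x)) a b 1); auto.
    + intros x Hx. apply is_derive_inv; auto. specialize (Hlow x Hx). lra.
    + intros x Hx. apply is_derive_sin_comp; auto.
    + intros x Hx. apply (continuous_mult (fun x => - ddh x) (fun x => / dh x ^ 2)).
      * apply (continuous_opp (V := R_NormedModule)); auto.
      * apply (continuous_comp (fun x => dh x ^ 2) Rinv).
        -- apply (continuous_mult dh (fun x => dh x * 1)); auto.
           apply (continuous_mult dh (fun _ => 1)); auto. apply continuous_const.
        -- apply continuous_Rinv, pow_nonzero. specialize (Hlow x Hx). lra.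
    + intros x Hx. apply (continuous_mult dh (fun x => cos (h x))); auto.
    + intros. apply Rabs_le, SIN_bound.
    + assert (Hpos : forall x, a <= x <= b -> 0 < / dh x ^ 2).
      { intros x Hx. specialize (Hlow x Hx). apply Rinv_pos, pow_lt. lra. }
      destruct Hsign as [Hs|Hs]; [right|left]; intros x Hx; specialize (Hs x Hx); specialize (Hpos x Hx); unfold Rdiv; nra.
  - assert (Hq : forall x, a <= x <= b -> Rabs (/ dh x) <= / m).
    { intros x Hx. specialize (Hlow x Hx). rewrite Rabs_right by (left; apply Rinv_pos; lra).
      apply Rinv_le_contravar; lra. }
    assert (Q1 := Hq a ltac:(lra)). assert (Q2 := Hq b ltac:(lra)). unfold Rdiv; lra.
Qed.

Lemma RInt_rsum n (F : nat -> R -> R) a b :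
  (forall k, (1 <= k <= n)%nat -> ex_RInt (F k) a b) ->
  is_RInt (fun x => rsum n (fun k => F k x)) a b (rsum n (fun k => RInt (F k) a b)).
Proof.
  induction n as [|n IH]; intros H; cbn [rsum].
  - evar_last; [apply is_RInt_cst|ring].
  - apply (is_RInt_plus (fun x => rsum n (fun k => F k x))).
    + apply IH; intros; apply H; lia.
    + apply (RInt_correct (V := R_CompleteNormedModule)), H; lia.
Qed.

(** Partial fractions: each term is [1 / j - 1 / (n + j)]. The bound does not depend on [V], which
    is essential because the truncation point of the sawtooth series is not controlled. *)
Lemma harm_telescope n V : (1 <= n)%nat ->
  rsum V (fun j => INR n / (INR j * INR (n + j))) <= harm n.
Proof.
  intros Hn. assert (H : rsum V (fun j => INR n / (INR j * INR (n + j))) = harm V + harm n - harm (n + V)).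
  { induction V as [|V IH]; [rewrite Nat.add_0_r; unfold harm at 1; simpl; ring|].
    cbn [rsum]. rewrite IH, Nat.add_succ_r. unfold harm; cbn [rsum].
    assert (0 < INR (S V)) by (apply lt_0_INR; lia).
    assert (E : INR (S (n + V)) = INR n + INR (S V)) by (rewrite <- plus_INR; f_equal; lia).
    rewrite E. assert (0 < INR n) by (apply lt_0_INR; lia). field. lra. }
  rewrite H. assert (harm V <= harm (n + V)) by (apply harm_mono; lia). lra.
Qed.

Section Truncated_Poisson.

Variables (f df ddf : R -> R) (a b phi : R) (n0 : nat).
Hypothesis Ha : 0 < a.
Hypothesis Hab : a <= b.
Hypothesis Hf : forall x, a <= x <= b -> is_derive f x (df x).
Hypothesis Hdf : forall x, a <= x <= b -> is_derive df x (ddf x).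
Hypothesis Cddf : forall x, a <= x <= b -> continuous ddf x.
Hypothesis Hsign : (forall x, a <= x <= b -> 0 <= ddf x) \/ (forall x, a <= x <= b -> ddf x <= 0).
Hypothesis Hn0 : (1 <= n0)%nat.
Hypothesis Hdf0 : forall x, a <= x <= b -> 0 < df x <= INR n0.

Let ph (y x : R) := 2 * PI * (f x - y * x) + phi.

Lemma ph_derive y x : a <= x <= b -> is_derive (ph y) x (2 * PI * (df x - y)).
Proof.
  intros Hx.
  evar_last.
  { apply (is_derive_plus (fun x => 2 * PI * (f x - y * x)) (fun _ => phi)).
    - apply (is_derive_scal (fun x => f x - y * x) x (2 * PI) (df x - y)).
      apply (is_derive_minus f (fun x => y * x) x (df x) y); [auto|].
      auto_derive; [auto|ring].
    - apply is_derive_const. }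
  unfold plus, zero; simpl. ring.
Qed.

Let Cdf x : a <= x <= b -> continuous df x.
Proof. intros Hx; apply (is_derive_cont df x (ddf x)); auto. Qed.

Lemma cos_ph_cont y x : a <= x <= b -> continuous (fun x => cos (ph y x)) x.
Proof. intros Hx. eapply is_derive_cont, is_derive_cos_comp, ph_derive; auto. Qed.

Lemma df_cos_ph_cont y x : a <= x <= b -> continuous (fun x => df x * cos (ph y x)) x.
Proof. intros Hx. apply (continuous_mult df (fun x => cos (ph y x))); auto. now apply cos_ph_cont. Qed.

Lemma dsin_ph_cont y x : a <= x <= b -> continuous (fun x => 2 * PI * (df x - y) * cos (ph y x)) x.
Proof.
  intros Hx. apply (continuous_mult (fun x => 2 * PI * (df x - y)) (fun x => cos (ph y x))).
  - apply (continuous_mult (fun _ => 2 * PI) (fun x => df x - y)); [apply continuous_const|].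
    apply (continuous_minus df (fun _ => y)); [auto|apply continuous_const].
  - now apply cos_ph_cont.
Qed.

(** [A] is what the sawtooth series produces, since differentiating the phase brings down [df]; [I],
    without that weight, is what Poisson summation asks for. *)
Let A (y : R) := RInt (fun x => df x * cos (ph y x)) a b.
Let I (y : R) := RInt (fun x => cos (ph y x)) a b.

(** The quotient [df / (df - y)] is monotone, its derivative being [- y * ddf / (df - y)^2], so
    integration by parts costs its size at the two ends. *)
Lemma far_frequency y Q :
  0 < y \/ y < 0 -> (forall x, a <= x <= b -> df x - y <> 0 /\ Rabs (df x / (df x - y)) <= Q) ->
  Rabs (A y) <= Q.
Proof.
  intros Hy H. assert (hp : 3 <= PI) by (generalize PI2_3_2; lra).
  assert (Hb := RInt_monotone_parts (fun x => df x / (2 * PI * (df x - y)))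
     (fun x => - y * ddf x / (2 * PI * (df x - y) ^ 2))
     (fun x => sin (ph y x)) (fun x => 2 * PI * (df x - y) * cos (ph y x)) a b 1).
  cbv beta in Hb.
  assert (E : RInt (fun x => df x / (2 * PI * (df x - y)) * (2 * PI * (df x - y) * cos (ph y x))) a b = A y).
  { apply is_RInt_unique. apply (is_RInt_ext_le (fun x => df x * cos (ph y x))); auto.
    - intros x Hx. destruct (H x); [lra|]. field. lra.
    - apply is_RInt_cont_le; auto.
      intros; now apply df_cos_ph_cont. }
  rewrite E in Hb. eapply Rle_trans; [apply Hb|]; clear Hb; auto.
  - intros x Hx. destruct (H x Hx) as [H1 _].
    evar_last.
    { apply (is_derive_div df (fun x => 2 * PI * (df x - y)) x (ddf x) (2 * PI * ddf x)); auto.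
      - apply (is_derive_scal (fun x => df x - y) x (2 * PI) (ddf x)).
        evar_last; [apply (is_derive_minus df (fun _ => y) x (ddf x)); [auto|apply is_derive_const]|].
        unfold minus, plus, opp, zero; simpl. ring.
      - apply Rmult_integral_contrapositive_currified; lra. }
    field. lra.
  - intros x Hx. now apply is_derive_sin_comp, ph_derive.
  - intros x Hx. destruct (H x Hx) as [H1 _].
    apply (continuous_mult (fun x => - y * ddf x) (fun x => / (2 * PI * (df x - y) ^ 2))).
    + apply (continuous_mult (fun _ => - y) ddf); [apply continuous_const|auto].
    + apply (continuous_comp (fun x => 2 * PI * (df x - y) ^ 2) Rinv).
      * apply (continuous_mult (fun _ => 2 * PI) (fun x => (df x - y)^2)); [apply continuous_const|].
        assert (Cm : continuous (fun x => df x - y) x).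
        { apply (continuous_minus df (fun _ => y)); [auto|apply continuous_const]. }
        apply (continuous_mult (fun x => df x - y) (fun x => (df x - y) * 1)); auto.
        apply (continuous_mult (fun x => df x - y) (fun _ => 1)); auto. apply continuous_const.
      * apply continuous_Rinv. apply Rmult_integral_contrapositive_currified; [lra|]. now apply pow_nonzero.
  - intros x Hx. now apply dsin_ph_cont.
  - intros x Hx. apply Rabs_le, SIN_bound.
  - assert (Hpos : forall x, a <= x <= b -> 0 < / (2 * PI * (df x - y) ^ 2)).
    { intros x Hx. destruct (H x Hx) as [H1 _]. apply Rinv_pos.
      assert (0 < (df x - y) ^ 2) by (apply pow2_gt_0; auto). apply Rmult_lt_0_compat; lra. }
    destruct Hy as [Hy|Hy], Hsign as [Hs|Hs]; [right|left|left|right]; intros x Hx;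
    specialize (Hpos x Hx); specialize (Hs x Hx); unfold Rdiv; set (z := / _) in *;
    revert Hs Hpos; generalize (ddf x); intros w Hw Hz;
    first [assert (Hyw : 0 <= y * w) by nra | assert (Hyw : y * w <= 0) by nra]; nra.
  - assert (Hq : forall x, a <= x <= b -> Rabs (df x / (2 * PI * (df x - y))) <= / 6 * Q).
    { intros x Hx. destruct (H x Hx) as [H1 H2].
      replace (df x / (2 * PI * (df x - y))) with (/ (2 * PI) * (df x / (df x - y))) by (field; lra).
      rewrite Rabs_mult, Rabs_right by (left; apply Rinv_pos; lra).
      apply Rmult_le_compat; auto; [left; apply Rinv_pos; lra|apply Rabs_pos|].
      apply Rinv_le_contravar; lra. }
    assert (Q1 := Hq a ltac:(lra)). assert (Q2 := Hq b ltac:(lra)).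
    assert (0 <= Q) by (apply Rle_trans with (2 := proj2 (H a ltac:(lra))), Rabs_pos). lra.
Qed.

(** [A y - y * I y] integrates the derivative of the phase against its cosine, so it is a difference
    of two sines divided by [2 PI]. *)
Lemma near_frequency y : 0 < y -> Rabs (A y / y - I y) <= / y.
Proof.
  intros Hy. assert (hp : 3 <= PI) by (generalize PI2_3_2; lra).
  assert (E : is_RInt (fun x => 2 * PI * (df x - y) * cos (ph y x)) a b (sin (ph y b) - sin (ph y a))).
  { apply (is_RInt_derive_le (fun x => sin (ph y x))); auto.
    - intros x Hx. now apply is_derive_sin_comp, ph_derive.
    - intros x Hx. now apply dsin_ph_cont. }
  assert (E2 : is_RInt (fun x => 2 * PI * (df x * cos (ph y x) - y * cos (ph y x))) a b (2 * PI * (A y - y * I y))).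
  { apply (is_RInt_scal (fun x => df x * cos (ph y x) - y * cos (ph y x))).
    apply (is_RInt_minus (fun x => df x * cos (ph y x)) (fun x => y * cos (ph y x))).
    - apply is_RInt_cont_le; auto. intros; now apply df_cos_ph_cont.
    - apply (is_RInt_scal (fun x => cos (ph y x))).
      apply is_RInt_cont_le; auto. intros; now apply cos_ph_cont. }
  assert (E3 : 2 * PI * (A y - y * I y) = sin (ph y b) - sin (ph y a)).
  { rewrite <- (is_RInt_unique _ _ _ _ E). symmetry. apply is_RInt_unique.
    refine (is_RInt_ext_le _ _ a b _ Hab _ E2). intros; ring. }
  assert (B1 := SIN_bound (ph y b)). assert (B2 := SIN_bound (ph y a)).
  assert (B3 : Rabs (A y - y * I y) <= 1).
  { apply Rabs_le. nra. }
  replace (A y / y - I y) with ((A y - y * I y) * / y) by (field; lra).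
  rewrite Rabs_mult, (Rabs_right (/ y)) by (left; apply Rinv_pos; auto).
  rewrite <- (Rmult_1_l (/ y)) at 2. apply Rmult_le_compat_r; auto. left; apply Rinv_pos; auto.
Qed.

(** One [harm n0] pays for each of three things: the negative frequencies, the frequencies above
    [n0], and the replacement of [A k / k] by [I k] up to [n0]. The first two are summed by
    [harm_telescope], uniformly in [V]. *)
Lemma sawtooth_integral V : (n0 <= V)%nat ->
  Rabs (RInt (fun x => cos (ph 0 x) - theta V x * (- (2 * PI * (df x - 0)) * sin (ph 0 x))) a b
        - (I 0 + rsum n0 (fun k => I (INR k)))) <= 3 * harm n0.
Proof.
  intros HV. assert (hp := PI_RGT_0).
  assert (Hn1 := INR_ge1 n0 Hn0).
  assert (Hex : forall k, ex_RInt (fun x => (df x * cos (ph (INR k) x) - df x * cos (ph (- INR k) x)) / INR k) a b).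
  { intros k. apply ex_RInt_cont_le; auto. intros x Hx.
    apply (continuous_mult (fun x => df x * cos (ph (INR k) x) - df x * cos (ph (- INR k) x)) (fun _ => / INR k)); [|apply continuous_const].
    apply (continuous_minus (V := R_NormedModule)); now apply df_cos_ph_cont. }
  assert (E : RInt (fun x => cos (ph 0 x) - theta V x * (- (2 * PI * (df x - 0)) * sin (ph 0 x))) a b
     = I 0 + rsum V (fun k => RInt (fun x => (df x * cos (ph (INR k) x) - df x * cos (ph (- INR k) x)) / INR k) a b)).
  { apply is_RInt_unique.
    apply (is_RInt_ext_le (fun x => cos (ph 0 x) + rsum V (fun k => (df x * cos (ph (INR k) x) - df x * cos (ph (- INR k) x)) / INR k))); auto.
    - intros x Hx. rewrite (Rminus_def (cos _)). f_equal.
      (* The sine in [theta] times the sine of the phase splits into the frequencies [k] and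
         [- k]. *)
      unfold theta. rewrite Ropp_mult_distr_r, <- rsum_scal_r.
      apply rsum_ext. intros k Hk. assert (0 < INR k) by (apply lt_0_INR; lia).
      replace (ph (INR k) x) with (ph 0 x - 2 * PI * INR k * x) by (unfold ph; ring).
      replace (ph (- INR k) x) with (ph 0 x + 2 * PI * INR k * x) by (unfold ph; ring).
      rewrite cos_plus, cos_minus. field. lra.
    - apply (is_RInt_plus (fun x => cos (ph 0 x))).
      + apply is_RInt_cont_le; auto. intros; now apply cos_ph_cont.
      + apply (RInt_rsum V (fun k x => (df x * cos (ph (INR k) x) - df x * cos (ph (- INR k) x)) / INR k)). auto. }
  rewrite E.
  assert (E2 : forall k, (1 <= k)%nat ->
     RInt (fun x => (df x * cos (ph (INR k) x) - df x * cos (ph (- INR k) x)) / INR k) a b = A (INR k) / INR k - A (- INR k) / INR k).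
  { intros k Hk. apply is_RInt_unique.
    replace (A (INR k) / INR k - A (- INR k) / INR k) with (/ INR k * (A (INR k) - A (- INR k))) by (unfold Rdiv; ring).
    apply (is_RInt_ext_le (fun x => / INR k * (df x * cos (ph (INR k) x) - df x * cos (ph (- INR k) x)))); auto.
    { intros; unfold Rdiv; ring. }
    apply (is_RInt_scal (fun x => df x * cos (ph (INR k) x) - df x * cos (ph (- INR k) x))).
    apply (is_RInt_minus (V := R_NormedModule)); apply (RInt_correct (V := R_CompleteNormedModule)); apply ex_RInt_cont_le; auto; intros; now apply df_cos_ph_cont. }
  rewrite (rsum_ext V _ (fun k => A (INR k) / INR k - A (- INR k) / INR k)) by (intros k Hk; apply E2; lia).
  rewrite rsum_minus.
  assert (Hneg : Rabs (rsum V (fun k => A (- INR k) / INR k)) <= harm n0).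
  { eapply Rle_trans; [|apply (harm_telescope n0 V); auto].
    apply rsum_abs_le. intros k Hk. assert (hk : 1 <= INR k) by (apply INR_ge1; lia).
    unfold Rdiv at 1. rewrite Rabs_mult, (Rabs_right (/ INR k)) by (left; apply Rinv_pos; lra).
    replace (INR n0 / (INR k * INR (n0 + k))) with (INR n0 / (INR n0 + INR k) * / INR k) by (rewrite plus_INR; field; lra).
    apply Rmult_le_compat_r; [left; apply Rinv_pos; lra|].
    apply far_frequency; [right; lra|]. intros x Hx. specialize (Hdf0 x Hx). split; [lra|].
    rewrite Rabs_right by (left; apply Rdiv_lt_0_compat; lra).
    apply Rmult_le_reg_r with ((df x - - INR k) * (INR n0 + INR k)); [apply Rmult_lt_0_compat; lra|].
    field_simplify; nra. }
  assert (Hsplit : rsum V (fun k => A (INR k) / INR k) = rsum n0 (fun k => A (INR k) / INR k)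
     + rsum (V - n0) (fun j => A (INR (n0 + j)) / INR (n0 + j))).
  { replace V with (n0 + (V - n0))%nat at 1 by lia. generalize (V - n0)%nat as q.
    induction q as [|q IH]; [rewrite Nat.add_0_r; simpl; ring|].
    rewrite Nat.add_succ_r. cbn [rsum]. rewrite IH, Nat.add_succ_r. ring. }
  assert (Hfar : Rabs (rsum (V - n0) (fun j => A (INR (n0 + j)) / INR (n0 + j))) <= harm n0).
  { eapply Rle_trans; [|apply (harm_telescope n0 (V - n0)); auto].
    apply rsum_abs_le. intros k Hk. assert (hk : 1 <= INR k) by (apply INR_ge1; lia). rewrite plus_INR.
    unfold Rdiv at 1. rewrite Rabs_mult, (Rabs_right (/ (INR n0 + INR k))) by (left; apply Rinv_pos; lra).
    replace (INR n0 / (INR k * (INR n0 + INR k))) with (INR n0 / INR k * / (INR n0 + INR k)) by (field; lra).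
    apply Rmult_le_compat_r; [left; apply Rinv_pos; lra|].
    apply far_frequency; [left; lra|]. intros x Hx. specialize (Hdf0 x Hx). split; [lra|].
    replace (df x / (df x - (INR n0 + INR k))) with (- (df x / (INR n0 + INR k - df x))) by (field; lra).
    rewrite Rabs_Ropp, Rabs_right by (left; apply Rdiv_lt_0_compat; lra).
    apply Rmult_le_reg_r with ((INR n0 + INR k - df x) * INR k); [apply Rmult_lt_0_compat; lra|].
    field_simplify; nra. }
  assert (Hnear : Rabs (rsum n0 (fun k => A (INR k) / INR k) - rsum n0 (fun k => I (INR k))) <= harm n0).
  { apply rsum_dist_le. intros k Hk. apply near_frequency. apply lt_0_INR; lia. }
  rewrite Hsplit.
  apply Rabs_le_between in Hneg. apply Rabs_le_between in Hfar. apply Rabs_le_between in Hnear.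
  apply Rabs_le. lra.
Qed.

(** [V] is chosen after everything else and drops out, because [sawtooth_integral] is uniform in it.
    The added 3 is 2 for the ends of the interval plus [eps = 1]. *)
Lemma truncated_poisson K : b <= INR K ->
  Rabs (rsum K (fun k => cut a b (INR k) * cos (2 * PI * f (INR k) + phi)) -
    (RInt (fun x => cos (2 * PI * f x + phi)) a b
     + rsum n0 (fun k => RInt (fun x => cos (2 * PI * (f x - INR k * x) + phi)) a b)))
  <= 3 * harm n0 + 3.
Proof.
  intros HK.
  assert (E0 : forall x, cos (2 * PI * f x + phi) = cos (ph 0 x)) by (intros; unfold ph; f_equal; ring).
  destruct (sawtooth_sum (fun x => cos (ph 0 x)) (fun x => - (2 * PI * (df x - 0)) * sin (ph 0 x)) a b Ha Hab) with (K := K) (eps := 1) as [V0 H0]; auto; try lra.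
  - intros x Hx. now apply is_derive_cos_comp, ph_derive.
  - intros x Hx. apply (continuous_mult (fun x => - (2 * PI * (df x - 0))) (fun x => sin (ph 0 x))).
    + apply (continuous_opp (fun x => 2 * PI * (df x - 0))).
      apply (continuous_mult (fun _ => 2 * PI) (fun x => df x - 0)); [apply continuous_const|].
      apply (continuous_minus df (fun _ => 0)); [auto|apply continuous_const].
    + eapply is_derive_cont, is_derive_sin_comp, ph_derive; auto.
  - intros; apply Rabs_le, COS_bound.
  - specialize (H0 (V0 + n0)%nat ltac:(lia)).
    assert (H1 := sawtooth_integral (V0 + n0) ltac:(lia)).
    rewrite (rsum_ext K _ (fun k => cut a b (INR k) * cos (ph 0 (INR k)))) by (intros; now rewrite E0).
    rewrite (RInt_ext (fun x => cos (2 * PI * f x + phi)) (fun x => cos (ph 0 x))) by (intros; apply E0).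
    unfold I, ph in *.
    apply Rabs_le_between in H0. apply Rabs_le_between in H1. apply Rabs_le. lra.
Qed.

End Truncated_Poisson.

(** * Fresnel integrals and the quadratic phase *)

Definition fresnel (phi W : R) : R := RInt (fun w => cos (PI * w ^ 2 + phi)) 0 W.

Lemma fresnel_phase_derive phi w : is_derive (fun w => PI * w ^ 2 + phi) w (2 * PI * w).
Proof. auto_derive; [auto|]. ring. Qed.

Lemma fresnel_integrand_cont phi w : continuous (fun w => cos (PI * w ^ 2 + phi)) w.
Proof. eapply is_derive_cont, is_derive_cos_comp, fresnel_phase_derive. Qed.

Lemma fresnel_ex phi a b : ex_RInt (fun w => cos (PI * w ^ 2 + phi)) a b.
Proof.
  apply (ex_RInt_continuous (V := R_CompleteNormedModule)); intros; apply fresnel_integrand_cont.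
Qed.

Lemma fresnel_diff phi u v :
  RInt (fun w => cos (PI * w ^ 2 + phi)) u v = fresnel phi v - fresnel phi u.
Proof.
  unfold fresnel.
  assert (h : RInt (fun w => cos (PI * w ^ 2 + phi)) 0 u + RInt (fun w => cos (PI * w ^ 2 + phi)) u v
    = RInt (fun w => cos (PI * w ^ 2 + phi)) 0 v)
    by (apply (RInt_Chasles (V := R_CompleteNormedModule)); apply fresnel_ex).
  lra.
Qed.

Lemma fresnel_opp phi W : fresnel phi (- W) = - fresnel phi W.
Proof.
  apply is_RInt_unique.
  assert (H : is_RInt (fun w => cos (PI * w ^ 2 + phi)) (-0) (- - W) (RInt (fun w => cos (PI * w ^ 2 + phi)) 0 W)).
  { rewrite Ropp_0, Ropp_involutive. apply (RInt_correct (V := R_CompleteNormedModule)), fresnel_ex. }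
  apply is_RInt_comp_opp in H.
  apply is_RInt_opp in H.
  apply is_RInt_ext with (2 := H).
  intros x _. rewrite Ropp_involutive. f_equal. ring.
Qed.

Lemma fresnel_tail phi u v : 0 < u <= v -> Rabs (fresnel phi v - fresnel phi u) <= / u.
Proof.
  intros Huv. assert (hp : 3 <= PI) by (generalize PI2_3_2; lra).
  rewrite <- fresnel_diff. apply Rle_trans with (4 / (2 * PI * u)).
  - apply (first_derivative_test (fun w => PI * w ^ 2 + phi) (fun w => 2 * PI * w) (fun _ => 2 * PI)); try nra.
    + intros w _. apply fresnel_phase_derive.
    + intros w _. auto_derive; [auto|ring].
    + intros w _. apply continuous_const.
    + left. intros; lra.
    + intros w Hw. nra.
  - apply div_le_iff; [nra|]. replace (/ u * (2 * PI * u)) with (2 * PI) by (field; lra). lra.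
Qed.

(** [fresnel_tail] makes the integral Cauchy. [kappa] is the integral over the whole line, hence the
    factor 2; for [W < 1] the estimate at 1 and a trivial bound suffice. *)
Lemma fresnel_limit phi :
  exists kappa, forall W, 0 <= W -> Rabs (2 * fresnel phi W - kappa) <= 8 / (1 + W).
Proof.
  assert (HC : ex_finite_lim_seq (fun n => fresnel phi (INR n))).
  { apply ex_lim_seq_cauchy_corr. intros eps.
    destruct (nfloor_ex (/ eps)) as [n Hn]; [left; apply Rinv_pos, eps|].
    assert (He : 0 < / eps) by apply Rinv_pos, eps.
    assert (Hbase : forall p q, (S n <= p <= q)%nat -> Rabs (fresnel phi (INR q) - fresnel phi (INR p)) < eps).
    { intros p q [h1 h2]. apply le_INR in h1. apply le_INR in h2. rewrite S_INR in h1.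
      eapply Rle_lt_trans; [apply fresnel_tail; lra|].
      rewrite <- (Rinv_inv eps). apply Rinv_lt_contravar; nra. }
    exists (S n). intros p q hp hq. destruct (Nat.le_ge_cases p q).
    - rewrite Rabs_minus_sym. apply Hbase; lia.
    - apply Hbase; lia. }
  destruct HC as [l Hl]. exists (2 * l).
  assert (H1 : forall W, 0 < W -> Rabs (fresnel phi W - l) <= / W).
  { intros W HW.
    destruct (nfloor_ex W) as [n0 Hn0]; [lra|].
    assert (HL : is_lim_seq (fun n => Rabs (fresnel phi (INR n) - fresnel phi W)) (Rabs (l - fresnel phi W))).
    { apply (is_lim_seq_abs _ (Finite (l - fresnel phi W))).
      apply is_lim_seq_minus'; [exact Hl|apply is_lim_seq_const]. }
    rewrite Rabs_minus_sym.
    apply (is_lim_seq_le_loc (fun n => Rabs (fresnel phi (INR n) - fresnel phi W)) (fun _ => / W) (Finite (Rabs (l - fresnel phi W))) (Finite (/ W))) ; [|exact HL|apply is_lim_seq_const].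
    exists (S n0). intros n Hn. apply fresnel_tail. split; auto.
    apply le_INR in Hn. rewrite S_INR in Hn. lra. }
  intros W HW. replace (2 * fresnel phi W - 2 * l) with (2 * (fresnel phi W - l)) by ring.
  rewrite Rabs_mult, Rabs_right by lra.
  destruct (Rle_dec 1 W) as [h|h].
  - specialize (H1 W ltac:(lra)).
    assert (/ W <= 4 / (1 + W)); [|unfold Rdiv in *; lra].
    apply Rmult_le_reg_r with (W * (1 + W)); [nra|]. field_simplify; lra.
  - specialize (H1 1 ltac:(lra)). rewrite Rinv_1 in H1.
    assert (H2 : Rabs (fresnel phi 1 - fresnel phi W) <= 1 - W).
    { rewrite <- fresnel_diff.
      apply (RInt_abs_le _ (fun _ => 1)); [lra|apply fresnel_ex| |intros; apply Rabs_le, COS_bound].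
      evar_last; [apply is_RInt_cst|ring]. }
    assert (H3 : Rabs (fresnel phi W - l) <= 2).
    {
      apply Rabs_le_between in H1. apply Rabs_le_between in H2. apply Rabs_le. lra. }
    assert (4 <= 8 / (1 + W)); [|lra].
    apply Rmult_le_reg_r with (1 + W); [lra|]. field_simplify; lra.
Qed.

(** The complete Fresnel integral with shift [phi], when [k1] and [k2] are its values at the shifts
    0 and [- (PI / 2)]. *)
Definition rot (k1 k2 phi : R) : R := cos phi * k1 - sin phi * k2.

Lemma fresnel_rot phi W :
  fresnel phi W = cos phi * fresnel 0 W - sin phi * fresnel (- (PI / 2)) W.
Proof.
  apply is_RInt_unique.
  apply (is_RInt_ext_all
    (fun w => cos phi * cos (PI * w ^ 2 + 0) - sin phi * cos (PI * w ^ 2 + - (PI / 2)))).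
  - intros w. rewrite Rplus_0_r, (cos_plus (PI * w ^ 2) phi).
    replace (PI * w ^ 2 + - (PI / 2)) with (- (PI / 2 - PI * w ^ 2)) by ring.
    rewrite cos_neg, cos_shift. ring.
  - apply (is_RInt_minus
      (fun w => cos phi * cos (PI * w ^ 2 + 0)) (fun w => sin phi * cos (PI * w ^ 2 + - (PI / 2))));
    apply (is_RInt_scal (V := R_NormedModule)); apply (RInt_correct (V := R_CompleteNormedModule)), fresnel_ex.
Qed.

Lemma fresnel_constants : exists k1 k2, forall phi W, 0 <= W ->
  Rabs (2 * fresnel phi W - rot k1 k2 phi) <= 16 / (1 + W).
Proof.
  destruct (fresnel_limit 0) as [k1 H1]. destruct (fresnel_limit (- (PI / 2))) as [k2 H2].
  exists k1, k2. intros phi W HW. specialize (H1 W HW). specialize (H2 W HW).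
  rewrite fresnel_rot. unfold rot.
  set (x := 2 * fresnel 0 W - k1) in *. set (y := 2 * fresnel (- (PI / 2)) W - k2) in *.
  replace (2 * (cos phi * fresnel 0 W - sin phi * fresnel (- (PI / 2)) W) - (cos phi * k1 - sin phi * k2))
    with (cos phi * x + - (sin phi * y)) by (unfold x, y; ring).
  eapply Rle_trans; [apply Rabs_triang|]. rewrite Rabs_Ropp, !Rabs_mult.
  assert (C := COS_bound phi). assert (S := SIN_bound phi).
  assert (Rabs (cos phi) <= 1) by (apply Rabs_le; lra). assert (Rabs (sin phi) <= 1) by (apply Rabs_le; lra).
  assert (Rabs (cos phi) * Rabs x <= 1 * (8 / (1 + W))) by (apply Rmult_le_compat; auto using Rabs_pos).
  assert (Rabs (sin phi) * Rabs y <= 1 * (8 / (1 + W))) by (apply Rmult_le_compat; auto using Rabs_pos).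
  lra.
Qed.

(** [fresnel] is odd in [W]: when 0 lies between [u] and [v] the two half-line values add up to the
    main term, and when both ends are on the same side they cancel. *)
Lemma fresnel_between k1 k2 :
  (forall phi W, 0 <= W -> Rabs (2 * fresnel phi W - rot k1 k2 phi) <= 16 / (1 + W)) ->
  forall phi u v, u <= v ->
  Rabs (RInt (fun w => cos (PI * w ^ 2 + phi)) u v - cut u v 0 * rot k1 k2 phi)
    <= 8 / (1 + Rabs u) + 8 / (1 + Rabs v).
Proof.
  intros H phi u v Huv. rewrite fresnel_diff.
  assert (Hp : forall w, 0 <= w -> Rabs (fresnel phi w - rot k1 k2 phi / 2) <= 8 / (1 + Rabs w)).
  { intros w Hw. specialize (H phi w Hw). rewrite (Rabs_right w) by lra.
    apply Rabs_le_between in H. apply Rabs_le. unfold Rdiv in *; lra. }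
  assert (Hm : forall w, w <= 0 -> Rabs (fresnel phi w + rot k1 k2 phi / 2) <= 8 / (1 + Rabs w)).
  { intros w Hw. rewrite <- (Rabs_Ropp w). specialize (Hp (- w) ltac:(lra)). rewrite fresnel_opp in Hp.
    rewrite <- Rabs_Ropp.
    replace (- (fresnel phi w + rot k1 k2 phi / 2)) with (- fresnel phi w - rot k1 k2 phi / 2) by ring. exact Hp. }
  destruct (cut_cases u v 0) as [[h ->]|[h ->]].
  - assert (A1 := Hm u ltac:(lra)). assert (A2 := Hp v ltac:(lra)).
    apply Rabs_le_between in A1. apply Rabs_le_between in A2. apply Rabs_le. lra.
  - destruct h as [h|h].
    + assert (A1 := Hp u ltac:(lra)). assert (A2 := Hp v ltac:(lra)).
      apply Rabs_le_between in A1. apply Rabs_le_between in A2. apply Rabs_le. lra.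
    + assert (A1 := Hm u ltac:(lra)). assert (A2 := Hm v ltac:(lra)).
      apply Rabs_le_between in A1. apply Rabs_le_between in A2. apply Rabs_le. lra.
Qed.

(** * The B-process for a quadratic phase, with undetermined Fresnel constants *)

Section Quadratic.

Variables (k1 k2 : R).
Hypothesis Hk : forall phi W, 0 <= W -> Rabs (2 * fresnel phi W - rot k1 k2 phi) <= 16 / (1 + W).

(** Completing the square with [w = sqrt t * x - y / sqrt t]. The Fresnel error [8 / (1 + |w|)]
    divided by [sqrt t] becomes the stated one, since [sqrt t * w = t * x - y]. *)
Lemma quadratic_integral t a b y phi :
  0 < t -> a <= b ->
  Rabs (RInt (fun x => cos (2 * PI * (t * x ^ 2 / 2 - y * x) + phi)) a b
        - cut (t * a) (t * b) y * / sqrt t * rot k1 k2 (phi - PI * y ^ 2 / t))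
  <= 8 * (/ (sqrt t + Rabs (t * a - y)) + / (sqrt t + Rabs (t * b - y))).
Proof.
  intros Ht Hab. assert (hs : 0 < sqrt t) by now apply sqrt_lt_R0.
  assert (hss : sqrt t * sqrt t = t) by (apply sqrt_sqrt; lra).
  set (s := sqrt t) in *. set (psi := phi - PI * y ^ 2 / t).
  set (wa := s * a + - (y / s)). set (wb := s * b + - (y / s)).
  assert (Hsw : forall x, s * (s * x + - (y / s)) = t * x - y) by (intros; rewrite <- hss; field; lra).
  assert (E : RInt (fun x => cos (2 * PI * (t * x ^ 2 / 2 - y * x) + phi)) a b
     = / s * RInt (fun w => cos (PI * w ^ 2 + psi)) wa wb).
  { apply is_RInt_unique.
    apply (is_RInt_ext_le (fun x => / s * (s * cos (PI * (s * x + - (y / s)) ^ 2 + psi)))); auto.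
    - intros x Hx. rewrite <- Rmult_assoc, Rinv_l, Rmult_1_l by lra. f_equal. unfold psi. rewrite <- hss. field. lra.
    - apply (is_RInt_scal (V := R_NormedModule)).
      apply (is_RInt_comp_lin (fun w => cos (PI * w ^ 2 + psi)) s (- (y / s)) a b).
      apply (RInt_correct (V := R_CompleteNormedModule)), fresnel_ex. }
  rewrite E.
  assert (Hcut : cut (t * a) (t * b) y = cut wa wb 0).
  { apply cut_iff. assert (Ea := Hsw a). assert (Eb := Hsw b). fold wa in Ea. fold wb in Eb.
    split; intros [h1 h2]; split; nra. }
  rewrite Hcut.
  replace (/ s * RInt (fun w => cos (PI * w ^ 2 + psi)) wa wb - cut wa wb 0 * / s * rot k1 k2 psi)
    with (/ s * (RInt (fun w => cos (PI * w ^ 2 + psi)) wa wb - cut wa wb 0 * rot k1 k2 psi)) by ring.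
  assert (hi : 0 < / s) by now apply Rinv_pos.
  rewrite Rabs_mult, (Rabs_right (/ s)) by lra.
  eapply Rle_trans; [apply Rmult_le_compat_l; [lra|apply (fresnel_between k1 k2 Hk)]|].
  - unfold wa, wb. nra.
  - rewrite <- (Hsw a), <- (Hsw b). fold wa wb. rewrite !Rabs_mult, !(Rabs_right s) by lra.
    assert (p1 := Rabs_pos wa). assert (p2 := Rabs_pos wb).
    right. field. repeat split; nra.
Qed.

(** [T] bounds the contribution of the frequencies nearest to an endpoint. It is left to the caller:
    [1 / sqrt t] always works, and a constant does when no positive integer is close to the
    endpoints. *)
Lemma quadratic_b_process t a b phi K n0 T :
  0 < t -> 0 < a <= b -> b <= INR K -> (1 <= n0)%nat -> t * b <= INR n0 -> 0 <= T ->
  (forall k, (1 <= k)%nat -> / (sqrt t + Rabs (t * a - INR k)) <= T) ->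
  (forall k, (1 <= k)%nat -> / (sqrt t + Rabs (t * b - INR k)) <= T) ->
  Rabs (rsum K (fun m => cut a b (INR m) * cos (PI * t * INR m ^ 2 + phi))
      - / sqrt t * rsum n0 (fun m => cut (t * a) (t * b) (INR m) * rot k1 k2 (phi - PI * INR m ^ 2 / t)))
  <= 40 * harm n0 + 32 * T + 16 / (t * a).
Proof.
  intros Ht Hab HK Hn0 Htb HT HTa HTb.
  assert (hs : 0 < sqrt t) by now apply sqrt_lt_R0.
  assert (Hh := harm_ge1 n0 Hn0).
  assert (HP := truncated_poisson (fun x => t * x ^ 2 / 2) (fun x => t * x) (fun _ => t) a b phi n0).
  specialize (HP ltac:(lra) ltac:(lra)).
  assert (HP' : Rabs (rsum K (fun k => cut a b (INR k) * cos (2 * PI * (t * INR k ^ 2 / 2) + phi)) -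
    (RInt (fun x => cos (2 * PI * (t * x ^ 2 / 2) + phi)) a b
     + rsum n0 (fun k => RInt (fun x => cos (2 * PI * (t * x ^ 2 / 2 - INR k * x) + phi)) a b)))
    <= 3 * harm n0 + 3).
  { apply HP; auto.
    - intros x Hx. auto_derive; [auto|]. field.
    - intros x Hx. auto_derive; [auto|]. ring.
    - intros x Hx. apply continuous_const.
    - left; intros; lra.
    - intros x Hx; split; nra. }
  clear HP.
  rewrite (rsum_ext K _ (fun k => cut a b (INR k) * cos (2 * PI * (t * INR k ^ 2 / 2) + phi))).
  2:{ intros k _. do 2 f_equal. field. }
  (* The frequency 0 lies to the left of [t * a], so it contributes endpoint terms and no main
     term. *)
  assert (H0 := quadratic_integral t a b 0 phi Ht ltac:(lra)).
  rewrite cut_out in H0 by (left; nra). rewrite !Rmult_0_l, Rminus_0_r, !Rminus_0_r in H0.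
  assert (H0' : Rabs (RInt (fun x => cos (2 * PI * (t * x ^ 2 / 2) + phi)) a b) <= 16 / (t * a)).
  { replace (RInt (fun x => cos (2 * PI * (t * x ^ 2 / 2) + phi)) a b)
      with (RInt (fun x => cos (2 * PI * (t * x ^ 2 / 2 - 0 * x) + phi)) a b).
    2:{ apply RInt_ext; intros; do 3 f_equal; ring. }
    eapply Rle_trans; [exact H0|].
    assert (Hi : forall x, t * a <= x -> / (sqrt t + Rabs x) <= / (t * a)).
    { intros x Hx. assert (0 < t * a) by nra. apply Rinv_le_contravar; auto. rewrite Rabs_right by lra. lra. }
    assert (I1 := Hi (t * a) ltac:(lra)). assert (I2 := Hi (t * b) ltac:(nra)). unfold Rdiv; lra. }
  assert (HM : Rabs (rsum n0 (fun k => RInt (fun x => cos (2 * PI * (t * x ^ 2 / 2 - INR k * x) + phi)) a b)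
     - rsum n0 (fun k => cut (t * a) (t * b) (INR k) * / sqrt t * rot k1 k2 (phi - PI * INR k ^ 2 / t)))
     <= 32 * T + 32 * harm n0).
  { eapply Rle_trans.
    - apply rsum_dist_le. intros k Hk0. apply quadratic_integral; lra.
    - rewrite rsum_scal, rsum_plus.
      assert (Hsp : forall z, (forall k, (1 <= k)%nat -> / (sqrt t + Rabs (z - INR k)) <= T) ->
        rsum n0 (fun k => / (sqrt t + Rabs (z - INR k))) <= 2 * T + 2 / 1 * harm n0).
      { intros z Hz0. apply (spaced_sum n0 INR _ z 1); try lra.
        - intros; lra.
        - intros k Hk0. apply Hz0; lia.
        - intros k _ Hz. apply Rinv_le_contravar.
          + apply Rabs_pos_lt; lra.
          + rewrite (Rabs_minus_sym (INR k)). lra. }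
      assert (S1 := Hsp (t * a) HTa). assert (S2 := Hsp (t * b) HTb). lra. }
  rewrite <- rsum_scal.
  rewrite (rsum_ext n0 _ (fun k => cut (t * a) (t * b) (INR k) * / sqrt t * rot k1 k2 (phi - PI * INR k ^ 2 / t))).
  2:{ intros; ring. }
  apply Rabs_le_between in HP'. apply Rabs_le_between in H0'. apply Rabs_le_between in HM.
  apply Rabs_le. lra.
Qed.

(** A square is 0 or 1 modulo 4, so [PI * m^2 / 2] takes two values modulo [2 PI], according to the
    parity of [m]. *)
Lemma rot_quarter_pairs L phi :
  rsum (2 * L) (fun m => rot k1 k2 (phi - PI * INR m ^ 2 / 2))
   = INR L * (rot k1 k2 phi + rot k1 k2 (phi - PI / 2)).
Proof.
  assert (Hper : forall x k, rot k1 k2 (x - 2 * INR k * PI) = rot k1 k2 x).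
  { intros x k. unfold rot. rewrite <- (cos_period (x - _) k), <- (sin_period (x - _) k).
    do 3 f_equal; ring. }
  induction L as [|L IH]; [simpl; ring|].
  replace (2 * S L)%nat with (S (S (2 * L))) by lia. cbn [rsum]. rewrite IH.
  replace (rot k1 k2 (phi - PI * INR (S (2 * L)) ^ 2 / 2)) with (rot k1 k2 (phi - PI / 2)).
  2:{ rewrite <- (Hper (phi - PI / 2) (L * L + L)%nat). f_equal.
      rewrite S_INR, plus_INR, !mult_INR. simpl. field. }
  replace (rot k1 k2 (phi - PI * INR (S (S (2 * L))) ^ 2 / 2)) with (rot k1 k2 phi).
  2:{ rewrite <- (Hper phi (L * L + 2 * L + 1)%nat). f_equal.
      rewrite !S_INR, !plus_INR, !mult_INR. simpl. field. }
  rewrite S_INR. ring.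
Qed.

(** For [t = 2] the terms [cos (PI * t * m ^ 2 + phi)] do not depend on [m], which evaluates the Fresnel constants. *)
Lemma rot_constraint phi :
  cos phi = / sqrt 2 * (rot k1 k2 phi + rot k1 k2 (phi - PI / 2)).
Proof.
  set (z := cos phi - / sqrt 2 * (rot k1 k2 phi + rot k1 k2 (phi - PI / 2))).
  assert (hs : 1 <= sqrt 2) by (rewrite <- sqrt_1 at 1; apply sqrt_le_1; lra).
  assert (hi : 0 < / sqrt 2 <= 1).
  { split; [apply Rinv_pos; lra|]. rewrite <- Rinv_1. apply Rinv_le_contravar; lra. }
  assert (Hrot : forall x, Rabs (rot k1 k2 x) <= 16).
  { intros x. specialize (Hk x 0 ltac:(lra)). unfold fresnel in Hk. rewrite RInt_point in Hk.
    rewrite Rmult_0_r, Rminus_0_l, Rabs_Ropp, Rplus_0_r, Rdiv_1_r in Hk. exact Hk. }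
  (* Both sides of the B-process on [[1, L]] are [L] times a constant, up to a logarithmic error;
     [z] is the difference of the two constants. *)
  assert (Hz : forall L, (1 <= L)%nat -> INR L * Rabs z <= 40 * harm (2 * L) + 80).
  { intros L HL. assert (hL : 1 <= INR L) by now apply INR_ge1.
    assert (H := quadratic_b_process 2 1 (INR L) phi L (2 * L) 1).
    assert (H' : 2 * INR L <= INR (2 * L)) by (rewrite mult_INR; simpl; lra).
    assert (HT : forall z k, (1 <= k)%nat -> / (sqrt 2 + Rabs (z - INR k)) <= 1).
    { intros x k _. rewrite <- Rinv_1. apply Rinv_le_contravar; [lra|]. generalize (Rabs_pos (x - INR k)); lra. }
    specialize (H ltac:(lra) ltac:(lra) ltac:(lra) ltac:(lia) H' ltac:(lra) (HT _) (HT _)).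
    rewrite (rsum_ext L _ (fun _ => cos phi)) in H.
    2:{ intros k Hk0. rewrite cut_in.
        - rewrite Rmult_1_l. rewrite <- (cos_period phi (k * k)). f_equal. rewrite mult_INR. ring.
        - split; [apply INR_ge1; lia|apply le_INR; lia]. }
    rewrite rsum_const in H.
    (* The dual range is [[2, 2 L]], so the complete pairs overcount by the term [m = 1]. *)
    assert (E : rsum (2 * L) (fun m => cut (2 * 1) (2 * INR L) (INR m) * rot k1 k2 (phi - PI * INR m ^ 2 / 2))
       = INR L * (rot k1 k2 phi + rot k1 k2 (phi - PI / 2)) - rot k1 k2 (phi - PI * INR 1 ^ 2 / 2)).
    { rewrite <- rot_quarter_pairs.
      assert (E3 : rsum (2 * L) (fun m => (1 - cut (2 * 1) (2 * INR L) (INR m)) * rot k1 k2 (phi - PI * INR m ^ 2 / 2))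
        = rsum (2 * L) (fun m => rot k1 k2 (phi - PI * INR m ^ 2 / 2))
        - rsum (2 * L) (fun m => cut (2 * 1) (2 * INR L) (INR m) * rot k1 k2 (phi - PI * INR m ^ 2 / 2))).
      { rewrite <- rsum_minus. apply rsum_ext; intros; ring. }
      rewrite (rsum_single (2 * L) 1) in E3.
      - rewrite cut_out in E3 by (left; simpl; lra). lra.
      - lia.
      - intros k h1 h2. rewrite cut_in; [ring|]. split.
        + replace (2 * 1) with (INR 2) by (simpl; ring). apply le_INR; lia.
        + replace (2 * INR L) with (INR (2 * L)) by (rewrite mult_INR; simpl; ring). apply le_INR; lia. }
    rewrite E in H.
    assert (Hr := Hrot (phi - PI * INR 1 ^ 2 / 2)). set (r := rot k1 k2 (phi - PI * INR 1 ^ 2 / 2)) in *.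
    rewrite <- (Rabs_right (INR L)) by lra. rewrite <- Rabs_mult.
    replace (INR L * z) with ((INR L * cos phi - / sqrt 2 * (INR L * (rot k1 k2 phi + rot k1 k2 (phi - PI / 2)) - r)) + - (/ sqrt 2 * r)) by (unfold z; ring).
    eapply Rle_trans; [apply Rabs_triang|]. rewrite Rabs_Ropp, (Rabs_mult (/ sqrt 2)), (Rabs_right (/ sqrt 2)) by lra.
    assert (/ sqrt 2 * Rabs r <= 1 * 16) by (apply Rmult_le_compat; auto using Rabs_pos; lra).
    lra. }
  destruct (Req_dec z 0) as [e|e]; [unfold z in e; lra|exfalso].
  assert (Hp : 0 < Rabs z) by now apply Rabs_pos_lt.
  (* Linear growth against logarithmic growth; the numbers 30 and 1000 leave ample room for the
     contradiction. *)
  destruct (ln_ratio_small (Rabs z / 30)) as [V0 HV]; [lra|].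
  destruct (nfloor_ex (1000 / Rabs z)) as [n Hn]; [left; apply Rdiv_lt_0_compat; lra|].
  set (L := (V0 + n + 1)%nat).
  assert (hL : 1 <= INR L) by (apply INR_ge1; unfold L; lia).
  specialize (Hz L ltac:(unfold L; lia)). specialize (HV (2 * L)%nat ltac:(unfold L; lia)).
  assert (H2L : INR (2 * L) = 2 * INR L) by (rewrite mult_INR; simpl; ring).
  assert (Hh : harm (2 * L) <= 1 + ln (1 + INR (2 * L))) by (apply harm_le_ln; lra).
  assert (Hln : 16 * ln (1 + INR (2 * L)) <= Rabs z / 30 * (2 * INR L)).
  { rewrite H2L in *. apply Rmult_le_reg_r with (/ (2 * INR L)); [apply Rinv_pos; lra|].
    replace (Rabs z / 30 * (2 * INR L) * / (2 * INR L)) with (Rabs z / 30) by (field; lra). exact HV. }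
  assert (Hbig : 1000 <= INR L * Rabs z).
  { apply Rmult_le_reg_r with (/ Rabs z); [apply Rinv_pos; auto|].
    replace (INR L * Rabs z * / Rabs z) with (INR L) by (field; lra).
    apply Rle_trans with (INR n + 1); [unfold Rdiv in Hn; lra|].
    rewrite <- S_INR. apply le_INR. unfold L; lia. }
  lra.
Qed.

(** [rot_constraint] is linear in [k1] and [k2]. At [phi = 0] it reads [k1 + k2 = sqrt 2] and at
    [phi = - (PI / 2)] it reads [k1 = k2], so both are [1 / sqrt 2]. *)
Lemma rot_value phi : rot k1 k2 phi = cos (phi + PI / 4).
Proof.
  assert (H0 := rot_constraint 0). assert (H1 := rot_constraint (- (PI / 2))).
  rewrite Rminus_0_l in H0. replace (- (PI / 2) - PI / 2) with (- PI) in H1 by field.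
  unfold rot in *. rewrite !cos_neg, !sin_neg, cos_PI2, sin_PI2, ?cos_PI, ?sin_PI, ?cos_0, ?sin_0 in *.
  rewrite cos_plus, cos_PI4, sin_PI4.
  assert (hs : 0 < / sqrt 2) by (apply Rinv_pos, sqrt_lt_R0; lra).
  assert (hss : / sqrt 2 * / sqrt 2 = / 2).
  { rewrite <- Rinv_mult, sqrt_sqrt by lra. reflexivity. }
  assert (E1 : k1 = k2) by nra. subst k2.
  assert (E2 : k1 = 1 / sqrt 2).
  { unfold Rdiv. rewrite Rmult_1_l. apply Rmult_eq_reg_l with (/ sqrt 2); [|lra]. lra. }
  rewrite E2. ring.
Qed.

End Quadratic.

Lemma fresnel_between_value phi u v : u <= v ->
  Rabs (RInt (fun w => cos (PI * w ^ 2 + phi)) u v - cut u v 0 * cos (phi + PI / 4))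
    <= 8 / (1 + Rabs u) + 8 / (1 + Rabs v).
Proof.
  destruct fresnel_constants as (k1 & k2 & Hk). rewrite <- (rot_value k1 k2 Hk).
  now apply fresnel_between.
Qed.

Lemma gauss_sum_reciprocity t a b phi K n0 T :
  0 < t -> 0 < a <= b -> b <= INR K -> (1 <= n0)%nat -> t * b <= INR n0 -> 0 <= T ->
  (forall k, (1 <= k)%nat -> / (sqrt t + Rabs (t * a - INR k)) <= T) ->
  (forall k, (1 <= k)%nat -> / (sqrt t + Rabs (t * b - INR k)) <= T) ->
  Rabs (rsum K (fun m => cut a b (INR m) * cos (PI * t * INR m ^ 2 + phi))
      - / sqrt t * rsum n0 (fun m => cut (t * a) (t * b) (INR m) * cos (phi + PI / 4 - PI * INR m ^ 2 / t)))
  <= 40 * harm n0 + 32 * T + 16 / (t * a).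
Proof.
  intros. destruct fresnel_constants as (k1 & k2 & Hk).
  rewrite (rsum_ext n0 _ (fun m => cut (t * a) (t * b) (INR m) * rot k1 k2 (phi - PI * INR m ^ 2 / t))).
  - now apply (quadratic_b_process k1 k2 Hk).
  - intros k _. rewrite (rot_value k1 k2 Hk). do 2 f_equal. ring.
Qed.

(** * Stationary phase for the power 2/3 *)

(** As an instance of [Rpower] this is positive for every [x], even where it is not a cube root;
    hence [cbrt_pos] is unconditional while [cbrt_cube] asks for [0 < x]. *)
Definition cbrt (x : R) : R := Rpower x (/ 3).

Lemma cbrt_pos x : 0 < cbrt x.
Proof. apply exp_pos. Qed.

Lemma cbrt_cube x : 0 < x -> cbrt x ^ 3 = x.
Proof.
  intros Hx. unfold cbrt. rewrite <- Rpower_pow by apply exp_pos.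
  rewrite Rpower_mult. replace (/ 3 * INR 3) with 1 by (simpl; field). now apply Rpower_1.
Qed.

Lemma cube_cbrt z : 0 < z -> cbrt (z ^ 3) = z.
Proof.
  intros Hz. unfold cbrt. rewrite <- Rpower_pow by auto.
  rewrite Rpower_mult. replace (INR 3 * / 3) with 1 by (simpl; field). now apply Rpower_1.
Qed.

Lemma cube_le_iff x y : 0 <= x -> 0 <= y -> (x ^ 3 <= y ^ 3 <-> x <= y).
Proof.
  intros Hx Hy; split; intros H; [|apply pow_incr; lra].
  destruct (Rle_dec x y) as [h|h]; auto. exfalso.
  assert (y * y <= x * x) by nra. assert (0 < x * x) by nra. nra.
Qed.

Lemma cbrt_le x y : 0 < x <= y -> cbrt x <= cbrt y.
Proof.
  intros H. apply cube_le_iff; try (left; apply cbrt_pos). rewrite !cbrt_cube; lra.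
Qed.

Lemma cbrt_derive x : 0 < x -> is_derive cbrt x (/ (3 * cbrt x ^ 2)).
Proof.
  intros Hx. apply is_derive_Reals.
  replace (/ (3 * cbrt x ^ 2)) with (/ 3 * Rpower x (/ 3 - 1)); [now apply derivable_pt_lim_power|].
  assert (h := cbrt_pos x). unfold Rminus. rewrite Rpower_plus, Rpower_Ropp, Rpower_1 by auto. fold (cbrt x).
  rewrite <- (cbrt_cube x Hx) at 2. field. lra.
Qed.

Section Stationary.

Variables (g y phi : R).
Hypothesis Hg : 0 < g.
Hypothesis Hy : 0 < y.

(** With [v = 1] at the stationary point [x0 = g ^ 6 / y ^ 3], the substitution [x = xv v] turns the phase
    [y * x - 3 / 2 * g ^ 2 * x ^ (2/3)] into [wv v ^ 2 / 2] up to a constant, both maps being polynomial in [v]. *)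
Let sv (v : R) := (3 * v ^ 2 - 1) / 2.
Let xv (v : R) := (g ^ 2 / y * sv v) ^ 3.
Let wv (v : R) := 3 * sqrt 3 / 2 * (g ^ 3 / y) * (v ^ 3 - v).
Let dwv (v : R) := 3 * sqrt 3 * (g ^ 3 / y) * sv v.
Let qv (v : R) := / (3 * y) * (3 + 2 / (v * (v + 1))).
Let psi := phi - PI * (g ^ 3) ^ 2 / y ^ 2.
Let F (x : R) := cos (2 * PI * (y * x - 3 / 2 * g ^ 2 * cbrt x ^ 2) + phi).
Let vx (x : R) := sqrt ((2 * (y * cbrt x / g ^ 2) + 1) / 3).

Lemma sqrt3_sqr : sqrt 3 * sqrt 3 = 3.
Proof. apply sqrt_sqrt; lra. Qed.

Lemma sv_vx x : sv (vx x) = y * cbrt x / g ^ 2.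
Proof.
  unfold sv, vx. assert (h : 0 < y * cbrt x / g ^ 2).
  { apply Rdiv_lt_0_compat; [apply Rmult_lt_0_compat; auto using cbrt_pos|apply pow_lt; auto]. }
  rewrite pow2_sqrt by lra. field. lra.
Qed.

Lemma xv_vx x : 0 < x -> xv (vx x) = x.
Proof.
  intros Hx. unfold xv. rewrite sv_vx. replace (g ^ 2 / y * (y * cbrt x / g ^ 2)) with (cbrt x) by (field; lra).
  now apply cbrt_cube.
Qed.

(** With [t = sv v], the phase minus its stationary value is [(g^6 / y^2) (t - 1)^2 (t + 1/2)]. The
    choice of [sv] makes [t + 1/2 = 3 v^2 / 2], so the whole is a perfect square in [v]. *)
Lemma F_xv v : 0 < sv v -> F (xv v) = cos (PI * wv v ^ 2 + psi).
Proof.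
  intros Hs. unfold F, xv. rewrite cube_cbrt.
  2:{ apply Rmult_lt_0_compat; auto. apply Rdiv_lt_0_compat; auto. apply pow_lt; auto. }
  f_equal. unfold wv, psi.
  replace ((3 * sqrt 3 / 2 * (g ^ 3 / y) * (v ^ 3 - v)) ^ 2) with (9 * (sqrt 3 * sqrt 3) / 4 * (g ^ 3 / y) ^ 2 * (v ^ 3 - v) ^ 2) by (field; lra).
  rewrite sqrt3_sqr. unfold sv. field. lra.
Qed.

(** [dx / dw] is its value at the stationary point plus [wv * qv]. The correction carries a factor
    [wv], which against [cos (PI * w^2 + psi)] is an exact derivative. *)
Lemma xv_derive v : 0 < v -> is_derive xv v (dwv v * (sqrt 3 * g ^ 3 / y ^ 2 + wv v * qv v)).
Proof.
  intros Hv.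
  replace (dwv v * (sqrt 3 * g ^ 3 / y ^ 2 + wv v * qv v)) with
    (sqrt 3 * sqrt 3 * (3 * (g ^ 3 / y) * sv v * (g ^ 3 / y ^ 2 + 3 / 2 * (g ^ 3 / y) * (v ^ 3 - v) * qv v)))
    by (unfold dwv, wv; field; lra).
  rewrite sqrt3_sqr. unfold xv, qv, sv. auto_derive; [auto|]. field. lra.
Qed.

Lemma wv_derive v : is_derive wv v (dwv v).
Proof. unfold wv, dwv, sv. auto_derive; [auto|]. field. lra. Qed.

Lemma qv_derive v : 0 < v -> is_derive qv v (- (2 * (2 * v + 1) / (3 * y * (v * (v + 1)) ^ 2))).
Proof.
  intros Hv. assert (0 < v * (v + 1)) by nra. unfold qv. auto_derive; [lra|]. field. lra.
Qed.

Lemma dwv_cont v : continuous dwv v.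
Proof. apply ex_derive_cont. unfold dwv, sv. auto_derive. auto. Qed.

Lemma wv_cont v : continuous wv v.
Proof. apply (is_derive_cont _ _ _ (wv_derive v)). Qed.

Lemma F_cont x : 0 < x -> continuous F x.
Proof.
  intros Hx.
  apply (is_derive_cont _ x (- (2 * PI * (y - 3 / 2 * g ^ 2 * (2 * cbrt x * / (3 * cbrt x ^ 2)))) * sin (2 * PI * (y * x - 3 / 2 * g ^ 2 * cbrt x ^ 2) + phi))).
  apply (is_derive_cos_comp (fun x => 2 * PI * (y * x - 3 / 2 * g ^ 2 * cbrt x ^ 2) + phi)).
  assert (h := cbrt_derive x Hx).
  auto_derive; [exists (/ (3 * cbrt x ^ 2)); exact h|].
  rewrite (is_derive_unique (fun x : R => cbrt x) x _ h). ring.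
Qed.

(** Positivity of [sv] already forces [v^2 > 1/3]; the rounder bound is what keeps [qv] below
    [2 / y]. *)
Lemma vx_lower x : / 2 < vx x.
Proof.
  assert (h : 0 < y * cbrt x / g ^ 2).
  { apply Rdiv_lt_0_compat; [apply Rmult_lt_0_compat; auto using cbrt_pos|apply pow_lt; auto]. }
  replace (/ 2) with (sqrt (/ 4)).
  - apply sqrt_lt_1; lra.
  - replace (/ 4) with (/ 2 * / 2) by field. apply sqrt_square; lra.
Qed.

Lemma vx_le u x : 0 < u <= x -> vx u <= vx x.
Proof.
  intros Hux. assert (hu := cbrt_pos u).  assert (hl := cbrt_le u x Hux).
  assert (hg : 0 < / g ^ 2) by (apply Rinv_pos, pow_lt; auto).
  assert (0 < y * cbrt u / g ^ 2) by (unfold Rdiv; repeat apply Rmult_lt_0_compat; auto).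
  assert (y * cbrt u / g ^ 2 <= y * cbrt x / g ^ 2).
  { apply Rmult_le_compat_r; [lra|]. apply Rmult_le_compat_l; lra. }
  apply sqrt_le_1; lra.
Qed.

Lemma sv_pos_between a b v : 0 < a <= b -> vx a <= v <= vx b -> 0 < sv v.
Proof.
  intros Hab Hv. assert (h1 := vx_lower a).
  apply Rlt_le_trans with (sv (vx a)).
  - rewrite sv_vx. apply Rdiv_lt_0_compat; [apply Rmult_lt_0_compat; auto using cbrt_pos|apply pow_lt; auto].
  - unfold sv. nra.
Qed.

Lemma wv_le a b : 0 < a <= b -> wv (vx a) <= wv (vx b).
Proof.
  intros Hab. assert (Hle := vx_le a b Hab).
  assert (I : is_RInt dwv (vx a) (vx b) (wv (vx b) - wv (vx a))).
  { apply is_RInt_derive_le; auto; intros; [apply wv_derive|apply dwv_cont]. }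
  assert (0 <= wv (vx b) - wv (vx a)); [|lra].
  refine (is_RInt_ge_0 dwv _ _ _ Hle I _). intros v Hv.
  assert (0 < sv v) by (apply (sv_pos_between a b); lra).
  assert (0 < sqrt 3) by (apply sqrt_lt_R0; lra).
  assert (0 < g ^ 3 / y) by (apply Rdiv_lt_0_compat; auto; apply pow_lt; auto).
  left. apply Rmult_lt_0_compat; auto. apply Rmult_lt_0_compat; lra.
Qed.

(** The correction in [xv_derive] leaves [qv] times the derivative of
    [sin (PI * wv^2 + psi) / (2 PI)], and [qv] is monotone and at most [2 / y]. *)
Lemma stationary_split a b : 0 < a <= b ->
  Rabs (RInt F a b - sqrt 3 * g ^ 3 / y ^ 2 * RInt (fun w => cos (PI * w ^ 2 + psi)) (wv (vx a)) (wv (vx b))) <= 2 / y.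
Proof.
  intros Hab. assert (Hle := vx_le a b Hab). assert (h1 := vx_lower a).
  assert (hp : 3 <= PI) by (generalize PI2_3_2; lra).
  set (va := vx a) in *. set (vb := vx b) in *.
  set (kap := sqrt 3 * g ^ 3 / y ^ 2).
  set (E := fun v => cos (PI * wv v ^ 2 + psi)).
  assert (HE : forall v, continuous E v).
  { intros v. apply (continuous_comp wv (fun w => cos (PI * w ^ 2 + psi))).
    - apply wv_cont.
    - apply fresnel_integrand_cont. }
  assert (I1 : is_RInt (fun v => dwv v * (kap + wv v * qv v) * E v) va vb (RInt F a b)).
  { rewrite <- (xv_vx a), <- (xv_vx b) by lra. fold va vb.
    apply (is_RInt_ext_le (fun v => dwv v * (kap + wv v * qv v) * F (xv v))); auto.
    - intros v Hv. rewrite F_xv; [reflexivity|]. apply (sv_pos_between a b); auto. fold va vb; lra.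
    - apply (is_RInt_comp F xv (fun v => dwv v * (kap + wv v * qv v)));
      rewrite Rmin_left, Rmax_right by auto; intros v Hv.
      + apply F_cont. apply pow_lt, Rmult_lt_0_compat.
        * apply Rdiv_lt_0_compat; auto. apply pow_lt; auto.
        * apply (sv_pos_between a b); auto.
      + split; [apply xv_derive; lra|].
        apply (continuous_mult dwv (fun v => kap + wv v * qv v)); [apply dwv_cont|].
        apply (continuous_plus (fun _ => kap) (fun v => wv v * qv v)); [apply continuous_const|].
        apply (continuous_mult wv qv); [apply wv_cont|]. apply (is_derive_cont _ _ _ (qv_derive v ltac:(lra))). }
  assert (I2 : is_RInt (fun v => dwv v * E v) va vb (RInt (fun w => cos (PI * w ^ 2 + psi)) (wv va) (wv vb))).
  { apply (is_RInt_comp (fun w => cos (PI * w ^ 2 + psi)) wv dwv).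
    - intros; apply fresnel_integrand_cont.
    - intros; split; [apply wv_derive|apply dwv_cont]. }
  apply (is_RInt_scal _ _ _ kap) in I2.
  assert (I3 := is_RInt_minus _ _ _ _ _ _ I1 I2).
  assert (I4 : is_RInt (fun v => qv v * (wv v * dwv v * E v)) va vb
     (RInt F a b - kap * RInt (fun w => cos (PI * w ^ 2 + psi)) (wv va) (wv vb))).
  { refine (is_RInt_ext_all _ _ _ _ _ _ I3). intros v.
    unfold minus, plus, opp, scal; simpl; unfold mult; simpl. ring. }
  rewrite <- (is_RInt_unique _ _ _ _ I4).
  eapply Rle_trans.
  - apply (RInt_monotone_parts qv (fun v => - (2 * (2 * v + 1) / (3 * y * (v * (v + 1)) ^ 2)))
      (fun v => / (2 * PI) * sin (PI * wv v ^ 2 + psi)) (fun v => wv v * dwv v * E v) va vb (/ (2 * PI))); auto.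
    + intros v Hv. apply qv_derive; lra.
    + intros v Hv.
      replace (wv v * dwv v * E v) with (/ (2 * PI) * (2 * PI * wv v * dwv v * cos (PI * wv v ^ 2 + psi))) by (unfold E; field; lra).
      apply (is_derive_scal (fun v => sin (PI * wv v ^ 2 + psi))).
      apply (is_derive_sin_comp (fun v => PI * wv v ^ 2 + psi)).
      assert (hw := wv_derive v).
      auto_derive; [exists (dwv v); exact hw|]. rewrite (is_derive_unique (fun x : R => wv x) v _ hw). ring.
    + intros v Hv. apply ex_derive_cont. auto_derive.
      repeat apply Rmult_integral_contrapositive_currified; try lra.
    + intros v Hv. apply (continuous_mult (fun v => wv v * dwv v) E); auto.
      apply (continuous_mult wv dwv); [apply wv_cont|apply dwv_cont].
    + intros v Hv. rewrite Rabs_mult, Rabs_right by (left; apply Rinv_pos; lra).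
      rewrite <- (Rmult_1_r (/ (2 * PI))) at 2. apply Rmult_le_compat_l; [left; apply Rinv_pos; lra|].
      apply Rabs_le, SIN_bound.
    + right. intros v Hv. assert (0 < v * (v + 1)) by nra.
      assert (0 <= 2 * (2 * v + 1) / (3 * y * (v * (v + 1)) ^ 2)); [|lra].
      left. apply Rdiv_lt_0_compat; [lra|]. apply Rmult_lt_0_compat; [lra|]. apply pow_lt; auto.
  - assert (Hq : forall v, / 2 <= v -> Rabs (qv v) <= 2 / y).
    { intros v Hv. assert (hv : 3 / 4 <= v * (v + 1)) by nra.
      assert (h2 : 0 < 2 / (v * (v + 1)) <= 3).
      { split; [apply Rdiv_lt_0_compat; lra|]. apply Rmult_le_reg_r with (v * (v + 1)); [lra|].
        unfold Rdiv; rewrite Rmult_assoc, Rinv_l by lra. lra. }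
      assert (0 < / y) by now apply Rinv_pos.
      unfold qv. rewrite Rinv_mult. rewrite Rabs_right; [unfold Rdiv in *; nra|].
      apply Rle_ge. left. apply Rmult_lt_0_compat; nra. }
    assert (Q1 := Hq va ltac:(lra)). assert (Q2 := Hq vb ltac:(lra)).
    assert (hi : 0 < / (2 * PI) <= / 6).
    { split; [apply Rinv_pos; lra|]. apply Rinv_le_contravar; lra. }
    assert (0 < 2 / y) by (apply Rdiv_lt_0_compat; lra).
      nra.
Qed.

(** Translates the Fresnel error at an endpoint, measured in [wv], into the distance between [y] and
    the frequency [g^2 / cbrt x] at that endpoint, which is what the spacing argument can sum. *)
Lemma endpoint_gap x : 0 < x ->
  sqrt 3 * g ^ 3 / y ^ 2 * / (1 + Rabs (wv (vx x))) <=
   4 / y + 4 / (/ (sqrt 3 * g ^ 3 / y ^ 2) + Rabs (g ^ 2 / cbrt x - y)).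
Proof.
  intros Hx. set (kap := sqrt 3 * g ^ 3 / y ^ 2). set (v := vx x). set (s := y * cbrt x / g ^ 2).
  assert (hr : 0 < sqrt 3) by (apply sqrt_lt_R0; lra).
  assert (hc := cbrt_pos x). assert (hg3 : 0 < g ^ 3) by now apply pow_lt.
  assert (hk : 0 < kap) by (apply Rdiv_lt_0_compat; [nra|now apply pow_lt]).
  assert (hs : 0 < s) by (apply Rdiv_lt_0_compat; nra).
  assert (hsv : sv v = s) by apply sv_vx.
  assert (hv : / 2 < v) by apply vx_lower.
  set (rho := / kap). assert (hrho : 0 < rho) by now apply Rinv_pos.
  assert (Ew : rho * Rabs (wv v) = 3 / 2 * y * (v * (v + 1)) * Rabs (v - 1)).
  { unfold wv. replace (3 * sqrt 3 / 2 * (g ^ 3 / y) * (v ^ 3 - v)) with (3 * sqrt 3 / 2 * (g ^ 3 / y) * (v * (v + 1)) * (v - 1)) by ring.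
    rewrite Rabs_mult, (Rabs_right (3 * sqrt 3 / 2 * (g ^ 3 / y) * (v * (v + 1)))).
    - unfold rho, kap. field. lra.
    - apply Rle_ge, Rmult_le_pos; [|nra]. apply Rmult_le_pos; [nra|]. left; apply Rdiv_lt_0_compat; auto. }
  assert (Eu : Rabs (g ^ 2 / cbrt x - y) = y / s * Rabs (1 - s)).
  { rewrite <- (Rabs_right (y / s)) by (left; apply Rdiv_lt_0_compat; auto).
    rewrite <- Rabs_mult. f_equal. unfold s. field. repeat split; lra. }
  assert (Es : Rabs (1 - s) = 3 / 2 * ((v + 1) * Rabs (v - 1))).
  { rewrite <- hsv. unfold sv. replace (1 - (3 * v ^ 2 - 1) / 2) with (- (3 / 2 * ((v + 1) * (v - 1)))) by field.
    rewrite Rabs_Ropp, !Rabs_mult, (Rabs_right (3 / 2)), (Rabs_right (v + 1)) by lra. ring. }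
  assert (Eq : kap * / (1 + Rabs (wv v)) = / (rho + rho * Rabs (wv v))).
  { unfold rho. field. split; [lra|]. generalize (Rabs_pos (wv v)); lra. }
  rewrite Eq. set (dlt := Rabs (g ^ 2 / cbrt x - y)) in *.
  assert (Hd : 0 <= dlt) by apply Rabs_pos. assert (Pv := Rabs_pos (v - 1)).
  assert (P1 : 0 < 4 / y) by (apply Rdiv_lt_0_compat; lra).
  assert (P2 : 0 < 4 / (rho + dlt)) by (apply Rdiv_lt_0_compat; lra).
  (* [s] is [y] divided by the frequency at [x]. For [s >= 1/2] the gap is at most four times
     [rho * |wv v|]; for smaller [s] the point is far from stationary and [rho * |wv v|] is at least
     [y / 4]. *)
  destruct (Rle_dec (/ 2) s) as [h|h].
  - assert (Hge : dlt / 4 <= rho * Rabs (wv v)).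
    { rewrite Ew, Eu, Es.
      assert (hsi : / s <= 2) by (rewrite <- (Rinv_inv 2); apply Rinv_le_contravar; lra).
      set (m := (v + 1) * Rabs (v - 1)). assert (hm : 0 <= m) by (apply Rmult_le_pos; lra).
      replace (3 / 2 * y * (v * (v + 1)) * Rabs (v - 1)) with (3 / 2 * (y * m) * v) by (unfold m; ring).
      replace (y / s * (3 / 2 * m) / 4) with (3 / 2 * (y * m) * (/ s / 4)) by (field; lra).
      apply Rmult_le_compat_l; [|lra]. assert (0 <= y * m) by (apply Rmult_le_pos; lra). lra. }
    apply Rle_trans with (4 / (rho + dlt)); [|lra].
    replace (4 / (rho + dlt)) with (/ ((rho + dlt) / 4)) by (field; lra).
    apply Rinv_le_contravar; lra.
  - assert (Hge : y / 4 <= rho * Rabs (wv v)).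
    { rewrite Ew. rewrite <- hsv in h. unfold sv in h. rewrite Rabs_left by nra.
      replace (3 / 2 * y * (v * (v + 1)) * - (v - 1)) with (y * (3 / 2 * (v * (1 - v * v)))) by ring.
      apply Rmult_le_compat_l; nra. }
    apply Rle_trans with (4 / y); [|lra].
    replace (4 / y) with (/ (y / 4)) by (field; lra). apply Rinv_le_contravar; lra.
Qed.

(** [66 = 2 + 2 * 8 * 4] and [32 = 8 * 4]: the 2 is from [stationary_split], each 8 from the Fresnel
    error and each 4 from [endpoint_gap]. *)
Lemma stationary_phase a b : 0 < a <= b ->
  Rabs (RInt F a b - cut (g ^ 2 / cbrt b) (g ^ 2 / cbrt a) y * (sqrt 3 * g ^ 3 / y ^ 2 * cos (psi + PI / 4))) <=
  66 / y + 32 / (/ (sqrt 3 * g ^ 3 / y ^ 2) + Rabs (g ^ 2 / cbrt a - y))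
         + 32 / (/ (sqrt 3 * g ^ 3 / y ^ 2) + Rabs (g ^ 2 / cbrt b - y)).
Proof.
  intros Hab.  assert (hw := wv_le a b Hab).
  assert (H1 := stationary_split a b Hab).
  assert (H2 := fresnel_between_value psi _ _ hw).
  assert (Ha := endpoint_gap a ltac:(lra)). assert (Hb := endpoint_gap b ltac:(lra)).
  set (kap := sqrt 3 * g ^ 3 / y ^ 2) in *.
  assert (hg3 : 0 < g ^ 3) by now apply pow_lt. assert (hg2 : 0 < g ^ 2) by now apply pow_lt.
  assert (hr : 0 < sqrt 3) by (apply sqrt_lt_R0; lra).
  assert (hk : 0 < kap) by (apply Rdiv_lt_0_compat; [nra|now apply pow_lt]).
  (* [wv (vx x)] has the sign of [y - g^2 / cbrt x], so the stationary point lies in the interval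
     exactly when [y] lies between the endpoint frequencies. *)
  assert (Hsgn : forall x, 0 < x -> (wv (vx x) <= 0 <-> y <= g ^ 2 / cbrt x) /\ (0 <= wv (vx x) <-> g ^ 2 / cbrt x <= y)).
  { intros x Hx. assert (hc := cbrt_pos x). assert (hv := vx_lower x). assert (hs := sv_vx x). unfold sv in hs.
    assert (hA : 0 < 3 * sqrt 3 / 2 * (g ^ 3 / y)).
    { apply Rmult_lt_0_compat; [lra|]. now apply Rdiv_lt_0_compat. }
    assert (Ew : wv (vx x) = 3 * sqrt 3 / 2 * (g ^ 3 / y) * (vx x * (vx x ^ 2 - 1))) by (unfold wv; ring).
    set (A := 3 * sqrt 3 / 2 * (g ^ 3 / y)) in *. rewrite Ew.
    assert (Eu : g ^ 2 / cbrt x - y = - (g ^ 2 / cbrt x) * (3 / 2 * (vx x ^ 2 - 1))).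
    { replace (3 / 2 * (vx x ^ 2 - 1)) with ((3 * vx x ^ 2 - 1) / 2 - 1) by field. rewrite hs. field. lra. }
    assert (hu : 0 < g ^ 2 / cbrt x) by now apply Rdiv_lt_0_compat.
    set (u := g ^ 2 / cbrt x) in *. set (m := vx x ^ 2 - 1) in *.
    assert (hAv : 0 < A * vx x) by nra.
    rewrite <- Rmult_assoc. split; split; intros; nra. }
  destruct (Hsgn a ltac:(lra)) as [Sa _]. destruct (Hsgn b ltac:(lra)) as [_ Sb].
  rewrite (cut_iff _ _ y (wv (vx a)) (wv (vx b)) 0) by tauto.
  set (c := cut _ _ 0) in *. set (J := RInt (fun w => cos (PI * w ^ 2 + psi)) _ _) in *.
  replace (RInt F a b - c * (kap * cos (psi + PI / 4))) with ((RInt F a b - kap * J) + kap * (J - c * cos (psi + PI / 4))) by ring.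
  eapply Rle_trans; [apply Rabs_triang|]. rewrite (Rabs_mult kap), (Rabs_right kap) by lra.
  assert (H3 : kap * Rabs (J - c * cos (psi + PI / 4)) <= kap * (8 / (1 + Rabs (wv (vx a))) + 8 / (1 + Rabs (wv (vx b))))).
  { apply Rmult_le_compat_l; lra. }
  lra.
Qed.

End Stationary.

(** [truncated_poisson] asks for a positive derivative, so it is applied to the opposite phase with
    shift [- phi], the cosine being even. The term [4 cbrt b / g^2] is the zero frequency, bounded
    by the first derivative test. *)
Lemma power_b_process g a b phi K n0 :
  0 < g -> 0 < a <= b -> b <= INR K -> (1 <= n0)%nat -> g ^ 2 / cbrt a <= INR n0 ->
  Rabs (rsum K (fun m => cut a b (INR m) * cos (phi - 3 * PI * g ^ 2 * cbrt (INR m) ^ 2))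
      - rsum n0 (fun k => cut (g ^ 2 / cbrt b) (g ^ 2 / cbrt a) (INR k) *
           (sqrt 3 * g ^ 3 / INR k ^ 2 * cos (phi + PI / 4 - PI * (g ^ 3) ^ 2 / INR k ^ 2))))
  <= 100 * harm n0 + 4 * cbrt b / g ^ 2
     + 32 * rsum n0 (fun k => / (INR k ^ 2 / (sqrt 3 * g ^ 3) + Rabs (g ^ 2 / cbrt a - INR k)))
     + 32 * rsum n0 (fun k => / (INR k ^ 2 / (sqrt 3 * g ^ 3) + Rabs (g ^ 2 / cbrt b - INR k))).
Proof.
  intros Hg Hab HK Hn0 Hga.
   assert (hg2 : 0 < g ^ 2) by now apply pow_lt.
  assert (hr : 0 < sqrt 3) by (apply sqrt_lt_R0; lra).
  assert (hp : 3 <= PI) by (generalize PI2_3_2; lra).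
  assert (Hh := harm_ge1 n0 Hn0).
  set (f := fun x => 3 / 2 * g ^ 2 * cbrt x ^ 2).
  assert (Hdf : forall x, a <= x <= b -> is_derive f x (g ^ 2 / cbrt x)).
  { intros x Hx. unfold f. assert (h := cbrt_derive x ltac:(lra)). assert (hc := cbrt_pos x).
    auto_derive; [eexists; exact h|]. rewrite (is_derive_unique (fun x : R => cbrt x) x _ h). field. lra. }
  assert (Hddf : forall x, a <= x <= b -> is_derive (fun x => g ^ 2 / cbrt x) x (- (g ^ 2 / (3 * cbrt x ^ 4)))).
  { intros x Hx. assert (h := cbrt_derive x ltac:(lra)). assert (hc := cbrt_pos x).
    auto_derive; [split; [eexists; exact h|split; [lra|auto]]|]. rewrite (is_derive_unique (fun x : R => cbrt x) x _ h). field. lra. }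
  assert (Cddf : forall x, a <= x <= b -> continuous (fun x => - (g ^ 2 / (3 * cbrt x ^ 4))) x).
  { intros x Hx. assert (h := cbrt_derive x ltac:(lra)). assert (hc := cbrt_pos x).
    apply ex_derive_cont.
    auto_derive. split; [eexists; exact h|split; [|auto]].
    apply Rmult_integral_contrapositive_currified; [lra|].
    change (cbrt x ^ 4 <> 0). apply pow_nonzero. lra. }
  assert (Sddf : forall x, a <= x <= b -> - (g ^ 2 / (3 * cbrt x ^ 4)) <= 0).
  { intros x Hx. assert (hc := cbrt_pos x).
    assert (0 < g ^ 2 / (3 * cbrt x ^ 4)); [|lra]. apply Rdiv_lt_0_compat; auto.
    assert (0 < cbrt x ^ 4) by now apply pow_lt. lra. }
  assert (HP := truncated_poisson f (fun x => g ^ 2 / cbrt x) (fun x => - (g ^ 2 / (3 * cbrt x ^ 4))) a b (- phi) n0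
    ltac:(lra) ltac:(lra) Hdf Hddf Cddf (or_intror Sddf) Hn0).
  assert (HP' := fun H => HP H K HK).
  specialize (HP' ltac:(intros x Hx; assert (hc := cbrt_pos x); split; [now apply Rdiv_lt_0_compat|];
    apply Rle_trans with (2 := Hga); unfold Rdiv; apply Rmult_le_compat_l; [lra|];
    apply Rinv_le_contravar; [apply cbrt_pos|apply cbrt_le; lra])).
  clear HP.
  assert (Hneg : forall x z, cos (2 * PI * (f x - z * x) + - phi) = cos (2 * PI * (z * x - 3 / 2 * g ^ 2 * cbrt x ^ 2) + phi)).
  { intros x z. rewrite <- cos_neg. f_equal. unfold f. ring. }
  rewrite (rsum_ext K _ (fun k => cut a b (INR k) * cos (2 * PI * f (INR k) + - phi))).
  2:{ intros k _. rewrite <- (cos_neg (phi - _)). f_equal. f_equal. unfold f. field. }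
  assert (H0 : Rabs (RInt (fun x => cos (2 * PI * f x + - phi)) a b) <= 4 * cbrt b / g ^ 2).
  { assert (hcb := cbrt_pos b).
    replace (4 * cbrt b / g ^ 2) with (4 / (g ^ 2 / cbrt b)) by (field; lra).
    assert (hm : 0 < g ^ 2 / cbrt b) by now apply Rdiv_lt_0_compat.
    apply (first_derivative_test (fun x => 2 * PI * f x + - phi) (fun x => 2 * PI * (g ^ 2 / cbrt x))
      (fun x => 2 * PI * - (g ^ 2 / (3 * cbrt x ^ 4)))); auto; try lra.
    - intros x Hx. assert (h := Hdf x Hx). auto_derive; [eexists; exact h|].
      rewrite (is_derive_unique (fun x : R => f x) x _ h). ring.
    - intros x Hx. apply (is_derive_scal (fun x => g ^ 2 / cbrt x)). now apply Hddf.
    - intros x Hx. apply (continuous_mult (fun _ => 2 * PI) (fun x => - (g ^ 2 / (3 * cbrt x ^ 4)))); [apply continuous_const|auto].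
    - right. intros x Hx. specialize (Sddf x Hx). nra.
    - intros x Hx. assert (hcx := cbrt_pos x). assert (hle := cbrt_le x b ltac:(lra)).
      assert (hmx : g ^ 2 / cbrt b <= g ^ 2 / cbrt x).
      { apply Rmult_le_compat_l; [lra|]. apply Rinv_le_contravar; lra. }
      nra. }
  assert (HM : Rabs (rsum n0 (fun k => RInt (fun x => cos (2 * PI * (f x - INR k * x) + - phi)) a b)
     - rsum n0 (fun k => cut (g ^ 2 / cbrt b) (g ^ 2 / cbrt a) (INR k) *
           (sqrt 3 * g ^ 3 / INR k ^ 2 * cos (phi + PI / 4 - PI * (g ^ 3) ^ 2 / INR k ^ 2))))
     <= 66 * harm n0
     + 32 * rsum n0 (fun k => / (INR k ^ 2 / (sqrt 3 * g ^ 3) + Rabs (g ^ 2 / cbrt a - INR k)))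
     + 32 * rsum n0 (fun k => / (INR k ^ 2 / (sqrt 3 * g ^ 3) + Rabs (g ^ 2 / cbrt b - INR k)))).
  { unfold harm. rewrite <- !rsum_scal, <- !rsum_plus. apply rsum_dist_le. intros k Hk.
    assert (hk : 0 < INR k) by (apply lt_0_INR; lia).
    assert (Hs := stationary_phase g (INR k) phi Hg hk a b Hab).
    replace (/ (sqrt 3 * g ^ 3 / INR k ^ 2)) with (INR k ^ 2 / (sqrt 3 * g ^ 3)) in Hs by (field; repeat split; lra).
    replace (RInt (fun x => cos (2 * PI * (f x - INR k * x) + - phi)) a b) with
      (RInt (fun x => cos (2 * PI * (INR k * x - 3 / 2 * g ^ 2 * cbrt x ^ 2) + phi)) a b)
      by (apply RInt_ext; intros; now rewrite Hneg).
    replace (phi + PI / 4 - PI * (g ^ 3) ^ 2 / INR k ^ 2) with (phi - PI * (g ^ 3) ^ 2 / INR k ^ 2 + PI / 4) by ring.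
    exact Hs. }
  apply Rabs_le_between in HP'. apply Rabs_le_between in H0. apply Rabs_le_between in HM.
  apply Rabs_le. lra.
Qed.

(** * Partial summation and divisor sums *)

(** As a function of its upper limit, [cut a x p] is the step at [p]; this is partial summation for
    a single term. *)
Lemma cut_RInt (g dg : R -> R) a b p :
  a <= b -> (forall x, a <= x <= b -> is_derive g x (dg x)) ->
  (forall x, a <= x <= b -> continuous dg x) ->
  is_RInt (fun x => dg x * cut a x p) a b (cut a b p * (g b - g p)).
Proof.
  intros Hab Hg Cg.
  assert (Hz : forall u v, is_RInt (fun _ => 0) u v 0).
  { intros u v. evar_last; [apply is_RInt_cst|ring]. }
  destruct (cut_cases a b p) as [[h ->]|[h ->]].
  - replace (1 * (g b - g p)) with (0 + (g b - g p)) by ring.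
    apply (is_RInt_Chasles (V := R_NormedModule)) with p.
    + apply (is_RInt_ext_le (fun _ => 0)); [lra| |apply Hz].
      intros x Hx. rewrite cut_out by lra. ring.
    + apply (is_RInt_ext_le dg); [lra| |].
      * intros x Hx. rewrite cut_in by lra. ring.
      * apply is_RInt_derive_le; [lra| |]; intros x Hx; [apply Hg|apply Cg]; lra.
  - rewrite Rmult_0_l. apply (is_RInt_ext_le (fun _ => 0)); auto.
    intros x Hx. rewrite cut_out; [ring|]. lra.
Qed.

Lemma abel_RInt (g dg : R -> R) a b K (p w : nat -> R) :
  a <= b -> (forall x, a <= x <= b -> is_derive g x (dg x)) ->
  (forall x, a <= x <= b -> continuous dg x) ->
  is_RInt (fun x => dg x * rsum K (fun k => cut a x (p k) * w k)) a b
    (g b * rsum K (fun k => cut a b (p k) * w k) - rsum K (fun k => cut a b (p k) * (g (p k) * w k))).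
Proof.
  intros Hab Hg Cg. induction K as [|K IH]; cbn [rsum].
  - apply (is_RInt_ext_le (fun _ => 0)); auto; [intros; ring|].
    evar_last; [apply is_RInt_cst|ring].
  - assert (I := cut_RInt g dg a b (p (S K)) Hab Hg Cg).
    apply (is_RInt_scal _ _ _ (w (S K))) in I.
    assert (I2 := is_RInt_plus _ _ _ _ _ _ IH I).
    match type of I2 with is_RInt _ _ _ ?l =>
      match goal with |- is_RInt _ _ _ ?l' => replace l' with l end end.
    + refine (is_RInt_ext_all _ _ _ _ _ _ I2). intros x.
      unfold plus, scal; simpl; unfold mult; simpl. ring.
    + unfold plus, scal; simpl; unfold mult; simpl. ring.
Qed.

(** The difference equals [g b] times the full difference minus the integral of [dg] against the
    truncated differences, all bounded by [E]. The points [p1] and [p2] may differ, which lets one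
    weight act on a sum and on its dual. *)
Lemma abel_compare (g dg : R -> R) a b K1 K2 (p1 w1 p2 w2 : nat -> R) E :
  a <= b -> (forall x, a <= x <= b -> is_derive g x (dg x)) ->
  (forall x, a <= x <= b -> continuous dg x) ->
  (forall x, a <= x <= b -> 0 <= dg x) \/ (forall x, a <= x <= b -> dg x <= 0) ->
  (forall x, a <= x <= b ->
    Rabs (rsum K1 (fun k => cut a x (p1 k) * w1 k) - rsum K2 (fun k => cut a x (p2 k) * w2 k)) <= E) ->
  Rabs (rsum K1 (fun k => cut a b (p1 k) * (g (p1 k) * w1 k)) - rsum K2 (fun k => cut a b (p2 k) * (g (p2 k) * w2 k)))
   <= E * (Rabs (g b) + Rabs (g b - g a)).
Proof.
  intros Hab Hg Cg Hs HE.
  assert (I1 := abel_RInt g dg a b K1 p1 w1 Hab Hg Cg). assert (I2 := abel_RInt g dg a b K2 p2 w2 Hab Hg Cg).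
  assert (HE0 : 0 <= E) by (eapply Rle_trans; [apply Rabs_pos|apply (HE a); lra]).
  set (S1 := rsum K1 (fun k => cut a b (p1 k) * w1 k)) in *. set (S2 := rsum K2 (fun k => cut a b (p2 k) * w2 k)) in *.
  set (W1 := rsum K1 (fun k => cut a b (p1 k) * (g (p1 k) * w1 k))) in *.
  set (W2 := rsum K2 (fun k => cut a b (p2 k) * (g (p2 k) * w2 k))) in *.
  assert (I3 := is_RInt_minus _ _ _ _ _ _ I1 I2).
  assert (HI : Rabs (RInt (fun x => dg x * rsum K1 (fun k => cut a x (p1 k) * w1 k) - dg x * rsum K2 (fun k => cut a x (p2 k) * w2 k)) a b)
     <= E * Rabs (g b - g a)).
  { assert (Hsg : exists sg, (sg = 1 \/ sg = -1) /\ forall x, a <= x <= b -> Rabs (dg x) <= sg * dg x).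
    { destruct Hs as [Hs|Hs]; [exists 1|exists (-1)]; (split; [lra|]); intros x Hx; specialize (Hs x Hx).
      - rewrite Rabs_right; lra.
      - rewrite Rabs_left1; lra. }
    destruct Hsg as (sg & Hsg & Hd).
    apply Rle_trans with (E * (sg * (g b - g a))).
    - apply (RInt_abs_le _ (fun x => E * (sg * dg x))); auto.
      + eexists; exact I3.
      + apply (is_RInt_scal (fun x => sg * dg x)).
        apply (is_RInt_scal dg). now apply is_RInt_derive_le.
      + intros x Hx. rewrite <- Rmult_minus_distr_l, Rabs_mult, Rmult_comm.
        apply Rmult_le_compat; auto using Rabs_pos.
    - apply Rmult_le_compat_l; auto. destruct Hsg as [->| ->].
      + rewrite Rmult_1_l. apply Rle_abs.
      + rewrite <- Rabs_Ropp. replace (-1 * (g b - g a)) with (- (g b - g a)) by ring. apply Rle_abs. }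
  assert (EI : RInt (fun x => dg x * rsum K1 (fun k => cut a x (p1 k) * w1 k) - dg x * rsum K2 (fun k => cut a x (p2 k) * w2 k)) a b
     = (g b * S1 - W1) - (g b * S2 - W2)) by (apply is_RInt_unique; exact I3).
  rewrite EI in HI.
  replace (W1 - W2) with (g b * (S1 - S2) - ((g b * S1 - W1) - (g b * S2 - W2))) by ring.
  assert (Hb : Rabs (g b * (S1 - S2)) <= Rabs (g b) * E).
  { rewrite Rabs_mult. apply Rmult_le_compat_l; [apply Rabs_pos|]. apply HE; lra. }
  eapply Rle_trans; [apply Rabs_triang|]. rewrite Rabs_Ropp. lra.
Qed.

(** * Divisor sums as sums over pairs of factors *)

Definition le_ind (n m : nat) : R := if le_dec n m then 1 else 0.

(** The ranges [n <= m] and [m <= n] cover all pairs and count the diagonal twice. *)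
Lemma symmetric_double_sum K (H : nat -> nat -> R) :
  (forall n m, H n m = H m n) ->
  rsum K (fun n => rsum K (fun m => H n m)) =
  2 * rsum K (fun n => rsum K (fun m => le_ind n m * H n m)) - rsum K (fun n => H n n).
Proof.
  intros Hsym.
  assert (E : rsum K (fun n => rsum K (fun m => le_ind m n * H n m)) = rsum K (fun n => rsum K (fun m => le_ind n m * H n m))).
  { rewrite rsum_swap. apply rsum_ext; intros n _. apply rsum_ext; intros m _. now rewrite Hsym. }
  assert (E2 : rsum K (fun n => rsum K (fun m => H n m)) =
    rsum K (fun n => rsum K (fun m => le_ind n m * H n m)) + rsum K (fun n => rsum K (fun m => le_ind m n * H n m)) - rsum K (fun n => H n n)).
  { rewrite <- rsum_plus, <- rsum_minus. apply rsum_ext; intros n Hn.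
    assert (E3 : rsum K (fun m => (if Nat.eq_dec n m then 1 else 0) * H n m) = H n n).
    { rewrite (rsum_single K n); [destruct (Nat.eq_dec n n); [ring|lia]|lia|].
      intros k h1 h2. destruct Nat.eq_dec; [lia|ring]. }
    rewrite <- E3, <- rsum_plus, <- rsum_minus. apply rsum_ext; intros m Hm.
    unfold le_ind. destruct (le_dec n m), (le_dec m n), (Nat.eq_dec n m); try lia; ring. }
  rewrite E2, E. ring.
Qed.

(** An indicator, like [le_ind]; both names hide the induction principles so called. *)
Definition eq_ind (n m : nat) : R := if Nat.eqb n m then 1 else 0.

Lemma length_filter_seq (f : nat -> bool) k :
  INR (length (filter f (seq 1 k))) = rsum k (fun n => if f n then 1 else 0).
Proof.
  induction k as [|k IH]; [reflexivity|].
  rewrite seq_S, filter_app, length_app, plus_INR, IH. cbn [rsum]. f_equal.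
  simpl. destruct (f (S k)); simpl; ring.
Qed.

Lemma d_as_sum k : INR (d k) = rsum k (fun n => rsum k (fun m => eq_ind (n * m) k)).
Proof.
  unfold d.
  assert (list_prod_app : forall (l1 l2 l : list nat), list_prod (l1 ++ l2) l = list_prod l1 l ++ list_prod l2 l).
  { induction l1 as [|x l1 IH]; intros; simpl; [reflexivity|]. now rewrite IH, app_assoc. }
  assert (H : forall j l, INR (length (filter (fun p => Nat.eqb (fst p * snd p) k) (list_prod (seq 1 j) l)))
     = rsum j (fun n => INR (length (filter (fun m => Nat.eqb (n * m) k) l)))).
  { intros j l. induction j as [|j IH]; [reflexivity|].
    rewrite seq_S, list_prod_app, filter_app, length_app, plus_INR, IH. cbn [rsum]. f_equal.
    simpl list_prod. rewrite app_nil_r. f_equal.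
    clear IH. induction l as [|x l IH]; [reflexivity|].
    cbn [map filter fst snd]. destruct (Nat.eqb (S j * x) k); cbn [length]; rewrite IH; reflexivity. }
  rewrite H. apply rsum_ext; intros n _. now rewrite length_filter_seq.
Qed.

(** Both factors of a positive [k <= K] are at most [k], so the square of side [K] contains every
    factorisation, and pairs with a larger product are killed by [H]. *)
Lemma divisor_double_sum K (H : nat -> R) :
  (forall k, (K < k)%nat -> H k = 0) ->
  rsum K (fun n => rsum K (fun m => H (n * m)%nat)) = rsum K (fun k => INR (d k) * H k).
Proof.
  intros HK.
  transitivity (rsum K (fun k => rsum K (fun n => rsum K (fun m => eq_ind (n * m) k * H k)))).
  - symmetry. rewrite rsum_swap. apply rsum_ext; intros n Hn. rewrite rsum_swap. apply rsum_ext; intros m Hm.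
    unfold eq_ind. destruct (le_lt_dec (n * m) K) as [h|h].
    + rewrite (rsum_single K (n * m)%nat); [rewrite Nat.eqb_refl; ring|split; nia|].
      intros k _ hk. destruct (Nat.eqb_spec (n * m) k); [lia|ring].
    + rewrite HK by auto. apply rsum_zero. intros k Hk.
      destruct (Nat.eqb_spec (n * m) k); [lia|ring].
  - apply rsum_ext; intros k Hk. rewrite d_as_sum.
    rewrite <- rsum_scal_r. rewrite (rsum_widen k K) by (lia || (intros n Hn; apply rsum_zero; intros m Hm;
      unfold eq_ind; destruct (Nat.eqb_spec (n * m) k); [nia|ring])).
    apply rsum_ext; intros n Hn. rewrite <- rsum_scal_r.
    apply rsum_widen; [lia|]. intros m Hm. unfold eq_ind; destruct (Nat.eqb_spec (n * m) k); [nia|ring].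
Qed.

Lemma count_cut K a b : 0 <= b -> rsum K (fun k => cut a b (INR k)) <= b.
Proof.
  intros Hb. assert (H : rsum K (fun k => cut a b (INR k)) <= Rmin b (INR K)).
  { induction K as [|K IH]; [simpl; unfold Rmin; destruct Rle_dec; lra|].
    cbn [rsum]. rewrite S_INR. destruct (cut_cases a b (INR K + 1)) as [[h e]|[h e]];
    (replace (INR (S K)) with (INR K + 1) by now rewrite S_INR); rewrite e.
    - rewrite Rmin_right by lra. generalize (Rmin_r b (INR K)); lra.
    - assert (Rmin b (INR K) <= Rmin b (INR K + 1)); [|lra].
      unfold Rmin; repeat destruct Rle_dec; lra. }
  generalize (Rmin_l b (INR K)); lra.
Qed.

(** For each [i] at most [z / i] values of [j] satisfy [i * j <= z], and the [1 / i] add up to a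
    logarithm. *)
Lemma sum_d_le K z : 1 <= z ->
  rsum K (fun k => cut 0 z (INR k) * INR (d k)) <= z * (1 + ln z).
Proof.
  intros Hz. destruct (nfloor_ex z) as [n Hn]; [lra|].
  assert (E : rsum K (fun k => cut 0 z (INR k) * INR (d k)) <= rsum n (fun k => INR (d k))).
  { destruct (le_lt_dec K n) as [h|h].
    - apply Rle_trans with (rsum K (fun k => INR (d k))).
      + apply rsum_le; intros k _. generalize (cut_bound 0 z (INR k)) (pos_INR (d k)). nra.
      + apply rsum_mono_len; auto. intros; apply pos_INR.
    - rewrite (rsum_widen n K).
      + apply rsum_le; intros k _. generalize (cut_bound 0 z (INR k)) (pos_INR (d k)). nra.
      + lia.
      + intros k Hk. rewrite cut_out; [ring|]. right.
        assert (INR n + 1 <= INR k) by (rewrite <- S_INR; apply le_INR; lia). lra. }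
  apply Rle_trans with (1 := E).
  assert (E2 : rsum n (fun k => INR (d k)) = rsum n (fun i => rsum n (fun j => cut 0 (INR n) (INR (i * j))))).
  { rewrite (divisor_double_sum n (fun k => cut 0 (INR n) (INR k))).
    - apply rsum_ext; intros k Hk. rewrite cut_in; [ring|]. split; [apply pos_INR|apply le_INR; lia].
    - intros k Hk. apply cut_out. right. apply lt_INR; lia. }
  rewrite E2.
  apply Rle_trans with (rsum n (fun i => z * / INR i)).
  - apply rsum_le; intros i Hi. assert (hi : 1 <= INR i) by (apply INR_ge1; lia).
    apply Rle_trans with (rsum n (fun j => cut 0 (z * / INR i) (INR j))).
    + apply rsum_le; intros j Hj.
      destruct (cut_cases 0 (INR n) (INR (i * j))) as [[h ->]|[h ->]]; [|apply cut_bound].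
      rewrite cut_in; [lra|]. split; [apply pos_INR|].
      rewrite mult_INR in h. apply Rmult_le_reg_l with (INR i); [lra|]. field_simplify; lra.
    + apply count_cut. apply Rmult_le_pos; [lra|]. left; apply Rinv_pos; lra.
  - rewrite rsum_scal. apply Rmult_le_compat_l; [lra|]. apply harm_le_ln; lra.
Qed.

(** * The two transformations of the double sum *)

Lemma sqrt3_bounds : 1 < sqrt 3 < 2.
Proof.
  split.
  - rewrite <- sqrt_1 at 1. apply sqrt_lt_1; lra.
  - replace 2 with (sqrt (2 * 2)) by (apply sqrt_square; lra). apply sqrt_lt_1; lra.
Qed.

Section Endpoint_sums.

Variables (p eta : R) (beta : nat -> R) (P Q : nat).
Hypothesis Hp : 0 < p.
Hypothesis Heta : 0 < eta.
Hypothesis Hlow : forall n, (1 <= n <= P)%nat -> eta * INR n <= beta n.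
Hypothesis Hspace : forall i j, (1 <= i)%nat -> (i <= j <= P)%nat -> eta / 3 * (INR j - INR i) <= beta j - beta i.

(** A smooth form of the smaller of the stationary phase amplitude [sqrt 3 p^3 n / k^2] and the
    inverse distance from [k] to the endpoint frequency [beta n]. *)
Let term (n k : nat) := / (INR k ^ 2 / (sqrt 3 * (p ^ 3 * INR n)) + Rabs (beta n - INR k)).

Lemma rho_pos n k : (1 <= n)%nat -> (1 <= k)%nat -> 0 < INR k ^ 2 / (sqrt 3 * (p ^ 3 * INR n)).
Proof.
  intros hn hk. apply INR_ge1 in hn. apply INR_ge1 in hk. assert (h := sqrt3_bounds).
  assert (0 < p ^ 3) by now apply pow_lt.
  apply Rdiv_lt_0_compat; [apply pow_lt; lra|]. apply Rmult_lt_0_compat; [lra|nra].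
Qed.

Lemma term_le_gap n k : (1 <= n)%nat -> (1 <= k)%nat -> INR k <> beta n -> term n k <= / Rabs (beta n - INR k).
Proof.
  intros hn hk hne. assert (h := rho_pos n k hn hk).
  apply Rinv_le_contravar; [apply Rabs_pos_lt; lra|lra].
Qed.

Lemma inv_rho n k : (1 <= n)%nat -> (1 <= k)%nat ->
  term n k <= 2 * p ^ 3 * INR n / INR k ^ 2.
Proof.
  intros hn hk. assert (h := rho_pos n k hn hk). assert (hs := sqrt3_bounds).
  assert (hn' := INR_ge1 n hn). assert (hk' := INR_ge1 k hk). assert (hp3 : 0 < p ^ 3) by now apply pow_lt.
  assert (hk2 : 0 < INR k ^ 2) by (apply pow_lt; lra).
  apply Rle_trans with (/ (INR k ^ 2 / (sqrt 3 * (p ^ 3 * INR n)))).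
  - apply Rinv_le_contravar; auto. generalize (Rabs_pos (beta n - INR k)); lra.
  - replace (/ (INR k ^ 2 / (sqrt 3 * (p ^ 3 * INR n)))) with (sqrt 3 * (p ^ 3 * INR n * / INR k ^ 2)) by (field; repeat split; lra).
    replace (2 * p ^ 3 * INR n / INR k ^ 2) with (2 * (p ^ 3 * INR n * / INR k ^ 2)) by (field; lra).
    apply Rmult_le_compat_r; [|lra]. apply Rmult_le_pos; [nra|]. left; now apply Rinv_pos.
Qed.

(** For fixed [k] the values [beta n] are spaced by [eta / 3], so only the two nearest to [k] can be
    large and the rest form a harmonic sum. Summing over [n] first uses this spacing in place of a
    bound for each endpoint separately. *)
Lemma endpoint_sum : eta / 2 <= INR Q ->
  rsum P (fun n => rsum Q (fun k => term n k)) <=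
  8 * p ^ 3 / eta * (1 + ln (2 * (INR Q / eta))) + INR Q * (4 / eta + 6 / eta * harm P).
Proof.
  intros HQ. assert (hp3 : 0 < p ^ 3) by now apply pow_lt.
  assert (hi : 0 < / eta) by now apply Rinv_pos.
  rewrite rsum_swap.
  (* For [k < eta / 2] every [beta n >= eta] exceeds [2 k], so the large term occurs only from
     [eta / 2] on and the logarithm is that of [2 Q / eta]. *)
  apply Rle_trans with (rsum Q (fun k => 8 * p ^ 3 / eta * (cut (eta / 2) (INR Q) (INR k) * / INR k) + (4 / eta + 6 / eta * harm P))).
  2:{ rewrite rsum_plus, rsum_scal, rsum_const. apply Rplus_le_compat_r, Rmult_le_compat_l; [unfold Rdiv; nra|].
      replace (2 * (INR Q / eta)) with (INR Q / (eta / 2)) by (field; lra). apply sum_inv_cut_le; lra. }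
  apply rsum_le. intros k Hk. assert (hk : 1 <= INR k) by (apply INR_ge1; lia).
  assert (hkQ : INR k <= INR Q) by (apply le_INR; lia).
  assert (hki : 0 < / INR k) by (apply Rinv_pos; lra).
  set (c := cut (eta / 2) (INR Q) (INR k)). assert (hc : 0 <= c <= 1) by apply cut_bound.
  assert (T1 : 0 < p ^ 3 * / eta * / INR k) by (repeat apply Rmult_lt_0_compat; lra).
  apply Rle_trans with (2 * (c * (4 * p ^ 3 / eta * / INR k) + 2 / eta) + 2 / (eta / 3) * harm P).
  2:{ right. field. lra. }
  assert (T0 : 0 <= c * (4 * p ^ 3 / eta * / INR k)) by (apply Rmult_le_pos; unfold Rdiv; lra).
  apply (spaced_sum P beta (fun n => term n k) (INR k) (eta / 3)); auto; try lra.
  - intros n Hn. assert (hn : 1 <= INR n) by (apply INR_ge1; lia).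
    assert (hl := Hlow n Hn).
    (* If [beta n <= 2 k] then [n <= 2 k / eta], which bounds the amplitude; otherwise the distance
       to [k] is at least [eta / 2]. *)
    destruct (Rle_dec (beta n) (2 * INR k)) as [h|h].
    + assert (he : eta * 1 <= eta * INR n) by (apply Rmult_le_compat_l; lra).
      unfold c. rewrite cut_in by lra. rewrite Rmult_1_l.
      apply Rle_trans with (4 * p ^ 3 / eta * / INR k); [|unfold Rdiv; lra].
      eapply Rle_trans; [apply inv_rho; lia|].
      assert (hnk : INR n <= 2 * INR k * / eta) by (apply le_div_iff; lra).
      replace (4 * p ^ 3 / eta * / INR k) with (2 * p ^ 3 * (2 * INR k * / eta) / INR k ^ 2) by (field; lra).
      apply Rmult_le_compat_r; [left; apply Rinv_pos, pow_lt; lra|].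
      apply Rmult_le_compat_l; lra.
    + apply Rle_trans with (2 / eta); [|lra].
      eapply Rle_trans; [apply term_le_gap; try lia; lra|].
      replace (2 / eta) with (/ (eta / 2)) by (field; lra).
      apply Rinv_le_contravar; [lra|]. rewrite Rabs_right by lra. nra.
  - intros n Hn Hne. apply term_le_gap; try lia; auto.
Qed.

End Endpoint_sums.

(** Here [A = p ^ 3], [X = u ^ 6] and [Y = s ^ 6], which makes every bound polynomial in [p], [u], [s]; the dual
    variable runs up to [p ^ 2 * s = A^(2/3) Y^(1/6)]. *)
Section Core.

Variables (p u s phi : R) (P Q K : nat).
Hypothesis Hp : 0 < p.
Hypothesis Hu : 1 <= u.
Hypothesis Hus : u <= s.
Hypothesis Hsu : s ^ 2 <= 2 * u ^ 2.
Hypothesis HP : INR P <= s ^ 3 < INR P + 1.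
Hypothesis HQ : p ^ 2 * s <= INR Q <= p ^ 2 * s + 1.
Hypothesis HPK : (P <= K)%nat.
Hypothesis HQK : (Q <= K)%nat.
Hypothesis HYK : s ^ 6 <= INR K.
Hypothesis HMK : p ^ 4 * s ^ 2 <= INR K.

(** The slope of the lower endpoint frequency in [n]; a third of it also bounds the spacing of the
    upper one from below. *)
Let eta := p ^ 2 / s ^ 2.

Lemma Hs1 : 1 <= s. Proof. lra. Qed.

Lemma p_pow k : 0 < p ^ k. Proof. now apply pow_lt. Qed.
Lemma s_pow k : 0 < s ^ k. Proof. apply pow_lt; lra. Qed.
Lemma u_pow k : 0 < u ^ k. Proof. apply pow_lt; lra. Qed.

Lemma eta_pos : 0 < eta.
Proof. apply Rdiv_lt_0_compat; [apply p_pow|apply s_pow]. Qed.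

Lemma Q_ge1 : (1 <= Q)%nat.
Proof.
  assert (h : 0 < p ^ 2 * s) by (apply Rmult_lt_0_compat; [apply p_pow|lra]).
  destruct Q as [|Q']; [simpl in HQ; lra|lia].
Qed.

(** For given [n], the conditions [n <= m] and [u^6 <= n m <= s^6] confine [m] to [[an n, bn n]].
    The frequencies at the right and left ends are [lo_freq n] and [hi_freq n]. *)
Let an (n : nat) := Rmax (INR n) (u ^ 6 / INR n).
Let bn (n : nat) := s ^ 6 / INR n.
Let lo_freq (n : nat) := p ^ 2 * INR n / s ^ 2.
Let hi_freq (n : nat) := Rmin (p ^ 2 * cbrt (INR n)) (p ^ 2 * INR n / u ^ 2).

Lemma cbrt_bn n : (1 <= n)%nat -> cbrt (bn n) = s ^ 2 / cbrt (INR n).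
Proof.
  intros hn. apply INR_ge1 in hn. assert (hc := cbrt_pos (INR n)).
  unfold bn. replace (s ^ 6 / INR n) with ((s ^ 2 / cbrt (INR n)) ^ 3).
  - apply cube_cbrt. apply Rdiv_lt_0_compat; auto. apply s_pow.
  - rewrite <- (cbrt_cube (INR n)) at 2 by lra. field. lra.
Qed.

Lemma freq_bn n : (1 <= n)%nat -> (p * cbrt (INR n)) ^ 2 / cbrt (bn n) = lo_freq n.
Proof.
  intros hn. rewrite cbrt_bn by auto. apply INR_ge1 in hn. assert (hc := cbrt_pos (INR n)).
  unfold lo_freq. rewrite <- (cbrt_cube (INR n)) at 3 by lra. field. split; lra.
Qed.

(** The frequency [g^2 / cbrt x] decreases in [x], so the maximum in [an] turns into the minimum in
    [hi_freq]. *)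
Lemma freq_an n : (1 <= n)%nat -> (p * cbrt (INR n)) ^ 2 / cbrt (an n) = hi_freq n.
Proof.
  intros hn. apply INR_ge1 in hn. assert (hc := cbrt_pos (INR n)).
  assert (h1 : (p * cbrt (INR n)) ^ 2 / cbrt (INR n) = p ^ 2 * cbrt (INR n)) by (field; lra).
  assert (h2 : (p * cbrt (INR n)) ^ 2 / cbrt (u ^ 6 / INR n) = p ^ 2 * INR n / u ^ 2).
  { replace (u ^ 6 / INR n) with ((u ^ 2 / cbrt (INR n)) ^ 3).
    - rewrite cube_cbrt by (apply Rdiv_lt_0_compat; auto; apply u_pow).
      rewrite <- (cbrt_cube (INR n)) at 3 by lra. field. split; lra.
    - rewrite <- (cbrt_cube (INR n)) at 2 by lra. field. lra. }
  assert (hmon : forall x y, 0 < x <= y -> (p * cbrt (INR n)) ^ 2 / cbrt y <= (p * cbrt (INR n)) ^ 2 / cbrt x).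
  { intros x y Hxy. apply Rmult_le_compat_l; [apply pow2_ge_0|].
    apply Rinv_le_contravar; [apply cbrt_pos|now apply cbrt_le]. }
  assert (hu6 : 0 < u ^ 6 / INR n) by (apply Rdiv_lt_0_compat; [apply u_pow|lra]).
  unfold an, hi_freq. rewrite <- h1, <- h2. unfold Rmax. destruct Rle_dec as [h|h].
  - rewrite Rmin_right; auto. apply hmon; lra.
  - rewrite Rmin_left; auto. apply hmon; lra.
Qed.

Lemma sq_le_Y n : (n <= P)%nat -> INR n <= s ^ 3.
Proof. intros h. apply le_INR in h. lra. Qed.

Lemma an_bn n : (1 <= n <= P)%nat -> 0 < an n <= bn n.
Proof.
  intros hn. assert (h1 : 1 <= INR n) by (apply INR_ge1; lia). assert (h2 := sq_le_Y n ltac:(lia)).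
  split; [apply Rlt_le_trans with (INR n); [lra|apply Rmax_l]|].
  unfold an, bn. apply Rmax_lub.
  - apply Rmult_le_reg_r with (INR n); [lra|]. field_simplify; [|lra].
    nra.
  - apply Rmult_le_compat_r; [left; apply Rinv_pos; lra|]. apply pow_incr; lra.
Qed.

Lemma lo_freq_props n : (1 <= n <= P)%nat -> eta * INR n <= lo_freq n.
Proof. intros _. unfold lo_freq, eta. right. field.  lra. Qed.

Lemma cbrt_le_s n : (1 <= n <= P)%nat -> cbrt (INR n) <= s.
Proof.
  intros hn. assert (h1 : 1 <= INR n) by (apply INR_ge1; lia). assert (h2 := sq_le_Y n ltac:(lia)).
  apply cube_le_iff; [left; apply cbrt_pos|lra|]. rewrite cbrt_cube; lra.
Qed.

(** On the first branch [p^2 cbrt n] is [p^2 n] divided by [(cbrt n)^2 <= s^2]; on the second,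
    [u <= s]. *)
Lemma hi_freq_low n : (1 <= n <= P)%nat -> eta * INR n <= hi_freq n.
Proof.
  intros hn. assert (h1 : 1 <= INR n) by (apply INR_ge1; lia). assert (hc := cbrt_pos (INR n)).
  assert (hs := cbrt_le_s n hn). assert (hp2 := p_pow 2). assert (hs2 := s_pow 2). assert (hu2 := u_pow 2).
  unfold hi_freq, eta. apply Rmin_glb.
  - assert (hc2 : cbrt (INR n) ^ 2 <= s ^ 2) by (apply pow_incr; lra).
    assert (E : INR n = cbrt (INR n) * cbrt (INR n) ^ 2) by (rewrite <- (cbrt_cube (INR n)) at 1 by lra; ring).
    rewrite E at 1. unfold Rdiv. rewrite Rmult_assoc. apply Rmult_le_compat_l; [lra|].
    apply Rmult_le_reg_l with (s ^ 2); auto. rewrite <- Rmult_assoc, Rinv_r, Rmult_1_l by lra.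
    rewrite Rmult_comm. apply Rmult_le_compat_r; lra.
  - replace (p ^ 2 / s ^ 2 * INR n) with (p ^ 2 * INR n / s ^ 2) by (field; lra).
    unfold Rdiv. apply Rmult_le_compat_l; [nra|]. apply Rinv_le_contravar; auto. apply pow_incr; lra.
Qed.

(** Each branch of the minimum grows at least this fast, hence so does the minimum. For the cube
    root branch, [y^3 - x^3] is at most [3 s^2 (y - x)]. *)
Lemma hi_freq_spaced i j : (1 <= i)%nat -> (i <= j <= P)%nat ->
  eta / 3 * (INR j - INR i) <= hi_freq j - hi_freq i.
Proof.
  intros hi hj. assert (h1 : 1 <= INR i) by (apply INR_ge1; lia). assert (hij : INR i <= INR j) by (apply le_INR; lia).
  assert (hp2 := p_pow 2). assert (hs2 := s_pow 2). assert (hu2 := u_pow 2).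
  assert (he : eta / 3 * (INR j - INR i) = p ^ 2 * ((INR j - INR i) / (3 * s ^ 2))) by (unfold eta; field; lra).
  assert (A1 : eta / 3 * (INR j - INR i) <= p ^ 2 * cbrt (INR j) - p ^ 2 * cbrt (INR i)).
  { rewrite he, <- Rmult_minus_distr_l. apply Rmult_le_compat_l; [lra|].
    assert (hci := cbrt_pos (INR i)).
    assert (hle := cbrt_le (INR i) (INR j) ltac:(lra)). assert (hcs := cbrt_le_s j ltac:(lia)).
    rewrite <- (cbrt_cube (INR i)) at 1 by lra. rewrite <- (cbrt_cube (INR j)) at 1 by lra.
    set (x := cbrt (INR i)) in *. set (y := cbrt (INR j)) in *.
    apply Rmult_le_reg_r with (3 * s ^ 2); [lra|]. unfold Rdiv. rewrite Rmult_assoc, Rinv_l, Rmult_1_r by lra.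
    replace (y ^ 3 - x ^ 3) with ((y - x) * (y * y + y * x + x * x)) by ring.
    apply Rmult_le_compat_l; [lra|]. nra. }
  assert (A2 : eta / 3 * (INR j - INR i) <= p ^ 2 * INR j / u ^ 2 - p ^ 2 * INR i / u ^ 2).
  { rewrite he. replace (p ^ 2 * INR j / u ^ 2 - p ^ 2 * INR i / u ^ 2) with (p ^ 2 * ((INR j - INR i) / u ^ 2)) by (field; lra).
    apply Rmult_le_compat_l; [lra|]. apply Rmult_le_compat_l; [lra|].
    apply Rinv_le_contravar; auto. assert (u ^ 2 <= s ^ 2) by (apply pow_incr; lra). lra. }
  unfold hi_freq, Rmin. destruct (Rle_dec (p ^ 2 * cbrt (INR j)) _), (Rle_dec (p ^ 2 * cbrt (INR i)) _); lra.
Qed.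

Lemma lo_freq_spaced i j : (1 <= i)%nat -> (i <= j <= P)%nat ->
  eta / 3 * (INR j - INR i) <= lo_freq j - lo_freq i.
Proof.
  intros hi hj. assert (hij : INR i <= INR j) by (apply le_INR; lia).
  replace (lo_freq j - lo_freq i) with (eta * (INR j - INR i)) by (unfold lo_freq, eta; field; lra).
  assert (h := eta_pos). nra.
Qed.

Let c1 (n m : nat) := cos (phi - 3 * PI * cbrt (p ^ 3 * INR (n * m)) ^ 2).
Let c2 (n k : nat) := cos (phi + PI / 4 - PI * (p ^ 3 * INR n) ^ 2 / INR k ^ 2).
Let gap (b : nat -> R) (n k : nat) := / (INR k ^ 2 / (sqrt 3 * (p ^ 3 * INR n)) + Rabs (b n - INR k)).

(** Applied with [g = p cbrt n], so that [g^3 = p^3 n] makes the amplitude and the dual phase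
    polynomial in [n]. The factor [INR n] is set apart for a later partial summation. *)
Lemma first_b_process n : (1 <= n <= P)%nat ->
  Rabs (rsum K (fun m => cut (an n) (bn n) (INR m) * c1 n m)
    - rsum Q (fun k => cut (lo_freq n) (hi_freq n) (INR k) * (sqrt 3 * p ^ 3 / INR k ^ 2 * (INR n * c2 n k))))
  <= 100 * harm Q + 4 / eta * / INR n + 32 * rsum Q (fun k => gap hi_freq n k) + 32 * rsum Q (fun k => gap lo_freq n k).
Proof.
  intros hn. assert (h1 : 1 <= INR n) by (apply INR_ge1; lia). assert (hc := cbrt_pos (INR n)).
  assert (hg3 : (p * cbrt (INR n)) ^ 3 = p ^ 3 * INR n).
  { rewrite Rpow_mult_distr, cbrt_cube by lra. reflexivity. }
  assert (HB := power_b_process (p * cbrt (INR n)) (an n) (bn n) phi K Q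
    ltac:(apply Rmult_lt_0_compat; auto) (an_bn n hn)).
  rewrite freq_an, freq_bn, hg3 in HB by lia.
  assert (HbK : bn n <= INR K).
  {  unfold bn, Rdiv.
    assert (/ INR n <= 1) by (rewrite <- Rinv_1; apply Rinv_le_contravar; lra). nra. }
  assert (HhQ : hi_freq n <= INR Q).
  { apply Rle_trans with (2 := proj1 HQ). eapply Rle_trans; [apply Rmin_l|].
    apply Rmult_le_compat_l; [left; apply p_pow|now apply cbrt_le_s]. }
  specialize (HB HbK Q_ge1 HhQ).
  eapply Rle_trans; [|eapply Rle_trans; [apply HB|]].
  - right. f_equal. apply (f_equal2 Rminus).
    + apply rsum_ext. intros m Hm. assert (hm : 1 <= INR m) by (apply INR_ge1; lia).
      unfold c1. do 2 f_equal.
      assert (hcm := cbrt_pos (INR m)).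
      replace (p ^ 3 * INR (n * m)) with ((p * cbrt (INR n) * cbrt (INR m)) ^ 3).
      * rewrite cube_cbrt by (repeat apply Rmult_lt_0_compat; auto). ring.
      * rewrite !Rpow_mult_distr, !cbrt_cube, mult_INR by lra. ring.
    + apply rsum_ext. intros k Hk. f_equal. unfold c2, Rdiv. ring.
  - rewrite cbrt_bn by lia. unfold gap.
    (* The zero frequency costs [4 s^2 / (p^2 n)], that is, [4 / (eta n)]. *)
    replace (4 * (s ^ 2 / cbrt (INR n)) / (p * cbrt (INR n)) ^ 2) with (4 / eta * / INR n); [lra|].
    rewrite <- (cbrt_cube (INR n)) at 1 by lra. unfold eta. field. repeat split; lra.
Qed.

Lemma first_step :
  Rabs (rsum P (fun n => rsum K (fun m => cut (an n) (bn n) (INR m) * c1 n m))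
    - rsum P (fun n => rsum Q (fun k => cut (lo_freq n) (hi_freq n) (INR k) * (sqrt 3 * p ^ 3 / INR k ^ 2 * (INR n * c2 n k)))))
  <= 100 * INR P * harm Q + 4 / eta * harm P
     + 32 * rsum P (fun n => rsum Q (fun k => gap hi_freq n k)) + 32 * rsum P (fun n => rsum Q (fun k => gap lo_freq n k)).
Proof.
  eapply Rle_trans; [apply rsum_dist_le; intros n hn; apply first_b_process; auto|].
  rewrite !rsum_plus, !rsum_scal, rsum_const. right. unfold harm. ring.
Qed.

(** With [k] fixed, the phase in [n] is [- PI * tk k * n^2] and the same region confines [n] to
    [[lok k, hik k]]. The dual variable [m] is stationary at [n = m / tk k]. *)
Let tk (k : nat) := p ^ 6 / INR k ^ 2.
Let lok (k : nat) := Rmax (INR k ^ 3 / p ^ 6) (INR k * u ^ 2 / p ^ 2).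
Let hik (k : nat) := INR k * s ^ 2 / p ^ 2.
Let c3 (k m : nat) := cos (phi + PI * INR (k * m) ^ 2 / p ^ 6).

(** Each of the three inequalities bounding [k] in terms of [n] is solved for [n]; closed ranges
    make the exchange of summations exact. *)
Lemma middle_range n k : (1 <= n)%nat -> (1 <= k)%nat ->
  cut (lo_freq n) (hi_freq n) (INR k) = cut (lok k) (hik k) (INR n).
Proof.
  intros hn hk. apply INR_ge1 in hn. apply INR_ge1 in hk. apply cut_iff.
  assert (hc := cbrt_pos (INR n)). assert (hp2 := p_pow 2). assert (hp6 := p_pow 6).
  assert (hs2 := s_pow 2). assert (hu2 := u_pow 2).
  assert (E1 : p ^ 2 * INR n / s ^ 2 <= INR k <-> INR n <= INR k * s ^ 2 / p ^ 2).
  { rewrite div_le_iff, le_div_iff by auto. rewrite (Rmult_comm (INR n)). tauto. }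
  assert (E2 : INR k <= p ^ 2 * INR n / u ^ 2 <-> INR k * u ^ 2 / p ^ 2 <= INR n).
  { rewrite div_le_iff, le_div_iff by auto. rewrite (Rmult_comm (INR n)). tauto. }
  assert (E3 : INR k <= p ^ 2 * cbrt (INR n) <-> INR k ^ 3 / p ^ 6 <= INR n).
  { rewrite div_le_iff by auto. rewrite <- (cube_le_iff (INR k)) by nra.
    replace ((p ^ 2 * cbrt (INR n)) ^ 3) with (cbrt (INR n) ^ 3 * p ^ 6) by ring. rewrite cbrt_cube by lra. tauto. }
  split; intros [h1 h2].
  - split; [|tauto]. apply Rmax_lub; [apply E3|apply E2]; apply Rle_trans with (1 := h2); [apply Rmin_l|apply Rmin_r].
  - split; [tauto|]. apply Rmin_glb; [apply E3|apply E2]; apply Rle_trans with (2 := h1); [apply Rmax_l|apply Rmax_r].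
Qed.

(** Substituting [n = m k^2 / p^6], the bound [n >= k^3 / p^6] becomes [k <= m], and the other two
    become bounds on [(k m)^3 / p^12]. The region is again symmetric in its variables. *)
Lemma dual_range k m : (1 <= k)%nat -> (1 <= m)%nat ->
  cut (lok k) (hik k) (INR m / tk k) = le_ind k m * cut (u ^ 6) (s ^ 6) (INR (k * m) ^ 3 / p ^ 12).
Proof.
  intros hk hm. apply INR_ge1 in hk as hk'. apply INR_ge1 in hm as hm'.
    assert (hp6 := p_pow 6). assert (hp12 := p_pow 12).
    assert (hk2 : 0 < INR k ^ 2) by (apply pow_lt; lra).
  assert (hkm : 0 < INR (k * m)) by (rewrite mult_INR; nra).
  assert (Et : INR m / tk k = INR m * INR k ^ 2 / p ^ 6) by (unfold tk; field; split; lra).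
  assert (E1 : INR k ^ 3 / p ^ 6 <= INR m / tk k <-> (k <= m)%nat).
  { rewrite Et. split; intros H.
    - apply INR_le. apply Rmult_le_reg_r in H; [|now apply Rinv_pos].
      apply Rmult_le_reg_r with (INR k ^ 2); auto.
    - apply le_INR in H. apply Rmult_le_compat_r; [left; now apply Rinv_pos|].
      apply Rmult_le_compat_r; lra. }
  assert (E2 : INR k * u ^ 2 / p ^ 2 <= INR m / tk k <-> u ^ 6 <= INR (k * m) ^ 3 / p ^ 12).
  { rewrite Et, le_div_iff, le_div_iff by auto.
    replace (INR k * u ^ 2 / p ^ 2 * p ^ 6) with (INR k * (u ^ 2 * p ^ 4)) by (field; lra).
    replace (u ^ 6 * p ^ 12) with ((u ^ 2 * p ^ 4) ^ 3) by ring.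
    rewrite cube_le_iff by nra. rewrite mult_INR.
    replace (INR m * INR k ^ 2) with (INR k * (INR k * INR m)) by ring.
    split; intros H; [apply Rmult_le_reg_l in H; lra|apply Rmult_le_compat_l; lra]. }
  assert (E3 : INR m / tk k <= hik k <-> INR (k * m) ^ 3 / p ^ 12 <= s ^ 6).
  { rewrite Et, div_le_iff, div_le_iff by auto. unfold hik.
    replace (INR k * s ^ 2 / p ^ 2 * p ^ 6) with (INR k * (s ^ 2 * p ^ 4)) by (field; lra).
    replace (s ^ 6 * p ^ 12) with ((s ^ 2 * p ^ 4) ^ 3) by ring.
    rewrite cube_le_iff by nra. rewrite mult_INR.
    replace (INR m * INR k ^ 2) with (INR k * (INR k * INR m)) by ring.
    split; intros H; [apply Rmult_le_reg_l in H; lra|apply Rmult_le_compat_l; lra]. }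
  unfold le_ind. destruct (le_dec k m) as [h|h].
  - rewrite Rmult_1_l. apply cut_iff. split; intros [h1 h2].
    + split; [apply E2|tauto]. apply Rle_trans with (2 := h1), Rmax_r.
    + split; [apply Rmax_lub|]; tauto.
  - rewrite Rmult_0_l. apply cut_out. left.
    destruct (Rlt_dec (INR m / tk k) (lok k)) as [h'|h']; auto. exfalso; apply h, E1.
    apply Rle_trans with (lok k); [apply Rmax_l|lra].
Qed.

(** Reciprocity is read from the [m]-side, with [t = k^2 / p^6] and [sqrt t = k / p^3]: then the [n]
    are the frequencies, and the logarithm is that of [P] whatever the size of [p]. The free upper
    end [x] prepares a partial summation. *)
Lemma second_inner k x E : (1 <= k)%nat -> lok k <= x <= hik k -> hik k <= s ^ 3 ->
  E = (if Rle_dec (hik k) (/ 2) then 104 + 16 / lok k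
       else 40 * harm (P + 1) + 32 * (p ^ 3 / INR k) + 16 / lok k) ->
  Rabs (rsum P (fun n => cut (lok k) x (INR n) * c2 n k)
    - rsum K (fun m => cut (lok k) x (INR m / tk k) * (INR k / p ^ 3 * c3 k m))) <= INR k / p ^ 3 * E.
Proof.
  intros hk Hx Hhi HE. apply INR_ge1 in hk as hk'.
  assert (hp3 := p_pow 3). assert (hp6 := p_pow 6).  assert (hk2 : 0 < INR k ^ 2) by (apply pow_lt; lra).
  assert (ht : 0 < tk k) by (apply Rdiv_lt_0_compat; auto).
  assert (hlo : 0 < lok k).
  { apply Rlt_le_trans with (INR k ^ 3 / p ^ 6); [apply Rdiv_lt_0_compat; auto; apply pow_lt; lra|apply Rmax_l]. }
  assert (hsq : sqrt (/ tk k) = INR k / p ^ 3).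
  { replace (/ tk k) with ((INR k / p ^ 3) * (INR k / p ^ 3)) by (unfold tk; field; split; lra).
    apply sqrt_square. left; apply Rdiv_lt_0_compat; lra. }
  assert (hkp : 0 < INR k / p ^ 3) by (apply Rdiv_lt_0_compat; lra).
  set (kap := INR k / p ^ 3) in *.
  assert (Hcancel : forall z, / tk k * (tk k * z) = z) by (intros; field; lra).
  assert (HG : exists n0, Rabs (rsum K (fun m => cut (tk k * lok k) (tk k * x) (INR m) * cos (PI * / tk k * INR m ^ 2 + phi))
      - / kap * rsum n0 (fun n => cut (lok k) x (INR n) * cos (phi + PI / 4 - PI * INR n ^ 2 / (/ tk k)))) <= E
     /\ rsum n0 (fun n => cut (lok k) x (INR n) * cos (phi + PI / 4 - PI * INR n ^ 2 / (/ tk k))) = rsum P (fun n => cut (lok k) x (INR n) * c2 n k)).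
  { assert (Htx : tk k * x <= INR K).
    { apply Rle_trans with (tk k * hik k); [apply Rmult_le_compat_l; lra|].
       unfold tk, hik.
      replace (p ^ 6 / INR k ^ 2 * (INR k * s ^ 2 / p ^ 2)) with (p ^ 4 * s ^ 2 * / INR k) by (field; split; lra).
      assert (/ INR k <= 1) by (rewrite <- Rinv_1; apply Rinv_le_contravar; lra).
        nra. }
    assert (Htl : 0 < tk k * lok k <= tk k * x) by (split; [now apply Rmult_lt_0_compat|apply Rmult_le_compat_l; lra]).
    assert (Hc2 : forall n, cos (phi + PI / 4 - PI * INR n ^ 2 / (/ tk k)) = c2 n k).
    { intros n. unfold c2. f_equal. f_equal. unfold tk. field. repeat split; lra. }
    (* If [hik k <= 1/2] there is no integer [n] in range and every frequency is at distance at
       least 1/2. Then [T = 2] and [n0 = 1] suffice, giving [104 = 40 + 64] without a logarithm. *)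
    destruct (Rle_dec (hik k) (/ 2)) as [h|h].
    - exists 1%nat. split.
      + assert (HR := gauss_sum_reciprocity (/ tk k) (tk k * lok k) (tk k * x) phi K 1 2).
        rewrite !Hcancel, hsq in HR.
        assert (HT : forall z, z <= / 2 -> forall j, (1 <= j)%nat -> / (kap + Rabs (z - INR j)) <= 2).
        { intros z hz j hj. apply INR_ge1 in hj. rewrite <- (Rinv_inv 2). apply Rinv_le_contravar; [lra|].
          rewrite Rabs_left by lra. lra. }
        eapply Rle_trans; [apply HR; auto; try lra; try (apply HT; lra)|].
        * now apply Rinv_pos.
        * simpl; lra.
        * rewrite HE. unfold harm; simpl. lra.
      + rewrite (rsum_zero 1), (rsum_zero P); [reflexivity| |]; intros n hn;
        assert (1 <= INR n) by (apply INR_ge1; lia); rewrite cut_out by lra; ring.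
    (* The range ends at [x <= s^3 < P + 1], so [P + 1] frequencies cover it and the last one is cut
       out. *)
    - exists (P + 1)%nat. assert (HP1 : INR (P + 1) = INR P + 1) by (rewrite plus_INR; simpl; ring). split.
      + assert (HR := gauss_sum_reciprocity (/ tk k) (tk k * lok k) (tk k * x) phi K (P + 1) (/ kap)).
        rewrite !Hcancel, hsq in HR.
        assert (HT : forall z j, / (kap + Rabs (z - INR j)) <= / kap).
        { intros z j. apply Rinv_le_contravar; auto. generalize (Rabs_pos (z - INR j)); lra. }
        eapply Rle_trans; [apply HR; auto; try lra; try lia|].
        * now apply Rinv_pos.
        * left; now apply Rinv_pos.
        * rewrite HE. right. unfold kap. field. repeat split; lra.
      + rewrite (rsum_widen P (P + 1)); [apply rsum_ext; intros; now rewrite Hc2|lia|].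
        intros j hj. replace j with (P + 1)%nat by lia. rewrite HP1, cut_out by lra. ring. }
  destruct HG as (n0 & HG & En). rewrite En in HG.
  set (N1 := rsum P _) in *.
  replace (rsum K (fun m => cut (lok k) x (INR m / tk k) * (kap * c3 k m))) with
    (kap * rsum K (fun m => cut (tk k * lok k) (tk k * x) (INR m) * cos (PI * / tk k * INR m ^ 2 + phi))).
  2:{ rewrite <- rsum_scal. apply rsum_ext. intros m hm.
      rewrite (cut_iff (tk k * lok k) (tk k * x) (INR m) (lok k) x (INR m / tk k)).
      - unfold c3. rewrite mult_INR.
        replace (PI * / tk k * INR m ^ 2 + phi) with (phi + PI * (INR k * INR m) ^ 2 / p ^ 6) by (unfold tk; field; split; lra). ring.
      - rewrite le_div_iff, div_le_iff by auto. rewrite (Rmult_comm (lok k)), (Rmult_comm x). tauto. }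
  set (M1 := rsum K _) in *.
  replace (N1 - kap * M1) with (- (kap * (M1 - / kap * N1))) by (field; lra).
  rewrite Rabs_Ropp, Rabs_mult, Rabs_right by lra. apply Rmult_le_compat_l; lra.
Qed.

(** The weight [n] is restored by partial summation, which multiplies the error by at most
    [2 * hik k]. For [hik k <= 1/2] this leaves a multiple of [1 / k]; the costlier case needs
    [k >= eta / 2], since [hik k = k / eta]. *)
Lemma second_b_process k : (1 <= k)%nat ->
  Rabs (rsum P (fun n => cut (lok k) (hik k) (INR n) * (sqrt 3 * p ^ 3 / INR k ^ 2 * (INR n * c2 n k)))
    - sqrt 3 / p ^ 6 * rsum K (fun m => le_ind k m * cut (u ^ 6) (s ^ 6) (INR (k * m) ^ 3 / p ^ 12) * (INR (k * m) * c3 k m)))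
  <= 544 * / INR k + cut (eta / 2) (p ^ 2 * s) (INR k) * (4 / eta * (40 * harm (P + 1) + 64) + 128 * p ^ 3 / eta * / INR k).
Proof.
  intros hk. apply INR_ge1 in hk as hk'.
  assert (hp3 := p_pow 3). assert (hp6 := p_pow 6). assert (hp2 := p_pow 2). assert (hk2 : 0 < INR k ^ 2) by (apply pow_lt; lra).
  assert (hs2 := s_pow 2). assert (hu2 := u_pow 2). assert (he := eta_pos). assert (hr3 := sqrt3_bounds).
  assert (hhm := harm_nonneg (P + 1)).
  assert (hki : 0 < / INR k) by (apply Rinv_pos; lra).
  assert (hei : 0 < / eta) by now apply Rinv_pos.
  assert (ht : 0 < tk k) by (apply Rdiv_lt_0_compat; auto).
  assert (Hb0 : 0 <= 4 / eta * (40 * harm (P + 1) + 64) + 128 * p ^ 3 / eta * / INR k).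
  { assert (0 <= / eta * harm (P + 1)) by (apply Rmult_le_pos; lra).
    assert (0 < p ^ 3 * / eta * / INR k) by (repeat apply Rmult_lt_0_compat; lra).
    unfold Rdiv. lra. }
  assert (Hb1 := cut_bound (eta / 2) (p ^ 2 * s) (INR k)).
  assert (Edual : sqrt 3 / p ^ 6 * rsum K (fun m => le_ind k m * cut (u ^ 6) (s ^ 6) (INR (k * m) ^ 3 / p ^ 12) * (INR (k * m) * c3 k m))
     = sqrt 3 * p ^ 3 / INR k ^ 2 * rsum K (fun m => cut (lok k) (hik k) (INR m / tk k) * (INR m / tk k * (INR k / p ^ 3 * c3 k m)))).
  { rewrite <- !rsum_scal. apply rsum_ext. intros m hm. rewrite dual_range by lia. rewrite (mult_INR k m) at 2. unfold tk. field. split; lra. }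
  rewrite Edual.
  rewrite (rsum_ext P _ (fun n => sqrt 3 * p ^ 3 / INR k ^ 2 * (cut (lok k) (hik k) (INR n) * (INR n * c2 n k)))) by (intros; ring).
  rewrite rsum_scal, <- Rmult_minus_distr_l.
  destruct (Rlt_dec (hik k) (lok k)) as [Hempty|Hne].
  - rewrite !rsum_zero.
    + rewrite Rminus_0_r, Rmult_0_r, Rabs_R0. nra.
    + intros m _. rewrite cut_out by lra. ring.
    + intros n _. rewrite cut_out by lra. ring.
  - assert (Hle : lok k <= hik k) by lra.
    assert (Hhk : hik k = INR k * / eta) by (unfold hik, eta; field; lra).
    assert (hhi : 0 < hik k) by (rewrite Hhk; nra).
    (* A nonempty range gives [k^3 / p^6 <= k s^2 / p^2]. *)
    assert (Hkb : INR k <= p ^ 2 * s).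
    { assert (H1 : INR k ^ 3 / p ^ 6 <= hik k) by (apply Rle_trans with (2 := Hle), Rmax_l).
      unfold hik in H1. rewrite div_le_iff in H1 by auto.
      replace (INR k * s ^ 2 / p ^ 2 * p ^ 6) with (INR k * (p ^ 2 * s) ^ 2) in H1 by (field; lra).
      assert (H2 : INR k ^ 2 <= (p ^ 2 * s) ^ 2).
      { apply Rmult_le_reg_l with (INR k); [lra|]. lra. }
      assert (0 < p ^ 2 * s) by (apply Rmult_lt_0_compat; lra).
      nra. }
    assert (Hhs : hik k <= s ^ 3).
    { unfold hik. rewrite div_le_iff by auto. replace (s ^ 3 * p ^ 2) with (p ^ 2 * s * s ^ 2) by ring. apply Rmult_le_compat_r; lra. }
    (* From [s^2 <= 2 u^2]; this keeps the term [16 / lok k], once multiplied by [hik k],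
       bounded. *)
    assert (Hlo : hik k / 2 <= lok k).
    { apply Rle_trans with (INR k * u ^ 2 / p ^ 2); [|apply Rmax_r]. unfold hik, Rdiv.
      assert (0 < INR k * / p ^ 2) by (apply Rmult_lt_0_compat; [lra|now apply Rinv_pos]). nra. }
    set (E := if Rle_dec (hik k) (/ 2) then 104 + 16 / lok k else 40 * harm (P + 1) + 32 * (p ^ 3 / INR k) + 16 / lok k).
    (* The weight is [n] on one side and the stationary point [m / tk k] on the other. *)
    assert (HA := abel_compare (fun x => x) (fun _ => 1) (lok k) (hik k) P K INR (fun n => c2 n k)
      (fun m => INR m / tk k) (fun m => INR k / p ^ 3 * c3 k m) (INR k / p ^ 3 * E) Hle).
    assert (HA' : Rabs (rsum P (fun n => cut (lok k) (hik k) (INR n) * (INR n * c2 n k)) -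
       rsum K (fun m => cut (lok k) (hik k) (INR m / tk k) * (INR m / tk k * (INR k / p ^ 3 * c3 k m))))
       <= INR k / p ^ 3 * E * (Rabs (hik k) + Rabs (hik k - lok k))).
    { apply HA.
      - intros; apply (is_derive_id (K := R_AbsRing)).
      - intros; apply continuous_const.
      - left; intros; lra.
      - intros x Hx. now apply second_inner. }
    clear HA.
    assert (hlo0 : 0 < lok k) by lra.
    assert (hli : 0 < / lok k) by now apply Rinv_pos.
    assert (HE0 : 0 <= E).
    { unfold E. assert (0 < p ^ 3 / INR k) by (apply Rdiv_lt_0_compat; lra). destruct Rle_dec; lra. }
    assert (Hkp : 0 < INR k / p ^ 3) by (apply Rdiv_lt_0_compat; lra).
    assert (Hc0 : 0 < sqrt 3 * p ^ 3 / INR k ^ 2) by (apply Rdiv_lt_0_compat; [apply Rmult_lt_0_compat; lra|auto]).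
    rewrite Rabs_mult, (Rabs_right (sqrt 3 * p ^ 3 / INR k ^ 2)) by lra.
    apply Rle_trans with (sqrt 3 * p ^ 3 / INR k ^ 2 * (INR k / p ^ 3 * E * (2 * hik k))).
    { apply Rmult_le_compat_l; [lra|]. eapply Rle_trans; [exact HA'|].
      apply Rmult_le_compat_l; [apply Rmult_le_pos; lra|]. rewrite !Rabs_right by lra. lra. }
    replace (sqrt 3 * p ^ 3 / INR k ^ 2 * (INR k / p ^ 3 * E * (2 * hik k))) with (2 * sqrt 3 * (hik k * E * / INR k)) by (field; split; lra).
    assert (Hx0 : 0 <= hik k * E * / INR k) by (apply Rmult_le_pos; [apply Rmult_le_pos; lra|lra]).
    apply Rle_trans with (4 * (hik k * E * / INR k)); [apply Rmult_le_compat_r; lra|].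
    assert (Hll : hik k * / lok k <= 2).
    { apply Rmult_le_reg_r with (lok k); auto. rewrite Rmult_assoc, Rinv_l by lra. lra. }
    unfold E. destruct Rle_dec as [h|h].
    + assert (hik k * (104 + 16 / lok k) <= 136) by (unfold Rdiv; nra).
       nra.
    + rewrite cut_in.
      2:{ split; auto. rewrite Hhk in h.
          assert (/ 2 < INR k * / eta) by lra. apply Rmult_lt_compat_r with (r := eta) in H; auto.
          rewrite Rmult_assoc, Rinv_l in H by lra. lra. }
      assert (Hl4 : 16 / lok k <= 64).
      { assert (/ lok k <= 4) by (rewrite <- (Rinv_inv 4); apply Rinv_le_contravar; lra). unfold Rdiv; lra. }
      rewrite Hhk.
      replace (4 * (INR k * / eta * (40 * harm (P + 1) + 32 * (p ^ 3 / INR k) + 16 / lok k) * / INR k))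
        with (4 / eta * (40 * harm (P + 1) + 16 / lok k) + 128 * p ^ 3 / eta * / INR k) by (field; repeat split; lra).
      assert (4 / eta * (40 * harm (P + 1) + 16 / lok k) <= 4 / eta * (40 * harm (P + 1) + 64)).
      { apply Rmult_le_compat_l; [unfold Rdiv; lra|lra]. }
      nra.
Qed.

(** Twice the sum over [n <= m] minus the diagonal. A product at most [s^6] forces [n <= P], and the
    diagonal has at most [P <= s^3] nonzero terms. *)
Lemma divisor_side :
  Rabs (rsum K (fun k => INR (d k) * (cut (u ^ 6) (s ^ 6) (INR k) * cos (phi - 3 * PI * cbrt (p ^ 3 * INR k) ^ 2)))
    - 2 * rsum P (fun n => rsum K (fun m => cut (an n) (bn n) (INR m) * c1 n m))) <= s ^ 3.
Proof.
  set (H := fun k => cut (u ^ 6) (s ^ 6) (INR k) * cos (phi - 3 * PI * cbrt (p ^ 3 * INR k) ^ 2)).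
  assert (hs3 := s_pow 3).
  change (rsum K (fun k => INR (d k) * (cut (u ^ 6) (s ^ 6) (INR k) * cos (phi - 3 * PI * cbrt (p ^ 3 * INR k) ^ 2))))
    with (rsum K (fun k => INR (d k) * H k)).
  rewrite <- (divisor_double_sum K H).
  2:{ intros k hk. apply lt_INR in hk. unfold H. rewrite cut_out by lra. ring. }
  rewrite (symmetric_double_sum K (fun n m => H (n * m)%nat)) by (intros; f_equal; lia).
  assert (Hbig : forall n m, (P < n)%nat -> (n <= m)%nat -> cut (u ^ 6) (s ^ 6) (INR (n * m)) = 0).
  { intros n m hn hm. apply cut_out. right. rewrite mult_INR.
    assert (INR P + 1 <= INR n) by (rewrite <- S_INR; apply le_INR; lia). apply le_INR in hm.
    nra. }
  assert (E1 : rsum K (fun n => rsum K (fun m => le_ind n m * H (n * m)%nat)) = rsum P (fun n => rsum K (fun m => cut (an n) (bn n) (INR m) * c1 n m))).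
  { rewrite (rsum_widen P K); auto.
    - apply rsum_ext. intros n hn. apply rsum_ext. intros m hm.
      assert (h1 : 1 <= INR n) by (apply INR_ge1; lia).
      unfold H, c1. rewrite <- Rmult_assoc. f_equal.
      unfold le_ind. destruct (le_dec n m) as [h|h].
      + rewrite Rmult_1_l. apply cut_iff. unfold an, bn. apply le_INR in h. rewrite mult_INR.
        rewrite le_div_iff by lra. rewrite (Rmult_comm (INR m)). split; intros [h2 h3]; (split; [|auto]).
        * apply Rmax_lub; auto. apply div_le_iff; lra.
        * assert (h4 : u ^ 6 / INR n <= INR m) by (apply Rle_trans with (2 := h2), Rmax_r).
          apply div_le_iff in h4; lra.
      + rewrite Rmult_0_l, cut_out; auto. left.
        apply Rlt_le_trans with (INR n); [|apply Rmax_l]. apply lt_INR; lia.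
    - intros n hn. apply rsum_zero. intros m hm. unfold H, le_ind. destruct (le_dec n m) as [h|h]; [|ring].
      rewrite Hbig by lia. ring. }
  rewrite E1.
  assert (E2 : Rabs (rsum K (fun n => H (n * n)%nat)) <= INR P).
  { rewrite (rsum_widen P K); auto.
    - replace (INR P) with (rsum P (fun _ => 1)) by (rewrite rsum_const; ring).
      apply rsum_abs_le. intros n hn. unfold H. rewrite Rabs_mult.
      rewrite <- (Rmult_1_l 1). apply Rmult_le_compat; auto using Rabs_pos.
      + assert (h := cut_bound (u ^ 6) (s ^ 6) (INR (n * n))). apply Rabs_le; lra.
      + apply Rabs_le, COS_bound.
    - intros n hn. unfold H. rewrite Hbig by lia. ring. }
  rewrite <- Rabs_Ropp. eapply Rle_trans; [|eapply Rle_trans; [exact E2|apply HP]].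
  right. f_equal. ring.
Qed.

(** The same symmetry for the dual sum. Its diagonal has at most [p^2 s] nonzero terms of size at
    most [p^4 s^2], and the factor [sqrt 3 / p^6] leaves [sqrt 3 * s^3]. *)
Lemma dual_side :
  Rabs (sqrt 3 / p ^ 6 * rsum K (fun k => INR (d k) * (cut (u ^ 6) (s ^ 6) (INR k ^ 3 / p ^ 12) * (INR k * cos (phi + PI * INR k ^ 2 / p ^ 6))))
    - 2 * rsum Q (fun k => sqrt 3 / p ^ 6 * rsum K (fun m => le_ind k m * cut (u ^ 6) (s ^ 6) (INR (k * m) ^ 3 / p ^ 12) * (INR (k * m) * c3 k m))))
  <= 2 * s ^ 3.
Proof.
  set (H := fun k => cut (u ^ 6) (s ^ 6) (INR k ^ 3 / p ^ 12) * (INR k * cos (phi + PI * INR k ^ 2 / p ^ 6))).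
  assert (hs3 := s_pow 3). assert (hs2 := s_pow 2).
  assert (hp4 := p_pow 4). assert (hp6 := p_pow 6). assert (hp12 := p_pow 12). assert (hp2 := p_pow 2).
  assert (hr3 := sqrt3_bounds).
  assert (hB : 0 < p ^ 2 * s) by (apply Rmult_lt_0_compat; lra).
  assert (Hdual : forall x, 0 <= x -> p ^ 4 * s ^ 2 < x -> cut (u ^ 6) (s ^ 6) (x ^ 3 / p ^ 12) = 0).
  { intros x hx0 hx. apply cut_out. right. apply Rnot_le_lt. intros h. rewrite div_le_iff in h by auto.
    replace (s ^ 6 * p ^ 12) with ((p ^ 4 * s ^ 2) ^ 3) in h by ring.
    assert (0 < p ^ 4 * s ^ 2) by now apply Rmult_lt_0_compat. apply (proj1 (cube_le_iff x (p ^ 4 * s ^ 2) ltac:(lra) ltac:(lra))) in h; lra. }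
  assert (Hsq : forall n m, p ^ 2 * s < INR n -> (n <= m)%nat -> cut (u ^ 6) (s ^ 6) (INR (n * m) ^ 3 / p ^ 12) = 0).
  { intros n m hn hm. apply le_INR in hm. apply Hdual; rewrite mult_INR; [apply Rmult_le_pos; lra|].
    replace (p ^ 4 * s ^ 2) with (p ^ 2 * s * (p ^ 2 * s)) by ring.
    apply Rlt_le_trans with (INR n * INR n); [apply Rmult_le_0_lt_compat; lra|apply Rmult_le_compat_l; lra]. }
  change (rsum K (fun k => INR (d k) * (cut (u ^ 6) (s ^ 6) (INR k ^ 3 / p ^ 12) * (INR k * cos (phi + PI * INR k ^ 2 / p ^ 6)))))
    with (rsum K (fun k => INR (d k) * H k)).
  rewrite <- (divisor_double_sum K H).
  2:{ intros k hk. apply lt_INR in hk. unfold H. rewrite Hdual by (try apply pos_INR; lra). ring. }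
  rewrite (symmetric_double_sum K (fun n m => H (n * m)%nat)) by (intros; f_equal; lia).
  assert (E1 : rsum K (fun n => rsum K (fun m => le_ind n m * H (n * m)%nat)) =
    rsum Q (fun k => rsum K (fun m => le_ind k m * cut (u ^ 6) (s ^ 6) (INR (k * m) ^ 3 / p ^ 12) * (INR (k * m) * c3 k m)))).
  { rewrite (rsum_widen Q K); auto.
    - apply rsum_ext. intros n hn. apply rsum_ext. intros m hm. unfold H, c3. ring.
    - intros n hn. apply rsum_zero. intros m hm. unfold H, le_ind. destruct (le_dec n m) as [h|h]; [|ring].
      rewrite Hsq; auto; [ring|]. apply Rle_lt_trans with (INR Q); [lra|]. apply lt_INR; lia. }
  rewrite E1, rsum_scal.
  assert (E2 : Rabs (rsum K (fun n => H (n * n)%nat)) <= (p ^ 2 * s) * (p ^ 4 * s ^ 2)).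
  { apply Rle_trans with (rsum K (fun n => cut 0 (p ^ 2 * s) (INR n) * (p ^ 4 * s ^ 2))).
    - apply rsum_abs_le. intros n hn. unfold H.
      destruct (Rlt_dec (p ^ 2 * s) (INR n)) as [h|h].
      + rewrite Hsq, Rmult_0_l, Rabs_R0 by auto.
        apply Rmult_le_pos; [apply cut_bound|left; now apply Rmult_lt_0_compat].
      + assert (hn0 := pos_INR n). rewrite (cut_in 0) by lra. rewrite Rmult_1_l, Rabs_mult.
        assert (hc := cut_bound (u ^ 6) (s ^ 6) (INR (n * n) ^ 3 / p ^ 12)).
        rewrite (Rabs_right (cut _ _ _)), Rabs_mult, (Rabs_right (INR _)) by (try apply Rle_ge, pos_INR; lra).
        assert (hcos : Rabs (cos (phi + PI * INR (n * n) ^ 2 / p ^ 6)) <= 1) by apply Rabs_le, COS_bound.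
        assert (hcp := Rabs_pos (cos (phi + PI * INR (n * n) ^ 2 / p ^ 6))).
        assert (hnn : INR (n * n) <= p ^ 4 * s ^ 2).
        { rewrite mult_INR. replace (p ^ 4 * s ^ 2) with (p ^ 2 * s * (p ^ 2 * s)) by ring. apply Rmult_le_compat; lra. }
        assert (hn2 := pos_INR (n * n)).
        rewrite <- (Rmult_1_l (p ^ 4 * s ^ 2)). apply Rmult_le_compat; try lra.
        * apply Rmult_le_pos; lra.
        * rewrite <- (Rmult_1_r (p ^ 4 * s ^ 2)). apply Rmult_le_compat; lra.
    - rewrite rsum_scal_r. apply Rmult_le_compat_r; [left; now apply Rmult_lt_0_compat|]. apply count_cut; lra. }
  match type of E2 with Rabs ?D <= _ => set (Dg := D) in * end.
  assert (hc : 0 < sqrt 3 / p ^ 6) by (apply Rdiv_lt_0_compat; lra).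
  rewrite <- Rabs_Ropp.
  apply Rle_trans with (Rabs (sqrt 3 / p ^ 6 * Dg)); [right; f_equal; ring|].
  rewrite Rabs_mult, Rabs_right by lra.
  apply Rle_trans with (sqrt 3 / p ^ 6 * (p ^ 2 * s * (p ^ 4 * s ^ 2))); [apply Rmult_le_compat_l; lra|].
  replace (sqrt 3 / p ^ 6 * (p ^ 2 * s * (p ^ 4 * s ^ 2))) with (sqrt 3 * s ^ 3) by (field; lra). nra.
Qed.

(** The errors of both transformations are doubled, as each was made on the half [n <= m]; the
    diagonals add [3 s^3]. The bound [G] for the endpoint sums is supplied by [gap_bound]. *)
Lemma core_estimate G :
  rsum P (fun n => rsum Q (fun k => gap hi_freq n k)) <= G ->
  rsum P (fun n => rsum Q (fun k => gap lo_freq n k)) <= G ->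
  Rabs (rsum K (fun k => INR (d k) * (cut (u ^ 6) (s ^ 6) (INR k) * cos (phi - 3 * PI * cbrt (p ^ 3 * INR k) ^ 2)))
    - sqrt 3 / p ^ 6 * rsum K (fun k => INR (d k) * (cut (u ^ 6) (s ^ 6) (INR k ^ 3 / p ^ 12) * (INR k * cos (phi + PI * INR k ^ 2 / p ^ 6)))))
  <= 200 * INR P * harm Q + 8 / eta * harm P + 128 * G + 1088 * harm Q
     + 8 * s ^ 3 * (40 * harm (P + 1) + 64) + 256 * (p * s ^ 2) * (1 + ln (2 * s ^ 3)) + 3 * s ^ 3.
Proof.
  intros HGh HGl.
  assert (hp2 := p_pow 2). assert (hp3 := p_pow 3).   assert (he := eta_pos).
  assert (hB : 0 < p ^ 2 * s) by (apply Rmult_lt_0_compat; lra).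
  assert (hhm := harm_nonneg (P + 1)).
  assert (H1 := divisor_side). assert (H2 := dual_side). assert (H3 := first_step).
  match goal with |- Rabs (?L - ?R) <= _ => set (LHS := L) in *; set (RHS := R) in * end.
  match type of H1 with Rabs (_ - 2 * ?M) <= _ => set (M1 := M) in * end.
  match type of H2 with Rabs (_ - 2 * ?M) <= _ => set (M2 := M) in * end.
  set (W := 4 / eta * (40 * harm (P + 1) + 64)). set (V := 128 * p ^ 3 / eta).
  assert (HW : 0 <= W) by (apply Rmult_le_pos; [left; apply Rdiv_lt_0_compat|]; lra).
  assert (HV : 0 <= V) by (left; apply Rdiv_lt_0_compat; lra).
  assert (H4 : Rabs (rsum P (fun n => rsum Q (fun k => cut (lo_freq n) (hi_freq n) (INR k) * (sqrt 3 * p ^ 3 / INR k ^ 2 * (INR n * c2 n k)))) - M2)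
     <= 544 * harm Q + p ^ 2 * s * W + V * (1 + ln (2 * s ^ 3))).
  (* Exchanging [n] and [k] exposes, for each [k], an incomplete Gauss sum in [n]. *)
  { rewrite rsum_swap. eapply Rle_trans.
    - apply rsum_dist_le. intros k hk. rewrite (rsum_ext P _ (fun n => cut (lok k) (hik k) (INR n) * (sqrt 3 * p ^ 3 / INR k ^ 2 * (INR n * c2 n k)))).
      + apply second_b_process; lia.
      + intros n hn. rewrite middle_range by lia. reflexivity.
    - fold W V.
      rewrite (rsum_ext Q _ (fun k => 544 * / INR k + W * cut (eta / 2) (p ^ 2 * s) (INR k) + V * (cut (eta / 2) (p ^ 2 * s) (INR k) * / INR k))) by (intros; ring).
      rewrite !rsum_plus, !rsum_scal. fold (harm Q).
      assert (C1 := count_cut Q (eta / 2) (p ^ 2 * s) ltac:(lra)).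
      assert (C2 := sum_inv_cut_le Q (eta / 2) (p ^ 2 * s) ltac:(lra)).
      assert (Hle : eta / 2 <= p ^ 2 * s).
      { unfold eta, Rdiv. assert (/ s ^ 2 <= 1) by (rewrite <- Rinv_1; apply Rinv_le_contravar; [lra|apply pow_R1_Rle; lra]).
         nra. }
      specialize (C2 Hle). replace (p ^ 2 * s / (eta / 2)) with (2 * s ^ 3) in C2 by (unfold eta; field; split; lra).
      assert (D1 := Rmult_le_compat_l W _ _ HW C1). assert (D2 := Rmult_le_compat_l V _ _ HV C2). lra. }
  replace (p ^ 2 * s * W) with (4 * s ^ 3 * (40 * harm (P + 1) + 64)) in H4 by (unfold W, eta; field; split; lra).
  replace V with (128 * (p * s ^ 2)) in H4 by (unfold V, eta; field; split; lra).
  match type of H4 with Rabs (?M - _) <= _ => set (N := M) in * end.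

  apply Rabs_le_between in H1. apply Rabs_le_between in H2. apply Rabs_le_between in H3. apply Rabs_le_between in H4.
  apply Rabs_le. lra.
Qed.

Lemma eta_le : eta / 2 <= p ^ 2 * s.
Proof.
   assert (h1 : 1 <= s ^ 2) by (apply pow_R1_Rle; lra).
  assert (h2 : eta <= p ^ 2) by (apply div_le_iff; nra). nra.
Qed.

Lemma gap_bound b : b = hi_freq \/ b = lo_freq ->
  rsum P (fun n => rsum Q (fun k => gap b n k)) <=
  8 * p ^ 3 / eta * (1 + ln (2 * (INR Q / eta))) + INR Q * (4 / eta + 6 / eta * harm P).
Proof.
  assert (he := eta_le).
  intros [-> | ->]; apply endpoint_sum; auto using eta_pos; try lra.
  - apply hi_freq_low.
  - apply hi_freq_spaced.
  - apply lo_freq_props.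
  - apply lo_freq_spaced.
Qed.

End Core.

(** * Collecting the error terms *)

Lemma ln_le_sub1 x : 0 < x -> ln x <= x - 1.
Proof. intros hx. generalize (exp_ineq1_le (ln x)). rewrite exp_ln by auto. lra. Qed.

(** Writing [p^2 u^2 = u^6 (p / u^2)^2] lets a large [A] enter linearly through [p / u^2]. This is
    harmless: the harmonic sum is later multiplied by at most a constant times [u^3], and
    [u^3 * (p / u^2) = p u]. *)
Lemma harm_Q_bound c0 p u s Q :
  0 < c0 -> 0 < p -> 1 <= u -> 1 <= ln (u ^ 6) -> 0 < s <= 2 * u -> c0 <= p ^ 2 * u -> INR Q <= p ^ 2 * s + 1 ->
  harm Q <= (6 + / c0) * ln (u ^ 6) + 2 * (p / u ^ 2).
Proof.
  intros hc hp hu hL hs hcp hQ.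
  assert (hp2 : 0 < p ^ 2) by now apply pow_lt. assert (hu2 : 0 < u ^ 2) by (apply pow_lt; lra).
  assert (hci : 0 < / c0) by now apply Rinv_pos.
  assert (h1 : p ^ 2 * s + 1 <= (2 + / c0) * (p ^ 2 * u)).
  { assert (p ^ 2 * s <= p ^ 2 * (2 * u)) by (apply Rmult_le_compat_l; lra).
    assert (/ c0 * c0 <= / c0 * (p ^ 2 * u)) by (apply Rmult_le_compat_l; lra).
    rewrite Rinv_l in H0 by lra. lra. }
  assert (hb : 1 <= p ^ 2 * s + 1) by (assert (0 < p ^ 2 * s) by (apply Rmult_lt_0_compat; lra); lra).
  eapply Rle_trans; [apply (harm_le_ln Q (p ^ 2 * s + 1)); lra|].
  assert (h2 : ln (p ^ 2 * s + 1) <= ln (2 + / c0) + ln (u ^ 6) + 2 * ln (p / u ^ 2)).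
  { assert (hz : 0 < p / u ^ 2) by now apply Rdiv_lt_0_compat.
    replace (2 * ln (p / u ^ 2)) with (ln ((p / u ^ 2) * (p / u ^ 2))) by (rewrite ln_mult; lra).
    assert (hu6 : 0 < u ^ 6) by (apply pow_lt; lra).
    assert (hzz : 0 < p / u ^ 2 * (p / u ^ 2)) by now apply Rmult_lt_0_compat.
    rewrite <- !ln_mult; try lra; [|apply Rmult_lt_0_compat; lra].
    apply ln_le; [lra|]. apply Rle_trans with (1 := h1).
    replace ((2 + / c0) * u ^ 6 * (p / u ^ 2 * (p / u ^ 2))) with ((2 + / c0) * (p ^ 2 * u ^ 2)) by (field; lra).
    apply Rmult_le_compat_l; [lra|]. apply Rmult_le_compat_l; [lra|]. nra. }
  assert (h3 := ln_le_sub1 (2 + / c0) ltac:(lra)).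
  assert (h4 := ln_le_sub1 (p / u ^ 2) ltac:(now apply Rdiv_lt_0_compat)).
  nra.
Qed.

(** Every term of [core_estimate] is reduced to [U * L] or [Z * L] with [U = u^3], [Z = p u^2] and
    [L = ln (u^6)]. The dependence on [c0] is carried by [c1], and [u >= 3] makes [L >= 2], so
    additive constants are absorbed. *)
Lemma weightless_estimate c0 : 0 < c0 -> exists C, 0 < C /\
  forall p u s phi K, 0 < p -> 3 <= u -> u <= s -> s ^ 2 <= 2 * u ^ 2 -> c0 <= p ^ 2 * u ->
    s ^ 6 <= INR K -> p ^ 4 * s ^ 2 <= INR K -> p ^ 2 * s + 1 <= INR K ->
  Rabs (rsum K (fun k => INR (d k) * (cut (u ^ 6) (s ^ 6) (INR k) * cos (phi - 3 * PI * cbrt (p ^ 3 * INR k) ^ 2)))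
    - sqrt 3 / p ^ 6 * rsum K (fun k => INR (d k) * (cut (u ^ 6) (s ^ 6) (INR k ^ 3 / p ^ 12) * (INR k * cos (phi + PI * INR k ^ 2 / p ^ 6)))))
  <= C * ((p * u ^ 2 + u ^ 3) * ln (u ^ 6)).
Proof.
  intros hc. set (c1 := 6 + / c0).
  exists (200000 * (c1 * c1)).
  assert (hci : 0 < / c0) by now apply Rinv_pos.
  assert (hc1 : 6 <= c1) by (unfold c1; lra).
  split; [nra|].
  intros p u s phi K hp hu hus hsu hcp HYK HMK HQK.
  destruct (nfloor_ex (s ^ 3)) as [P HP]; [left; apply pow_lt; lra|].
  assert (hp2 : 0 < p ^ 2) by now apply pow_lt. assert (hp3 : 0 < p ^ 3) by now apply pow_lt.
  assert (hps : 0 < p ^ 2 * s) by (apply Rmult_lt_0_compat; lra).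
  destruct (nfloor_ex (p ^ 2 * s)) as [q Hq]; [lra|]. set (Q := S q).
  assert (HQ : p ^ 2 * s <= INR Q <= p ^ 2 * s + 1) by (unfold Q; rewrite S_INR; lra).
  assert (hs3 : 0 < s ^ 3) by (apply pow_lt; lra). assert (hs2 : 0 < s ^ 2) by (apply pow_lt; lra).
  assert (hu2 : 0 < u ^ 2) by (apply pow_lt; lra). assert (hu3 : 27 <= u ^ 3) by (replace 27 with (3 ^ 3) by ring; apply pow_incr; lra).
  assert (hs2u : s <= 2 * u) by (simpl in hsu; nra).
  assert (hs3u : s ^ 3 <= 3 * u ^ 3).
  { assert (h1 : 2 * s <= 3 * u) by (simpl in hsu; nra).
    replace (3 * u ^ 3) with (3 / 2 * u * (2 * u ^ 2)) by field.
    apply Rmult_le_compat; lra. }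
  assert (hs6 : s ^ 6 <= 9 * u ^ 6).
  { replace (s ^ 6) with (s ^ 3 * s ^ 3) by ring. replace (9 * u ^ 6) with (3 * u ^ 3 * (3 * u ^ 3)) by ring. apply Rmult_le_compat; lra. }
  assert (hs31 : 27 <= s ^ 3) by (replace 27 with (3 ^ 3) by ring; apply pow_incr; lra).
  assert (hu6 : 729 <= u ^ 6) by (replace 729 with (3 ^ 6) by ring; apply pow_incr; lra).
  assert (HPK : (P <= K)%nat).
  { apply INR_le. apply Rle_trans with (s ^ 6); auto. nra. }
  assert (HQK' : (Q <= K)%nat) by (apply INR_le; lra).
  set (L := ln (u ^ 6)).
  assert (hL : 2 <= L).
  { rewrite <- (ln_exp 2). apply ln_le; [apply exp_pos|].
    replace 2 with (1 + 1) by ring. rewrite exp_plus. assert (h := exp_le_3). assert (h0 := exp_pos 1). nra. }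
  assert (hln : forall x a, 0 < x -> x <= a * u ^ 6 -> 0 < a -> ln x <= a + L).
  { intros x a hx hxa ha. apply Rle_trans with (ln (a * u ^ 6)); [now apply ln_le|].
    rewrite ln_mult by lra. generalize (ln_le_sub1 a ha). unfold L; lra. }
  assert (hs36 : s ^ 3 <= s ^ 6) by (replace (s ^ 6) with (s ^ 3 * s ^ 3) by ring; nra).
  assert (hHP : harm P <= 6 * L).
  { eapply Rle_trans; [apply (harm_le_ln P (s ^ 3)); lra|]. generalize (hln (s ^ 3) 9 ltac:(lra) ltac:(lra) ltac:(lra)); lra. }
  assert (hHP1 : harm (P + 1) <= 7 * L).
  { eapply Rle_trans; [apply (harm_le_ln (P + 1) (s ^ 3 + 1)); [lra|rewrite plus_INR; simpl; lra]|].
    generalize (hln (s ^ 3 + 1) 10 ltac:(lra) ltac:(lra) ltac:(lra)); lra. }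
  assert (hl3 : 1 + ln (2 * s ^ 3) <= 11 * L).
  { generalize (hln (2 * s ^ 3) 18 ltac:(lra) ltac:(lra) ltac:(lra)); lra. }
  assert (hHQ : harm Q <= c1 * L + 2 * (p / u ^ 2)).
  { apply (harm_Q_bound c0 p u s Q); auto; fold L; lra. }
  assert (hHQ0 := harm_nonneg Q). assert (hHP0 := harm_nonneg P). assert (hP0 := pos_INR P).
  assert (Heta : 0 < p ^ 2 / s ^ 2) by now apply Rdiv_lt_0_compat.
  (* The lower bound on [p^2 u] gives [1 / p^2 <= u / c0], to be multiplied by [s^2 <= 2 u^2]. *)
  assert (Hetai : / (p ^ 2 / s ^ 2) <= 2 * c1 * u ^ 3).
  { replace (/ (p ^ 2 / s ^ 2)) with (s ^ 2 * / p ^ 2) by (field; lra).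
    assert (hpi : / p ^ 2 <= u * / c0).
    { apply Rmult_le_reg_l with (p ^ 2); auto. rewrite Rinv_r by lra.
      replace (p ^ 2 * (u * / c0)) with (p ^ 2 * u * / c0) by ring. rewrite <- (Rinv_r c0) by lra. apply Rmult_le_compat_r; lra. }
    assert (0 < / p ^ 2) by now apply Rinv_pos.
    apply Rle_trans with (2 * u ^ 2 * (u * / c0)); [apply Rmult_le_compat; lra|].
    replace (2 * u ^ 2 * (u * / c0)) with (2 * / c0 * u ^ 3) by ring. apply Rmult_le_compat_r; [lra|]. unfold c1; lra. }
  set (eta := p ^ 2 / s ^ 2) in *.
  assert (Hei0 : 0 < / eta) by now apply Rinv_pos.
  assert (Hp3e : p ^ 3 / eta = p * s ^ 2) by (unfold eta; field; lra).
  set (Z := p * u ^ 2). set (U := u ^ 3) in *.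
  assert (hZ : 0 < Z) by (unfold Z; nra).
  set (B := (Z + U) * L).
  assert (hUL : U * L <= B) by (unfold B; nra). assert (hZL : Z * L <= B) by (unfold B; nra).
  assert (hU1 : U <= B) by nra. assert (hZ1 : Z <= B) by nra.
  assert (hcB : forall x, x <= B -> c1 * x <= c1 * B) by (intros; apply Rmult_le_compat_l; lra).
  assert (hcB2 : B <= c1 * B) by nra. assert (hcB3 : c1 * B <= c1 * c1 * B) by nra.
  assert (hpU : p / u ^ 2 * U <= Z).
  { unfold U, Z. replace (p / u ^ 2 * u ^ 3) with (p * u) by (field; lra). nra. }
  assert (hPQ : INR P * harm Q <= 9 * (c1 * B)).
  { apply Rle_trans with (3 * U * (c1 * L + 2 * (p / u ^ 2))); [apply Rmult_le_compat; lra|].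
    assert (c1 * (U * L) <= c1 * B) by now apply hcB. lra. }
  assert (hQ1 : harm Q <= 3 * (c1 * B)).
  { assert (0 < p / u ^ 2) by now apply Rdiv_lt_0_compat.
    assert (p / u ^ 2 <= Z) by nra. assert (c1 * (U * L) <= c1 * B) by now apply hcB.
    assert (L <= U * L) by (rewrite <- (Rmult_1_l L) at 1; apply Rmult_le_compat_r; lra).
    assert (c1 * L <= c1 * (U * L)) by (apply Rmult_le_compat_l; lra). lra. }
  assert (hE1 : / eta * harm P <= 12 * (c1 * B)).
  { apply Rle_trans with (2 * c1 * U * (6 * L)); [apply Rmult_le_compat; lra|].
    assert (c1 * (U * L) <= c1 * B) by now apply hcB. lra. }
  assert (Hfinal : forall G, G <= 1000 * (c1 * c1 * B) ->
     200 * INR P * harm Q + 8 / eta * harm P + 128 * G + 1088 * harm Q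
     + 8 * s ^ 3 * (40 * harm (P + 1) + 64) + 256 * (p * s ^ 2) * (1 + ln (2 * s ^ 3)) + 3 * s ^ 3 <= 200000 * (c1 * c1) * B).
  { intros G hG.
    assert (T1 : s ^ 3 * (40 * harm (P + 1) + 64) <= 936 * (U * L)).
    { apply Rle_trans with (3 * U * (312 * L)); [|lra]. apply Rmult_le_compat; generalize (harm_nonneg (P + 1)); lra. }
    assert (T2 : p * s ^ 2 * (1 + ln (2 * s ^ 3)) <= 22 * (Z * L)).
    { apply Rle_trans with (p * (2 * u ^ 2) * (11 * L)); [|unfold Z; lra].
      apply Rmult_le_compat; try lra.
      - apply Rmult_le_pos; lra.
      - assert (0 <= ln (2 * s ^ 3)); [|lra]. rewrite <- ln_1. apply ln_le; lra.
      - apply Rmult_le_compat_l; lra. }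
    lra. }
  set (G := 8 * p ^ 3 / eta * (1 + ln (2 * (INR Q / eta))) + INR Q * (4 / eta + 6 / eta * harm P)).
  assert (T2 : INR Q / eta <= 3 * U + 2 * c1 * U).
  { apply Rle_trans with ((p ^ 2 * s + 1) * / eta); [apply Rmult_le_compat_r; lra|].
    rewrite Rmult_plus_distr_r, Rmult_1_l.
    replace (p ^ 2 * s * / eta) with (s ^ 3) by (unfold eta; field; lra). lra. }
  assert (hG : G <= 1000 * (c1 * c1 * B)).
  { unfold G. replace (8 * p ^ 3 / eta) with (8 * (p * s ^ 2)) by (rewrite <- Hp3e; unfold Rdiv; ring).
    assert (hQe : 0 < INR Q / eta) by (apply Rdiv_lt_0_compat; lra).
    assert (hlQ : 1 + ln (2 * (INR Q / eta)) <= 4 * (c1 * L)).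
    { assert (hx : 2 * (INR Q / eta) <= (6 + 4 * c1) * u ^ 6).
      { apply Rle_trans with ((6 + 4 * c1) * U); [lra|]. apply Rmult_le_compat_l; [lra|].
        replace (u ^ 6) with (U * U) by (unfold U; ring). rewrite <- (Rmult_1_l U) at 1. apply Rmult_le_compat_r; lra. }
      assert (hy := hln (2 * (INR Q / eta)) (6 + 4 * c1) ltac:(lra) hx ltac:(lra)).
      assert (c1 * 2 <= c1 * L) by (apply Rmult_le_compat_l; lra).
      assert (6 * L <= c1 * L) by (apply Rmult_le_compat_r; lra). lra. }
    assert (hps2 : 0 <= p * s ^ 2 <= 2 * Z).
    { split; [apply Rmult_le_pos; lra|]. replace (2 * Z) with (p * (2 * u ^ 2)) by (unfold Z; ring). apply Rmult_le_compat_l; lra. }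
    assert (T1 : p * s ^ 2 * (1 + ln (2 * (INR Q / eta))) <= 2 * Z * (4 * (c1 * L))).
    { apply Rle_trans with (p * s ^ 2 * (4 * (c1 * L))); [apply Rmult_le_compat_l; lra|]. apply Rmult_le_compat_r; [|lra].
      apply Rmult_le_pos; [lra|apply Rmult_le_pos; lra]. }
    assert (T3 : INR Q * (4 / eta + 6 / eta * harm P) <= (3 * U + 2 * c1 * U) * (40 * L)).
    { replace (INR Q * (4 / eta + 6 / eta * harm P)) with (INR Q / eta * (4 + 6 * harm P)) by (unfold Rdiv; ring).
      apply Rmult_le_compat; [lra|clear - hHP0; lra|exact T2|clear - hHP hL; lra]. }
    assert (c1 * (U * L) <= c1 * B) by now apply hcB. assert (c1 * (Z * L) <= c1 * B) by now apply hcB. lra. }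
  eapply Rle_trans; [|apply (Hfinal G hG)].
  assert (h1 : 1 <= u) by lra.
  apply (core_estimate p u s phi P Q K); auto; apply (gap_bound p u s P Q K); auto.
Qed.

(** * From complex sums to real cosine sums *)

Lemma sum_n_m_parts (f : nat -> C) n :
  fst (sum_n_m f 1 n) = rsum n (fun k => fst (f k)) /\ snd (sum_n_m f 1 n) = rsum n (fun k => snd (f k)).
Proof.
  induction n as [|n [IH1 IH2]]; [rewrite sum_n_m_zero by lia; now split|].
  rewrite sum_n_Sm by lia. cbn [rsum]. now rewrite <- IH1, <- IH2.
Qed.

(** Terms past [b] vanish, so any index beyond [b] can replace [up b]; one common [K] then serves
    the sum and its dual. *)
Lemma rsum_upto_cut a b K (F : nat -> R) : b <= INR K ->
  rsum (Z.to_nat (up b)) (fun k => cut a b (INR k) * F k) = rsum K (fun k => cut a b (INR k) * F k).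
Proof.
  intros hK. destruct (archimed b) as [h1 h2].
  assert (hz : forall k, (Z.to_nat (up b) < k)%nat -> cut a b (INR k) * F k = 0).
  { intros k hk. rewrite cut_out; [ring|right]. apply Rlt_le_trans with (IZR (up b)); [lra|].
    rewrite INR_IZR_INZ. apply IZR_le. lia. }
  assert (hz2 : forall k, (K < k)%nat -> cut a b (INR k) * F k = 0).
  { intros k hk. rewrite cut_out; [ring|right]. apply lt_INR in hk. lra. }
  destruct (Nat.le_ge_cases (Z.to_nat (up b)) K).
  - symmetry. apply rsum_widen; auto. intros; apply hz; lia.
  - apply rsum_widen; auto. intros; apply hz2; lia.
Qed.

Lemma sum_between_parts a b K f : b <= INR K ->
  fst (sum_between a b f) = rsum K (fun k => cut a b (INR k) * fst (f k)) /\
  snd (sum_between a b f) = rsum K (fun k => cut a b (INR k) * snd (f k)).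
Proof.
  intros hK. unfold sum_between. rewrite (proj1 (sum_n_m_parts _ _)), (proj2 (sum_n_m_parts _ _)).
  split; rewrite <- (rsum_upto_cut a b K) by auto; apply rsum_ext; intros k _; unfold cut; (destruct Rle_dec; [destruct Rle_dec|]); simpl; ring.
Qed.

Lemma Cmod_le_parts (z : C) E : Rabs (fst z) <= E -> Rabs (snd z) <= E -> Cmod z <= 2 * E.
Proof.
  intros h1 h2. assert (hE : 0 <= E) by (apply Rle_trans with (2 := h1), Rabs_pos).
  rewrite <- (sqrt_square (2 * E)) by lra. apply sqrt_le_1_alt.
  apply Rabs_le_between in h1. apply Rabs_le_between in h2. nra.
Qed.

(** * The weighted sums: comparison and trivial bounds *)

Definition weighted_sum (p u phi : R) (K : nat) : R :=
  rsum K (fun k => cut (u ^ 6) (2 * sqrt 2 * u ^ 6) (INR k) *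
    (INR (d k) / Rpower (INR k) (1 / 6) * cos (phi - 3 * PI * cbrt (p ^ 3 * INR k) ^ 2))).

Definition dual_sum (p u phi : R) (K : nat) : R :=
  rsum K (fun k => cut (p ^ 4 * u ^ 2) (sqrt 2 * (p ^ 4 * u ^ 2)) (INR k) *
    (INR (d k) * Rpower (INR k) (1 / 2) * cos (phi + PI * (INR k / p ^ 3) ^ 2))).

Lemma Rpower_nat_root z n : 0 < z -> (1 <= n)%nat -> Rpower (z ^ n) (1 / INR n) = z.
Proof.
  intros hz hn. apply INR_ge1 in hn. rewrite <- Rpower_pow by auto. rewrite Rpower_mult.
  replace (INR n * (1 / INR n)) with 1 by (field; lra). now apply Rpower_1.
Qed.

Lemma sqrt2_bounds : 1 < sqrt 2 < 3 / 2.
Proof.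
  assert (h : sqrt 2 * sqrt 2 = 2) by (apply sqrt_sqrt; lra). assert (h0 := sqrt_pos 2).
  split; nra.
Qed.

(** Partial summation with [g x = x^(-1/6)], decreasing and at most [1 / u] on the range, turns the
    error [p u^2 + u^3] into [p u + u^2]. *)
Lemma weighted_estimate c0 : 0 < c0 -> exists C, 0 < C /\
  forall p u phi K, 0 < p -> 3 <= u -> c0 <= p ^ 2 * u ->
    2 * sqrt 2 * u ^ 6 <= INR K -> 2 * (p ^ 4 * u ^ 2) <= INR K -> 2 * (p ^ 2 * u) + 1 <= INR K ->
  Rabs (weighted_sum p u phi K - sqrt 3 / p ^ 4 * dual_sum p u phi K)
  <= C * ((p * u + u ^ 2) * ln (u ^ 6)).
Proof.
  intros hc. destruct (weightless_estimate c0 hc) as (C & hC & HC).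
  exists (2 * C). split; [lra|]. intros p u phi K hp hu hcp hK1 hK2 hK3.
  assert (hr2 := sqrt2_bounds). assert (hrr : sqrt 2 * sqrt 2 = 2) by (apply sqrt_sqrt; lra).
  assert (hu2 : 0 < u ^ 2) by (apply pow_lt; lra). assert (hu6 : 0 < u ^ 6) by (apply pow_lt; lra).
  assert (hp2 : 0 < p ^ 2) by now apply pow_lt.
  assert (hp4 : 0 < p ^ 4) by now apply pow_lt.
  assert (hp12 : 0 < p ^ 12) by now apply pow_lt.
  set (g := fun x => / Rpower x (1 / 6)).
  set (w1 := fun k => INR (d k) * cos (phi - 3 * PI * cbrt (p ^ 3 * INR k) ^ 2)).
  set (w2 := fun k => sqrt 3 / p ^ 6 * (INR (d k) * (INR k * cos (phi + PI * INR k ^ 2 / p ^ 6)))).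
  set (b := 2 * sqrt 2 * u ^ 6).
  assert (hab : u ^ 6 <= b) by (unfold b; nra).
  assert (Hg : forall x, 0 < x -> is_derive g x (- (/ (6 * x * Rpower x (1 / 6))))).
  { intros x hx. assert (hR := exp_pos (1 / 6 * ln x)). fold (Rpower x (1 / 6)) in hR.
    assert (hd : is_derive (fun y => Rpower y (1 / 6)) x (1 / 6 * Rpower x (1 / 6 - 1))).
    { apply is_derive_Reals. now apply derivable_pt_lim_power. }
    assert (hE : Rpower x (1 / 6 - 1) = Rpower x (1 / 6) / x).
    { unfold Rminus. rewrite Rpower_plus, Rpower_Ropp, Rpower_1 by auto. reflexivity. }
    rewrite hE in hd. evar_last; [apply (is_derive_inv (fun y => Rpower y (1 / 6)) x _ hd); lra|].
    cbv beta. set (r := Rpower x (1 / 6)) in *.  field. lra. }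
  assert (HA := abel_compare g (fun x => - (/ (6 * x * Rpower x (1 / 6)))) (u ^ 6) b K K INR w1
     (fun k => INR k ^ 3 / p ^ 12) w2 (C * ((p * u ^ 2 + u ^ 3) * ln (u ^ 6))) hab).
  assert (HA' : Rabs (rsum K (fun k => cut (u ^ 6) b (INR k) * (g (INR k) * w1 k)) -
      rsum K (fun k => cut (u ^ 6) b (INR k ^ 3 / p ^ 12) * (g (INR k ^ 3 / p ^ 12) * w2 k)))
      <= C * ((p * u ^ 2 + u ^ 3) * ln (u ^ 6)) * (Rabs (g b) + Rabs (g b - g (u ^ 6)))).
  { apply HA.
    - intros x hx. apply Hg; lra.
    - intros x hx. assert (hR := exp_pos (1 / 6 * ln x)). fold (Rpower x (1 / 6)) in hR.
      apply ex_derive_cont. unfold Rpower in *. auto_derive.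
      split; [lra|split; auto]. assert (0 < 6 * x * exp (1 / 6 * ln x)) by (apply Rmult_lt_0_compat; lra). lra.
    - right. intros x hx. assert (hR := exp_pos (1 / 6 * ln x)). fold (Rpower x (1 / 6)) in hR.
      assert (0 < / (6 * x * Rpower x (1 / 6))); [|lra]. apply Rinv_pos, Rmult_lt_0_compat; lra.
    (* At truncation [x] the unweighted estimate is used with [s = x^(1/6)]; the upper end
       [2 sqrt 2 u^6] guarantees [s^2 <= 2 u^2]. *)
    - intros x hx. set (s := Rpower x (1 / 6)).
      assert (hs6 : s ^ 6 = x).
      { unfold s. rewrite <- Rpower_pow by apply exp_pos. rewrite Rpower_mult.
        replace (1 / 6 * INR 6) with 1 by (simpl; field). apply Rpower_1; lra. }
      assert (hus : u <= s).
      { rewrite <- (Rpower_nat_root u 6) by (lra || lia). replace (INR 6) with 6 by (simpl; ring).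
        apply Rle_Rpower_l; lra. }
      assert (hsu : s ^ 2 <= 2 * u ^ 2).
      { apply (cube_le_iff (s ^ 2)); try (left; apply pow_lt; lra); [lra|].
        replace ((s ^ 2) ^ 3) with (s ^ 6) by ring. rewrite hs6.
        apply Rle_trans with b; [lra|]. unfold b. nra. }
      assert (hs2u : s <= 2 * u) by (simpl in hsu; nra).
      specialize (HC p u s phi K hp hu hus hsu hcp).
      rewrite hs6 in HC.
      eapply Rle_trans; [|apply HC].
      + right. f_equal. apply (f_equal2 Rminus).
        * apply rsum_ext. intros k _. unfold w1. ring.
        * rewrite <- rsum_scal. apply rsum_ext. intros k _. unfold w2. ring.
      + apply Rle_trans with b; [lra|exact hK1].
      + apply Rle_trans with (2 := hK2). replace (2 * (p ^ 4 * u ^ 2)) with (p ^ 4 * (2 * u ^ 2)) by ring.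
        apply Rmult_le_compat_l; lra.
      + apply Rle_trans with (2 := hK3). replace (2 * (p ^ 2 * u)) with (p ^ 2 * (2 * u)) by ring.
        apply Rplus_le_compat_r, Rmult_le_compat_l; lra. }
  clear HA.
  assert (E1 : rsum K (fun k => cut (u ^ 6) b (INR k) * (g (INR k) * w1 k)) = weighted_sum p u phi K).
  { apply rsum_ext. intros k _. unfold g, w1, Rdiv. fold b. ring. }
  assert (E2 : rsum K (fun k => cut (u ^ 6) b (INR k ^ 3 / p ^ 12) * (g (INR k ^ 3 / p ^ 12) * w2 k)) = sqrt 3 / p ^ 4 * dual_sum p u phi K).
  { unfold dual_sum. rewrite <- rsum_scal. apply rsum_ext. intros k hk.
    assert (hk1 : 1 <= INR k) by (apply INR_ge1; lia).
    (* Since [(sqrt 2)^3 = 2 sqrt 2], taking cube roots gives exactly the dual range of the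
       theorem. *)
    assert (Ec : cut (u ^ 6) b (INR k ^ 3 / p ^ 12) = cut (p ^ 4 * u ^ 2) (sqrt 2 * (p ^ 4 * u ^ 2)) (INR k)).
    { assert (hr3 : sqrt 2 ^ 3 = 2 * sqrt 2) by (replace (sqrt 2 ^ 3) with (sqrt 2 * sqrt 2 * sqrt 2) by ring; rewrite hrr; ring).
      apply cut_iff. unfold b. rewrite le_div_iff, div_le_iff by auto.
      replace (u ^ 6 * p ^ 12) with ((p ^ 4 * u ^ 2) ^ 3) by ring.
      replace (2 * sqrt 2 * u ^ 6 * p ^ 12) with ((sqrt 2 * (p ^ 4 * u ^ 2)) ^ 3) by (rewrite Rpow_mult_distr, hr3; ring).
      assert (0 < p ^ 4 * u ^ 2) by now apply Rmult_lt_0_compat.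
      rewrite !cube_le_iff; try lra; try tauto. apply Rmult_le_pos; lra. }
    rewrite Ec.
    (* With [k = z^2] the dual point [k^3 / p^12] is [(z / p^2)^6]. Its weight [p^2 / z] reduces
       [k / p^6] to [k^(1/2) / p^4]. *)
    assert (Eg : g (INR k ^ 3 / p ^ 12) = p ^ 2 / Rpower (INR k) (1 / 2)).
    { unfold g. set (z := Rpower (INR k) (1 / 2)). assert (hz : 0 < z) by apply exp_pos.
      assert (hz2 : z ^ 2 = INR k).
      { unfold z. rewrite <- Rpower_pow by apply exp_pos. rewrite Rpower_mult.
        replace (1 / 2 * INR 2) with 1 by (simpl; field). apply Rpower_1; lra. }
      replace (INR k ^ 3 / p ^ 12) with ((z / p ^ 2) ^ 6) by (rewrite <- hz2; field; lra).
      replace 6 with (INR 6) by (simpl; ring). rewrite Rpower_nat_root; [field; lra|now apply Rdiv_lt_0_compat|lia]. }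
    rewrite Eg. unfold w2.
    set (z := Rpower (INR k) (1 / 2)). assert (hz : 0 < z) by apply exp_pos.
    assert (hz2 : z * z = INR k).
    { unfold z. rewrite <- Rpower_plus. replace (1 / 2 + 1 / 2) with 1 by field. apply Rpower_1; lra. }
    replace (phi + PI * (INR k / p ^ 3) ^ 2) with (phi + PI * INR k ^ 2 / p ^ 6) by (field; lra).
    set (co := cos _). rewrite <- hz2 at 2. field. lra. }
  rewrite E1, E2 in HA'. eapply Rle_trans; [exact HA'|].
  assert (hgb : 0 < g b <= g (u ^ 6)).
  { split; [apply Rinv_pos, exp_pos|]. apply Rinv_le_contravar; [apply exp_pos|]. apply Rle_Rpower_l; lra. }
  assert (hga : g (u ^ 6) = / u).
  { unfold g. replace 6 with (INR 6) by (simpl; ring). rewrite Rpower_nat_root; auto; [lra|lia]. }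
  rewrite hga in *. rewrite (Rabs_right (g b)), (Rabs_left1 (g b - / u)) by lra.
  replace (2 * C * ((p * u + u ^ 2) * ln (u ^ 6))) with (C * ((p * u ^ 2 + u ^ 3) * ln (u ^ 6)) * (2 * / u)) by (field; lra).
  assert (hln : 0 <= ln (u ^ 6)).
  { rewrite <- ln_1. apply ln_le; [lra|]. apply pow_R1_Rle; lra. }
  assert (hu3 : 0 < u ^ 3) by (apply pow_lt; lra).
  assert (0 < p * u ^ 2) by now apply Rmult_lt_0_compat.
  apply Rmult_le_compat_l; [|lra].
  apply Rmult_le_pos; [lra|]. apply Rmult_le_pos; lra.
Qed.

(** Absolute values and the mean order of [d]; this settles the upper bound when [p > u], where the
    dual sum is the longer one. *)
Lemma weighted_sum_bound p u phi K : 1 <= u ->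
  Rabs (weighted_sum p u phi K) <= 3 * u ^ 5 * (3 + ln (u ^ 6)).
Proof.
  intros hu. assert (hr2 := sqrt2_bounds). assert (hu6 : 1 <= u ^ 6) by (apply pow_R1_Rle; lra).
  apply Rle_trans with (/ u * rsum K (fun k => cut 0 (3 * u ^ 6) (INR k) * INR (d k))).
  - rewrite <- rsum_scal. apply rsum_abs_le. intros k hk.
    assert (hd := pos_INR (d k)). assert (hui : 0 < / u) by (apply Rinv_pos; lra).
    destruct (cut_cases (u ^ 6) (2 * sqrt 2 * u ^ 6) (INR k)) as [[h ->]|[_ ->]].
    + rewrite (cut_in 0) by nra. rewrite !Rmult_1_l, Rabs_mult.
      assert (hR : u <= Rpower (INR k) (1 / 6)).
      { rewrite <- (Rpower_nat_root u 6) by (lra || lia). replace (INR 6) with 6 by (simpl; ring). apply Rle_Rpower_l; lra. }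
      assert (hRi : / Rpower (INR k) (1 / 6) <= / u) by (apply Rinv_le_contravar; lra).
      assert (hRp : 0 < / Rpower (INR k) (1 / 6)) by (apply Rinv_pos, exp_pos).
      rewrite Rabs_right by (apply Rle_ge, Rmult_le_pos; lra).
      assert (hc : Rabs (cos (phi - 3 * PI * cbrt (p ^ 3 * INR k) ^ 2)) <= 1) by apply Rabs_le, COS_bound.
      rewrite (Rmult_comm (/ u)). rewrite <- (Rmult_1_r (INR (d k) * / u)).
      apply Rmult_le_compat; auto using Rabs_pos.
      * apply Rmult_le_pos; lra.
      * apply Rmult_le_compat_l; lra.
    + rewrite Rmult_0_l, Rabs_R0. apply Rmult_le_pos; [lra|]. apply Rmult_le_pos; [apply cut_bound|auto].
  - assert (H := sum_d_le K (3 * u ^ 6) ltac:(lra)). rewrite ln_mult in H by lra.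
    assert (hl := ln_le_sub1 3 ltac:(lra)).
    apply Rle_trans with (/ u * (3 * u ^ 6 * (3 + ln (u ^ 6)))).
    + apply Rmult_le_compat_l; [left; apply Rinv_pos; lra|]. eapply Rle_trans; [exact H|].
      apply Rmult_le_compat_l; lra.
    + right. field. lra.
Qed.

(** The trivial bound again. The condition [p <= u] gives [p^4 u^2 <= u^6], so the logarithm
    produced by the divisor sum is that of [u^6] up to a constant. *)
Lemma dual_sum_bound p u phi K : 0 < p <= u -> 1 <= u ->
  Rabs (sqrt 3 / p ^ 4 * dual_sum p u phi K) <= 8 * (p ^ 2 * u ^ 3) * (2 + ln (u ^ 6)).
Proof.
  intros hp hu. assert (hr2 := sqrt2_bounds). assert (hr3 := sqrt3_bounds).
  assert (hp4 : 0 < p ^ 4) by (apply pow_lt; lra). assert (hp2 : 0 < p ^ 2) by (apply pow_lt; lra).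
  assert (hu2 : 0 < u ^ 2) by (apply pow_lt; lra). assert (hu3 : 0 < u ^ 3) by (apply pow_lt; lra).
  assert (hu6 : 1 <= u ^ 6) by (apply pow_R1_Rle; lra).
  assert (hl0 : 0 <= ln (u ^ 6)) by (rewrite <- ln_1; apply ln_le; lra).
  set (M := p ^ 4 * u ^ 2). assert (hM : 0 < M) by now apply Rmult_lt_0_compat.
  assert (hpu : 0 < p ^ 2 * u) by (apply Rmult_lt_0_compat; lra).
  assert (H : Rabs (dual_sum p u phi K) <= 2 * (p ^ 2 * u) * rsum K (fun k => cut 0 (2 * M) (INR k) * INR (d k))).
  { rewrite <- rsum_scal. apply rsum_abs_le. intros k hk. fold M.
    assert (hd := pos_INR (d k)).
    destruct (cut_cases M (sqrt 2 * M) (INR k)) as [[h ->]|[_ ->]].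
    - assert (hkM : INR k <= 2 * M) by nra. rewrite (cut_in 0) by lra. rewrite !Rmult_1_l, Rabs_mult.
      assert (hR : Rpower (INR k) (1 / 2) <= 2 * (p ^ 2 * u)).
      { rewrite <- (Rpower_nat_root (2 * (p ^ 2 * u)) 2) by (lra || lia). replace (INR 2) with 2 by (simpl; ring).
        apply Rle_Rpower_l; [lra|]. split; [lra|].
        replace ((2 * (p ^ 2 * u)) ^ 2) with (4 * M) by (unfold M; ring). lra. }
      assert (hRp : 0 < Rpower (INR k) (1 / 2)) by apply exp_pos.
      rewrite Rabs_right by (apply Rle_ge, Rmult_le_pos; lra).
      assert (hc : Rabs (cos (phi + PI * (INR k / p ^ 3) ^ 2)) <= 1) by apply Rabs_le, COS_bound.
      rewrite (Rmult_comm (2 * (p ^ 2 * u))). rewrite <- (Rmult_1_r (INR (d k) * (2 * (p ^ 2 * u)))).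
      apply Rmult_le_compat; auto using Rabs_pos.
      + apply Rmult_le_pos; lra.
      + apply Rmult_le_compat_l; lra.
    - rewrite Rmult_0_l, Rabs_R0. apply Rmult_le_pos; [lra|]. apply Rmult_le_pos; [apply cut_bound|auto]. }
  assert (HD : rsum K (fun k => cut 0 (2 * M) (INR k) * INR (d k)) <= 2 * M * (2 + ln (u ^ 6))).
  (* [sum_d_le] wants an upper end at least 1; below that, the range contains no positive
     integer. *)
  { destruct (Rle_dec 1 (2 * M)) as [h|h].
    - eapply Rle_trans; [apply sum_d_le; auto|]. apply Rmult_le_compat_l; [lra|].
      assert (hMu : M <= u ^ 6).
      { replace (u ^ 6) with (u ^ 4 * u ^ 2) by ring. apply Rmult_le_compat_r; [lra|]. apply pow_incr; lra. }
      assert (ln (2 * M) <= ln (2 * u ^ 6)) by (apply ln_le; lra). rewrite (ln_mult 2 (u ^ 6)) in H0 by lra.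
      assert (hl := ln_le_sub1 2 ltac:(lra)). lra.
    - rewrite rsum_zero.
      + apply Rmult_le_pos; lra.
      + intros k hk. assert (1 <= INR k) by (apply INR_ge1; lia). rewrite cut_out by lra. ring. }
  assert (hc : 0 < sqrt 3 / p ^ 4) by (apply Rdiv_lt_0_compat; lra).
  rewrite Rabs_mult, (Rabs_right (sqrt 3 / p ^ 4)) by lra.
  apply Rle_trans with (sqrt 3 / p ^ 4 * (2 * (p ^ 2 * u) * (2 * M * (2 + ln (u ^ 6))))).
  { apply Rmult_le_compat_l; [lra|]. eapply Rle_trans; [exact H|]. apply Rmult_le_compat_l; lra. }
  replace (sqrt 3 / p ^ 4 * (2 * (p ^ 2 * u) * (2 * M * (2 + ln (u ^ 6))))) with (sqrt 3 * (4 * (p ^ 2 * u ^ 3 * (2 + ln (u ^ 6))))).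
  2:{ unfold M. field. lra. }
  assert (0 <= p ^ 2 * u ^ 3 * (2 + ln (u ^ 6))) by (apply Rmult_le_pos; [apply Rmult_le_pos|]; lra).
  nra.
Qed.

Definition source (N A : R) : C :=
  sum_between N (2 * sqrt 2 * N)
    (fun k => (RtoC (INR (d k) / Rpower (INR k) (1 / 6)) * cis (3 * PI * Rpower (A * INR k) (2 / 3)))%C).

Definition target (N A : R) : C :=
  (RtoC (sqrt 3 * Rpower A (- (4 / 3)))
   * sum_between (Rpower A (4 / 3) * Rpower N (1 / 3)) (sqrt 2 * (Rpower A (4 / 3) * Rpower N (1 / 3)))
       (fun k => (RtoC (INR (d k) * Rpower (INR k) (1 / 2)) * cis (- (PI * (INR k / A) ^ 2)))%C))%C.

Lemma Rpower_split x y z n : y = z * INR n -> Rpower x y = Rpower x z ^ n.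
Proof. intros ->. rewrite <- Rpower_mult. apply Rpower_pow, exp_pos. Qed.

Section Translation.

Variables (N A : R) (K : nat).
Let p := Rpower A (1 / 3).
Let u := Rpower N (1 / 6).
Hypothesis HN : 0 < N.
Hypothesis HA : 0 < A.

Lemma N_pow : N = u ^ 6.
Proof. unfold u. rewrite <- (Rpower_split N 1) by (simpl; field). now rewrite Rpower_1. Qed.

Lemma A_pow : A = p ^ 3.
Proof. unfold p. rewrite <- (Rpower_split A 1) by (simpl; field). now rewrite Rpower_1. Qed.

Lemma source_parts : 2 * sqrt 2 * u ^ 6 <= INR K ->
  fst (source N A) = weighted_sum p u 0 K /\ snd (source N A) = weighted_sum p u (PI / 2) K.
Proof.
  intros hK. unfold source. rewrite <- N_pow in hK.
  rewrite (proj1 (sum_between_parts N _ K _ hK)), (proj2 (sum_between_parts N _ K _ hK)).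
  unfold weighted_sum. rewrite <- N_pow, <- A_pow.
  assert (Hc : forall k, Rpower (A * INR k) (2 / 3) = cbrt (A * INR k) ^ 2).
  { intros k. apply Rpower_split. simpl. field. }
  split; apply rsum_ext; intros k _; rewrite Hc; f_equal; cbn [fst snd RtoC Cmult cis].
  - replace (0 - 3 * PI * cbrt (A * INR k) ^ 2) with (- (3 * PI * cbrt (A * INR k) ^ 2)) by ring. rewrite cos_neg. ring.
  - rewrite cos_shift. ring.
Qed.

Lemma target_parts : 2 * (p ^ 4 * u ^ 2) <= INR K ->
  fst (target N A) = sqrt 3 / p ^ 4 * dual_sum p u 0 K /\ snd (target N A) = sqrt 3 / p ^ 4 * dual_sum p u (PI / 2) K.
Proof.
  intros hK. unfold target. assert (hr2 := sqrt2_bounds).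
  assert (Ep : Rpower A (4 / 3) = p ^ 4) by (apply Rpower_split; simpl; field).
  assert (Eu : Rpower N (1 / 3) = u ^ 2) by (apply Rpower_split; simpl; field).
  rewrite Rpower_Ropp, Ep, Eu.
  assert (hK' : sqrt 2 * (p ^ 4 * u ^ 2) <= INR K) by nra.
  set (S := sum_between _ _ _).
  assert (E1 : fst S = dual_sum p u 0 K).
  { unfold S. rewrite (proj1 (sum_between_parts _ _ K _ hK')). unfold dual_sum. rewrite <- A_pow.
    apply rsum_ext; intros k _. f_equal. cbn [fst snd RtoC Cmult cis]. rewrite cos_neg, Rplus_0_l. ring. }
  assert (E2 : snd S = dual_sum p u (PI / 2) K).
  { unfold S. rewrite (proj2 (sum_between_parts _ _ K _ hK')). unfold dual_sum. rewrite <- A_pow.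
    apply rsum_ext; intros k _. f_equal. cbn [fst snd RtoC Cmult cis].
    replace (PI / 2 + PI * (INR k / A) ^ 2) with (PI / 2 - - (PI * (INR k / A) ^ 2)) by ring. rewrite cos_shift. ring. }
  split; cbn [fst snd RtoC Cmult]; rewrite E1, E2; unfold Rdiv; ring.
Qed.

End Translation.

Lemma big_index p u : exists K, 2 * sqrt 2 * u ^ 6 <= INR K /\ 2 * (p ^ 4 * u ^ 2) <= INR K /\ 2 * (p ^ 2 * u) + 1 <= INR K.
Proof.
  set (z := Rmax (2 * sqrt 2 * u ^ 6) (Rmax (2 * (p ^ 4 * u ^ 2)) (2 * (p ^ 2 * u) + 1))).
  destruct (nfloor_ex (Rmax 0 z)) as [n Hn]; [apply Rmax_l|].
  exists (S n). rewrite S_INR.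
  assert (h0 : z <= Rmax 0 z) by apply Rmax_r.
  assert (h1 : 2 * sqrt 2 * u ^ 6 <= z) by apply Rmax_l.
  assert (h2 : 2 * (p ^ 4 * u ^ 2) <= z) by (eapply Rle_trans; [apply Rmax_l|apply Rmax_r]).
  assert (h3 : 2 * (p ^ 2 * u) + 1 <= z) by (eapply Rle_trans; [apply Rmax_r|apply Rmax_r]).
  lra.
Qed.

(** The condition on [A] raised to the power 2/3, which is where [c0 = c^(2/3)] comes from. *)
Lemma ratio_lower c N A : 0 < c -> 0 < N -> c * Rpower N (- (1 / 4)) <= A ->
  Rpower c (2 / 3) <= Rpower A (1 / 3) ^ 2 * Rpower N (1 / 6).
Proof.
  intros hc hN hA. assert (h1 := exp_pos (- (1 / 4) * ln N)). fold (Rpower N (- (1 / 4))) in h1.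
  rewrite <- (Rpower_split A (2 / 3)) by (simpl; field).
  assert (h2 : Rpower (c * Rpower N (- (1 / 4))) (2 / 3) <= Rpower A (2 / 3)).
  { apply Rle_Rpower_l; [lra|]. split; auto. now apply Rmult_lt_0_compat. }
  rewrite Rpower_mult_distr in h2 || rewrite <- Rpower_mult_distr in h2 by auto.
  rewrite Rpower_mult in h2. replace (- (1 / 4) * (2 / 3)) with (- (1 / 6)) in h2 by field.
  assert (h3 := exp_pos (1 / 6 * ln N)). fold (Rpower N (1 / 6)) in h3.
  rewrite Rpower_Ropp in h2.
  apply Rle_trans with (Rpower c (2 / 3) * / Rpower N (1 / 6) * Rpower N (1 / 6)); [right; field; lra|].
  apply Rmult_le_compat_r; lra.
Qed.

Lemma comparison c : 0 < c -> exists C, 0 < C /\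
  forall N A, 729 <= N -> 0 < A -> c * Rpower N (- (1 / 4)) <= A ->
  Cmod (source N A - target N A) <=
    C * ((Rpower A (1 / 3) * Rpower N (1 / 6) + Rpower N (1 / 6) ^ 2) * ln N).
Proof.
  intros hc. destruct (weighted_estimate (Rpower c (2 / 3)) (exp_pos _)) as (C & hC & H).
  exists (2 * C). split; [lra|]. intros N A hN hA hcA.
  set (p := Rpower A (1 / 3)). set (u := Rpower N (1 / 6)).
  assert (hp : 0 < p) by apply exp_pos.
  (* [729 = 3^6]. *)
  assert (hu : 3 <= u).
  { rewrite <- (Rpower_nat_root 3 6) by (lra || lia). replace (INR 6) with 6 by (simpl; ring).
    apply Rle_Rpower_l; lra. }
  assert (hr := ratio_lower c N A hc ltac:(lra) hcA). fold p u in hr.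
  destruct (big_index p u) as (K & hK1 & hK2 & hK3).
  destruct (source_parts N A K ltac:(lra) hA hK1) as [s1 s2].
  destruct (target_parts N A K hA hK2) as [t1 t2].
  assert (hNu : N = u ^ 6) by (apply N_pow; lra).
  rewrite hNu at 3. rewrite Rmult_assoc. apply Cmod_le_parts.
  - replace (fst (source N A - target N A)%C) with (fst (source N A) - fst (target N A)) by reflexivity.
    rewrite s1, t1. now apply H.
  - replace (snd (source N A - target N A)%C) with (snd (source N A) - snd (target N A)) by reflexivity.
    rewrite s2, t2. now apply H.
Qed.

Theorem theorem2 (c : R) (hc : 0 < c) :
  (forall eps : R, 0 < eps ->
    exists K N0 : R, 0 < K /\ 0 < N0 /\
    forall N A : R, N0 <= N -> 0 < A -> c * Rpower N (- (1 / 4)) <= A ->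
      Cmod
        (sum_between N (2 * sqrt 2 * N)
           (fun k => (RtoC (INR (d k) / Rpower (INR k) (1 / 6))
                      * cis (3 * PI * Rpower (A * INR k) (2 / 3)))%C)
         - RtoC (sqrt 3 * Rpower A (- (4 / 3)))
           * sum_between (Rpower A (4 / 3) * Rpower N (1 / 3))
                         (sqrt 2 * (Rpower A (4 / 3) * Rpower N (1 / 3)))
               (fun k => (RtoC (INR (d k) * Rpower (INR k) (1 / 2))
                          * cis (- (PI * (INR k / A) ^ 2)))%C))%C
      <= K * (Rpower A (- (1 / 3)) * Rpower N (1 / 2 + eps))
         + K * (Rpower A (1 / 3) * Rpower N (1 / 6) * ln N)
         + K * (Rpower A (- (1 / 9)) * Rpower N (2 / 9 + eps)))
  /\
  (exists K N0 : R, 0 < K /\ 0 < N0 /\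
    forall N A : R, N0 <= N -> 0 < A -> c * Rpower N (- (1 / 4)) <= A ->
      Cmod
        (sum_between N (2 * sqrt 2 * N)
           (fun k => (RtoC (INR (d k) / Rpower (INR k) (1 / 6))
                      * cis (3 * PI * Rpower (A * INR k) (2 / 3)))%C))
      <= K * (Rpower A (2 / 3) * Rpower N (1 / 2) * ln N)).
Proof.
  destruct (comparison c hc) as (C & hC & HC).
  assert (hlnN : forall N, 729 <= N -> 2 <= ln N).
  { intros N hN. rewrite <- (ln_exp 2). apply ln_le; [apply exp_pos|].
    replace 2 with (1 + 1) by ring. rewrite exp_plus. assert (h := exp_le_3). assert (h0 := exp_pos 1). nra. }
  assert (hroot : forall N, 729 <= N -> 3 <= Rpower N (1 / 6)).
  { intros N hN. rewrite <- (Rpower_nat_root 3 6) by (lra || lia). replace (INR 6) with 6 by (simpl; ring).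
    apply Rle_Rpower_l; lra. }
  split.
  - intros eps heps. assert (hei : 0 < / eps) by now apply Rinv_pos.
    (* The [/ eps] pays for [ln N <= N^eps / eps]; the 2 covers two multiples of the middle error
       term. *)
    exists (C * (2 + / eps)), 729.
    assert (hK : 0 < C * (2 + / eps)) by (apply Rmult_lt_0_compat; lra).
    split; [auto|]. split; [lra|].
    intros N A hN hA hcA.
    assert (H := HC N A hN hA hcA). eapply Rle_trans; [exact H|]. clear H.
    assert (hl := hlnN N hN). assert (hu := hroot N hN).
    rewrite (Rpower_Ropp A (1 / 3)).
    assert (hN2 : Rpower N (1 / 2 + eps) = Rpower N (1 / 6) ^ 3 * Rpower N eps).
    { rewrite Rpower_plus. f_equal. apply Rpower_split. simpl. field. }
    rewrite hN2.
    assert (hp : 0 < Rpower A (1 / 3)) by apply exp_pos.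
    assert (h9 : 0 < Rpower A (- (1 / 9)) * Rpower N (2 / 9 + eps)) by (apply Rmult_lt_0_compat; apply exp_pos).
    assert (hE : 0 < Rpower N eps) by apply exp_pos.
    assert (hlE : ln N <= / eps * Rpower N eps).
    { assert (h : ln (Rpower N eps) <= Rpower N eps - 1) by now apply ln_le_sub1.
      unfold Rpower in h at 1. rewrite ln_exp in h.
      apply Rmult_le_reg_l with eps; auto. rewrite <- Rmult_assoc, Rinv_r by lra. lra. }
    set (p := Rpower A (1 / 3)) in *. set (u := Rpower N (1 / 6)) in *. set (E := Rpower N eps) in *.
    set (L := ln N) in *. set (T := Rpower A (- (1 / 9)) * _) in *.
    assert (hpi : 0 < / p) by now apply Rinv_pos.
    assert (h1 : 0 < / p * (u ^ 3 * E)) by (repeat apply Rmult_lt_0_compat; lra).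
    assert (h2 : 0 < p * u * L) by (repeat apply Rmult_lt_0_compat; lra).
    (* The balance point is [p = u], that is [A = N^(1/2)]: below it [u^2 <= u^3 / p], above it
       [u^2 <= p u]. *)
    assert (hmain : u ^ 2 * L <= / eps * (/ p * (u ^ 3 * E)) + p * u * L).
    { destruct (Rle_dec p u) as [h|h].
      - assert (hup : 1 <= u * / p) by (rewrite <- (Rinv_r p) by lra; apply Rmult_le_compat_r; lra).
        assert (hu2 : 0 < u ^ 2) by (apply pow_lt; lra).
        apply Rle_trans with (/ eps * (/ p * (u ^ 3 * E))); [|lra].
        replace (/ eps * (/ p * (u ^ 3 * E))) with (u ^ 2 * (/ eps * E) * (u * / p)) by ring.
        rewrite <- (Rmult_1_r (u ^ 2 * L)). apply Rmult_le_compat; try lra.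
        + apply Rmult_le_pos; lra.
        + apply Rmult_le_compat_l; lra.
      - assert (0 < / eps * (/ p * (u ^ 3 * E))) by now apply Rmult_lt_0_compat.
        apply Rle_trans with (p * u * L); [|lra]. apply Rmult_le_compat_r; [lra|]. nra. }
    apply Rle_trans with (C * (/ eps * (/ p * (u ^ 3 * E)) + 2 * (p * u * L))).
    { apply Rmult_le_compat_l; lra. }
    assert (g1 : 0 < C * (2 + / eps) * T) by now apply Rmult_lt_0_compat.
    assert (g2 : 0 <= C * (/ p * (u ^ 3 * E))) by (apply Rmult_le_pos; lra).
    assert (g3 : 0 <= C * (/ eps * (p * u * L))) by (apply Rmult_le_pos; [lra|apply Rmult_le_pos; lra]).
    lra.
  - set (c0 := Rpower c (2 / 3)). assert (hc0 : 0 < c0) by apply exp_pos.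
    assert (hci : 0 < / c0) by now apply Rinv_pos.
    (* For [p <= u] the factor [1 + 2 / c0] bounds [(p u + u^2) / (p^2 u^3)]; the 100 covers the
       trivial bounds in either case. *)
    exists (C * (1 + 2 * / c0) + 100), 729.
    assert (hK0 : 0 < C * (1 + 2 * / c0)) by (apply Rmult_lt_0_compat; lra).
    split; [lra|]. split; [lra|].
    intros N A hN hA hcA.
    change (Cmod (source N A) <= (C * (1 + 2 * / c0) + 100) * (Rpower A (2 / 3) * Rpower N (1 / 2) * ln N)).
    assert (H := HC N A hN hA hcA).
    assert (hl := hlnN N hN). assert (hu := hroot N hN).
    assert (hr := ratio_lower c N A hc ltac:(lra) hcA). fold c0 in hr.
    rewrite (Rpower_split A (2 / 3) (1 / 3) 2) by (simpl; field).
    rewrite (Rpower_split N (1 / 2) (1 / 6) 3) by (simpl; field).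
    assert (hNu : N = Rpower N (1 / 6) ^ 6) by (apply N_pow; lra).
    destruct (big_index (Rpower A (1 / 3)) (Rpower N (1 / 6))) as (K & hK1 & hK2 & hK3).
    destruct (source_parts N A K ltac:(lra) hA hK1) as [s1 s2].
    destruct (target_parts N A K hA hK2) as [t1 t2].
    set (p := Rpower A (1 / 3)) in *. set (u := Rpower N (1 / 6)) in *.
    assert (hlnu : ln (u ^ 6) = ln N) by now rewrite <- hNu.
    assert (hp : 0 < p) by apply exp_pos.
    set (L := ln N) in *.
    assert (hu2 : 0 < u ^ 2) by (apply pow_lt; lra). assert (hu3 : 0 < u ^ 3) by (apply pow_lt; lra).
    assert (hp2 : 0 < p ^ 2) by (apply pow_lt; lra).
    set (B := p ^ 2 * u ^ 3 * L). assert (hB : 0 < B) by (unfold B; repeat apply Rmult_lt_0_compat; lra).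
    (* For [p <= u] the source is compared with the dual sum, whose trivial bound is already of the
       right size. *)
    destruct (Rle_dec p u) as [h|h].
    + assert (ht : Cmod (target N A) <= 2 * (8 * (p ^ 2 * u ^ 3) * (2 + L))).
      { rewrite <- hlnu. apply Cmod_le_parts; [rewrite t1|rewrite t2]; apply dual_sum_bound; lra. }
      assert (hs : Cmod (source N A) <= Cmod (source N A - target N A) + Cmod (target N A)).
      { replace (source N A) with (source N A - target N A + target N A)%C at 1 by ring. apply Cmod_triangle. }
      assert (hdom : p * u + u ^ 2 <= (1 + 2 * / c0) * (p ^ 2 * u ^ 3)).
      { assert (h1 : 1 <= / c0 * (p ^ 2 * u)).
        { rewrite <- (Rinv_l c0) by lra. apply Rmult_le_compat_l; lra. }
        assert (h2 : u ^ 2 <= / c0 * (p ^ 2 * u ^ 3)).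
        { replace (/ c0 * (p ^ 2 * u ^ 3)) with (/ c0 * (p ^ 2 * u) * u ^ 2) by ring.
          rewrite <- (Rmult_1_l (u ^ 2)) at 1. apply Rmult_le_compat_r; lra. }
        assert (h3 : p * u <= u ^ 2) by (simpl; nra).
        assert (0 < p ^ 2 * u ^ 3) by now apply Rmult_lt_0_compat. lra. }
      assert (h4 : C * ((p * u + u ^ 2) * L) <= C * (1 + 2 * / c0) * B).
      { unfold B. replace (C * (1 + 2 * / c0) * (p ^ 2 * u ^ 3 * L)) with (C * ((1 + 2 * / c0) * (p ^ 2 * u ^ 3) * L)) by ring.
        apply Rmult_le_compat_l; [lra|]. apply Rmult_le_compat_r; lra. }
      assert (h5 : p ^ 2 * u ^ 3 * 2 <= B).
      { apply Rmult_le_compat_l; [left; now apply Rmult_lt_0_compat|lra]. }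
      fold B. unfold B in *. lra.
    (* For [p > u] the trivial bound of the source suffices, because [u^5 <= p^2 u^3]. *)
    + assert (hs : Cmod (source N A) <= 2 * (3 * u ^ 5 * (3 + L))).
      { rewrite <- hlnu. apply Cmod_le_parts; [rewrite s1|rewrite s2]; apply weighted_sum_bound; lra. }
      assert (h1 : u ^ 5 * L <= B).
      { apply Rmult_le_compat_r; [lra|]. replace (u ^ 5) with (u ^ 2 * u ^ 3) by ring.
        apply Rmult_le_compat_r; [lra|]. apply pow_incr; lra. }
      assert (h2 : u ^ 5 * 2 <= u ^ 5 * L) by (apply Rmult_le_compat_l; [left; apply pow_lt|]; lra).
      fold B. assert (0 < C * (1 + 2 * / c0) * B) by now apply Rmult_lt_0_compat. lra.
Qed.
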